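(* Let $X$ be a Mumford curve of genus $g(X)>0$ over $\mathbb{Q}_p$ with good fundamental domain $F\subset\mathbb{Q}_p$, and let $G$ be the graph obtained from the semi-stable reduction graph of $X$ (the tree $T(F)$ with $g(X)$ edges attached) by attaching a loop-edge to every vertex, with vertex sets $U_v$ the holed discs decomposing $F$. Let $\alpha>0$, and let $d^\alpha_G=d^\alpha$, $D^\alpha$, $\Delta^\alpha_\rho$, their heat kernels and the index be those attached to $G$ as in the context. Then $$\operatorname{ind}(d^\alpha_G)=\lim_{t\to\infty}\left(\operatorname{tr}(p_{D^\alpha,t})-\operatorname{tr}(p_{\Delta_\rho^\alpha,t})\right)=1-g(X)=\chi(X),$$ where $\chi(X)$ is the Euler characteristic of $X$ with respect to its simplicial cohomology.
   Context: Mumford curve data. $X$ is the quotient of the ordinary points of a Schottky group $\Gamma\subset \mathrm{PGL}_2(\mathbb{Q}_p)$, free of rank $g=g(X)>0$. A good fundamental domain $F$ for $\Gamma$ (Gerritzen–van der Put) is the complement in the projective line of $2g$ open discs $B_1,\dots,B_g,C_1,\dots,C_g$, whose associated closed discs $B_i^+,C_i^+$ are pairwise disjoint, such that $\Gamma$ has free generators $\gamma_1,\dots,\gamma_g$ with $\gamma_i(\mathbb{P}^1\setminus B_i)=C_i^+$ and $\gamma_i(\mathbb{P}^1\setminus B_i^+)=C_i$. It is taken in $\mathbb{Q}_p$ (the point $\infty$ lies in one of the removed discs); the other removed discs are the inner holes of $F$. $T(F)$ is the finite subtree of the Bruhat–Tits tree of $\mathbb{Q}_p$ associated with $F$ (the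 dendrogram for finitely many points, one from each inner hole). Its vertices $v$ index a decomposition $F=\bigsqcup_v U_v$ into holed discs $U_v\subset\mathbb{Q}_p$ (discs with finitely many subdiscs removed). A semi-stable reduction graph of $X$ is obtained by attaching $g$ edges to $T(F)$ (the quotient by $\Gamma$ of an infinite subtree of the Bruhat–Tits tree); it is taken to be a simple connected graph on the vertex set of $T(F)$. $G=(V,E)$ is this graph with one loop-edge attached to each vertex. The Euler characteristic $\chi(X)$ w.r.t. simplicial cohomology is that of the reduction graph viewed as a $1$-dimensional simplicial complex. Operators. $p$ is a prime, $dx$ the Haar measure on $\mathbb{Q}_p$ with $\int_{\mathbb{Z}_p}dx=1$, functions are complex-valued. The sets $U_v$ are pairwise disjoint non-empty compact open and satisfy, for $v\neq w$, $x\in U_v$, $y\in U_w$: $|x-y|_p=\operatorname{dist}(U_v,U_w)$, where $\operatorname{dist}(A,B)=\inf\{|x-y|_p: x\in A,\,y\in B\}$. $\Omega_V=\bigsqcup_v U_v$, and $\Omega_E$ is the union of all $U_v\times U_w$ with $v,w$ joined by an edge of $G$ (both orders; including all $U_v\times U_v$). $L^2(\Omega_E)_\sigma=\{h\in L^2(\Omega_E): h(x,y)=-h(y,x)\}$. For $\alpha>0$: $d^\alpha: L^2(\Omega_V)\to L^2(\Omega_E)_\sigma$, $(d^\alpha f)(x,y)=\dfrac{f(x)-f(y)}{2|x-y|_p^\alpha}$; $\delta^\alpha: L^2(\Omega_E)_\sigma\to L^2(\Omega_V)$, $(\delta^\alpha h)(x)=\int_{\{y\in\Omega_V:(x,y)\in\Omega_E\}}h(x,y)|x-y|_p^{-\alpha}dy$;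 both are possibly unbounded, given by these formulas on locally constant functions and extended by closure. $D^\alpha=\delta^\alpha d^\alpha$ is the closed, non-negative self-adjoint operator on $L^2(\Omega_V)$ determined by its action on locally constant functions. $L^2(\Omega_E)_\rho$ is the finite-dimensional space of $h\in L^2(\Omega_E)_\sigma$ constant on $U_v\times U_w$ for every edge $(v,w)$; $\delta^\alpha_\rho$ is the restriction of $\delta^\alpha$ to it, and $\Delta_\rho^\alpha=d^\alpha\delta_\rho^\alpha$ on $L^2(\Omega_E)_\rho$. $\operatorname{ind}(d^\alpha)=\dim\ker d^\alpha-\dim\ker\delta_\rho^\alpha$. For $A\in\{D^\alpha,\Delta^\alpha_\rho\}$ the heat kernel is $p_{A,t}=\sum_\lambda e^{-\lambda t}f_\lambda(x)\overline{f_\lambda(y)}$ over an orthonormal eigenbasis (eigenvalues with multiplicity), with trace $\operatorname{tr}(p_{A,t})=\sum_\lambda e^{-\lambda t}$.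
   Formalization: The limit of the trace difference is asserted only for α ≥ 1/2 (or if the heat trace of D^α is finite at some t > 0); for α < 1/2, D^α is bounded, its heat trace is infinite for all t, and the limit claim is false. Index, 1−g(X) and χ(X) hold for all α > 0. *)

(* Defs.v *)
From HB Require Import structures.
From mathcomp Require Import all_boot all_order all_algebra.
From mathcomp Require Import complex.
From mathcomp Require Import all_classical all_reals all_analysis.
Set Implicit Arguments.
Unset Strict Implicit.
Unset Printing Implicit Defensive.
Import Order.TTheory GRing.Theory Num.Theory numFieldNormedType.Exports.
Local Open Scope classical_set_scope.
Local Open Scope ring_scope.

Definition padic_norm (R : realType) (p : nat) (q : rat) : R :=
  if q == 0 then 0
  else (p%:R : R) ^ ((logn p `|denq q|%N)%:Z - (logn p `|numq q|%N)%:Z).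

(* Q_p is given by its defining property: it is the completion of rat for the
   p-adic absolute value.  These axioms determine the field with its absolute
   value up to a unique isometric isomorphism. *)
Record padic_field (R : realType) (p : nat) := PadicField {
  padic_carrier : fieldType;
  pabs : padic_carrier -> R;
  pabs_eq0 : forall x, pabs x = 0 <-> x = 0;
  pabsM : forall x y, pabs (x * y) = pabs x * pabs y;
  pabs_ultra : forall x y, pabs (x + y) <= Num.max (pabs x) (pabs y);
  pabs_rat : forall q : rat, pabs (ratr q) = padic_norm R p q;
  padic_dense : forall x (e : R), 0 < e -> exists q : rat, pabs (x - ratr q) < e;
  padic_complete : forall u : nat -> padic_carrier,
    (forall e : R, 0 < e -> exists N, forall m n,
       (N <= m)%N -> (N <= n)%N -> pabs (u m - u n) < e) ->
    exists l, forall e : R, 0 < e -> exists N, forall n,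
       (N <= n)%N -> pabs (u n - l) < e
}.

Definition Qp (R : realType) (p : nat) (K : padic_field R p) : Type :=
  padic_carrier K.
HB.instance Definition _ R p (K : padic_field R p) :=
  GRing.Field.on (@Qp R p K).
HB.instance Definition _ R p (K : padic_field R p) :=
  isPointed.Build (@Qp R p K) (0 : padic_carrier K).

Section Padic.
Context (R : realType) (p : nat) (K : padic_field R p).
Implicit Types (x y : Qp K) (B : set (Qp K)).

Definition disc x (k : int) : set (Qp K) :=
  [set y | pabs (y - x) <= (p%:R : R) ^ k].

Definition is_disc B := exists x k, B = disc x k.

(* Vertices of the Bruhat-Tits tree (homothety classes of lattices in Q_p^2)
   correspond to discs of Q_p, and edges to pairs (disc, maximal subdisc). *)
Definition bt_adj B B' := exists x k,
  (B = disc x k /\ B' = disc x (k + 1)) \/ (B' = disc x k /\ B = disc x (k + 1)).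

Definition QpB := g_sigma_algebraType is_disc.

Definition is_haar (mu : set QpB -> \bar R) :=
  (forall (x : Qp K) (A : set QpB), measurable A ->
     mu [set (a + x : Qp K) | a in (A : set (Qp K))] = mu A) /\
  mu (disc 0 0) = 1%E.

(* None is the point at infinity. *)
Definition P1 := option (Qp K).

Definition moebius (M : 'M[Qp K]_2) (z : P1) : P1 :=
  let a := M 0 0 in let b := M 0 1 in let c := M 1 0 in let d := M 1 1 in
  match z with
  | Some x => if c * x + d == 0 then None else Some ((a * x + b) / (c * x + d))
  | None => if c == 0 then None else Some (a / c)
  end.

(* A subgroup of PGL_2 is encoded by its preimage in GL_2: a group of
   invertible matrices which is stable under nonzero scalars.  An element is
   trivial in PGL_2 when the matrix is scalar. *)
Record pgl_subgroup (Gam : set 'M[Qp K]_2) : Prop := {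
  pgl_unit : forall M, Gam M -> M \in unitmx;
  pgl_one : Gam 1%:M;
  pgl_mul : forall M N, Gam M -> Gam N -> Gam (M *m N);
  pgl_inv : forall M, Gam M -> Gam (invmx M);
  pgl_scale : forall c M, c != 0 -> Gam M -> Gam (c *: M)
}.

(* A word in n letters and their inverses; (i, true) is the inverse of (i, false). *)
Definition word_eval n (gam : 'I_n -> 'M[Qp K]_2) (w : seq ('I_n * bool)) :
    'M[Qp K]_2 :=
  foldr (fun l M => (if l.2 then invmx (gam l.1) else gam l.1) *m M) 1%:M w.

Definition reduced n (w : seq ('I_n * bool)) :=
  sorted (fun l l' => l' != (l.1, ~~ l.2)) w.

Definition pgl_generates n (gam : 'I_n -> 'M[Qp K]_2) (Gam : set 'M[Qp K]_2) :=
  (forall i, Gam (gam i)) /\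
  (forall M, Gam M -> exists c w, M = c *: word_eval gam w).

Definition pgl_free_generators n (gam : 'I_n -> 'M[Qp K]_2)
    (Gam : set 'M[Qp K]_2) :=
  pgl_generates gam Gam /\
  (forall w, reduced w -> w != [::] -> ~~ is_scalar_mx (word_eval gam w)).

(* Over the locally compact field Q_p, discontinuous means discrete. *)
Record schottky_group (Gam : set 'M[Qp K]_2) : Prop := {
  schottky_subgroup : pgl_subgroup Gam;
  schottky_fg : exists n (gam : 'I_n -> 'M[Qp K]_2), pgl_generates gam Gam;
  schottky_torsion_free : forall (M : 'M[Qp K]_2) n, Gam M -> (0 < n)%N ->
    is_scalar_mx (M ^+ n) -> is_scalar_mx M;
  schottky_discrete : exists2 e : R, 0 < e &
    forall M, Gam M -> (forall i j, pabs (M i j - (i == j)%:R) < e) ->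
      is_scalar_mx M
}.

(* (i, false) stands for B_i and (i, true) for C_i. *)
Definition hole (g : nat) := ('I_g * bool)%type.

(* The open disc of the hole h is {z : |z - ctr h| < p ^ rad h}, except for the
   outer hole, the one containing infinity, where it is
   {z : |z - ctr h| > p ^ rad h} together with infinity. *)
Record holes g := Holes {
  ctr : hole g -> Qp K;
  rad : hole g -> int;
  outer : hole g
}.

Section Domain.
Context (g : nat) (D : holes g).

Definition open_hole (h : hole g) : set P1 := [set z |
  match z with
  | Some x => let r := (p%:R : R) ^ rad D h in
      if h == outer D then r < pabs (x - ctr D h) else pabs (x - ctr D h) < r
  | None => h == outer D
  end].

Definition closed_hole (h : hole g) : set P1 := [set z |
  match z with
  | Some x => let r := (p%:R : R) ^ rad D h in
      if h == outer D then r <= pabs (x - ctr D h) else pabs (x - ctr D h) <= r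
  | None => h == outer D
  end].

Record good_fundamental_domain (Gam : set 'M[Qp K]_2)
    (gam : 'I_g -> 'M[Qp K]_2) : Prop := {
  gfd_free : pgl_free_generators gam Gam;
  gfd_disjoint : forall h h', h != h' -> closed_hole h `&` closed_hole h' = set0;
  gfd_open : forall i,
    moebius (gam i) @` (~` open_hole (i, false)) = closed_hole (i, true);
  gfd_closed : forall i,
    moebius (gam i) @` (~` closed_hole (i, false)) = open_hole (i, true)
}.

(* F, as a subset of Q_p: infinity lies in the outer hole. *)
Definition fund_dom : set (Qp K) := [set x | forall h, ~ open_hole h (Some x)].

(* In the Bruhat-Tits tree, the dendrogram of the points s h (h an inner hole),
   with root end infinity, has as vertices the discs containing one of them;
   T(F) is its finite part lying over F: the disc is not inside the hole of the
   point, and does not meet the outer hole. *)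
Definition TF_vertex (s : hole g -> Qp K) B :=
  is_disc B /\
  (forall x, B x -> ~ open_hole (outer D) (Some x)) /\
  exists2 h, h != outer D &
    B (s h) /\ ~ (forall x, B x -> open_hole h (Some x)).

(* The disc of Q_p with the same boundary as the hole h: this is the vertex of
   T(F) at which the hole h is attached. *)
Definition boundary_vertex (h : hole g) : set (Qp K) := disc (ctr D h) (rad D h).

(* gam i carries boundary_vertex (i, false) to boundary_vertex (i, true), which
   is why these two vertices are joined by an edge of the reduction graph. *)
Definition attached_edge (i : 'I_g) B B' :=
  (B = boundary_vertex (i, false) /\ B' = boundary_vertex (i, true)) \/
  (B' = boundary_vertex (i, false) /\ B = boundary_vertex (i, true)).

(* Attaching the g edges to T(F) yields neither loops nor multiple edges. *)
Definition simple_attachment :=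
  (forall i, let B := boundary_vertex (i, false) in
     let B' := boundary_vertex (i, true) in B <> B' /\ ~ bt_adj B B') /\
  (forall i j, i != j ->
     ~ attached_edge i (boundary_vertex (j, false)) (boundary_vertex (j, true))).

Section Graph.
Context (V : finType) (B : V -> set (Qp K)).

Definition reduction_graph : rel V := fun v w =>
  `[< bt_adj (B v) (B w) \/ exists i, attached_edge i (B v) (B w) >].

(* The points of F whose smallest disc in T(F) is B v. *)
Definition holed_disc (v : V) : set (Qp K) := [set x |
  [/\ fund_dom x, B v x & forall w, B w `<` B v -> ~ B w x]].

End Graph.
End Domain.
End Padic.

Definition add_loops (V : finType) (e : rel V) : rel V :=
  fun v w => (v == w) || e v w.

Section Euler.
Context (V : finType) (e : rel V).

Definition coboundary (f : {ffun V -> rat^o}) : {ffun V * V -> rat^o} :=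
  [ffun vw => if e vw.1 vw.2 then f vw.2 - f vw.1 else 0].

Definition edge_cochain (a : V * V) : {ffun V * V -> rat^o} :=
  [ffun vw => (vw == a)%:R - (vw == (a.2, a.1))%:R].

(* Simplicial 1-cochains: the alternating functions on the oriented edges. *)
Definition cochains1 : {vspace {ffun V * V -> rat^o}} :=
  <<[seq edge_cochain a | a <- enum [pred a : V * V | e a.1 a.2]]>>%VS.

(* H^0 = ker coboundary, and H^1 = cochains1 / im coboundary. *)
Definition euler_char : int :=
  (\dim (lker (linfun coboundary)))%:Z
  - ((\dim cochains1)%:Z - (\dim (limg (linfun coboundary)))%:Z).

End Euler.

Section L2.
Context d (T : measurableType d) (R : realType).
Context (mu : {measure set T -> \bar R}) (D : set T).
Local Notation C := R[i].
Implicit Types (f g h : T -> C) (W : set (T -> C)).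

Definition cintegral f : C :=
  Complex (Rintegral mu D (fun x => complex.Re (f x)))
          (Rintegral mu D (fun x => complex.Im (f x))).

Definition sqnorm f : \bar R :=
  (\int[mu]_(x in D)
     (complex.Re (f x) ^+ 2 + complex.Im (f x) ^+ 2)%:E)%E.

Definition L2 f := [/\ measurable_fun D (fun x => complex.Re (f x)),
  measurable_fun D (fun x => complex.Im (f x)) & (sqnorm f < +oo)%E].

Definition L2cvg (u : nat -> T -> C) f :=
  (fun n => sqnorm (fun x => u n x - f x)) @ \oo --> (0 : \bar R).

Definition inner f g : C := cintegral (fun x => f x * conjc (g x)).

Definition ae_on f g := {ae mu, forall x, D x -> f x = g x}.

(* Elements of L^2 are represented by functions, up to ae_on; has_dim W n says
   that W has a basis of n elements. *)
Definition has_dim W (n : nat) := exists b : 'I_n -> T -> C,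
  (forall i, W (b i)) /\
  (forall f, W f ->
     exists! c : {ffun 'I_n -> C}, ae_on f (fun x => \sum_i c i * b i x)).

(* b is an orthonormal basis of the space W consisting of eigenvectors, with
   eigenvalues lam, of the operator on W whose graph is A. *)
Definition orthonormal_eigenbasis W (A : (T -> C) -> (T -> C) -> Prop)
    (I : choiceType) (b : I -> T -> C) (lam : I -> R) :=
  [/\ forall i, W (b i),
      forall i j, inner (b i) (b j) = (i == j)%:R,
      forall f (eps : R), W f -> 0 < eps -> exists (J : seq I) (c : I -> C),
        (sqnorm (fun x => f x - \sum_(i <- J) c i * b i x)%R < eps%:E)%E
    & forall i, A (b i) (fun x => (lam i)%:C%C * b i x)].

(* The trace at time t > 0 of the heat kernel
     p_t(x, y) = \sum_i expR (- lam i * t) b i x (b i y)^*,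
   as a sum in [0, +oo]; it must exist and not depend on the eigenbasis. *)
Definition is_heat_trace W A (tr : R -> \bar R) :=
  (exists (I : choiceType) (b : I -> T -> C) (lam : I -> R),
     orthonormal_eigenbasis W A b lam) /\
  (forall (I : choiceType) (b : I -> T -> C) (lam : I -> R),
     orthonormal_eigenbasis W A b lam ->
     forall t, 0 < t -> tr t = \esum_(i in [set: I]) (expR (- (lam i * t)))%:E).

End L2.

Section Operators.
Context (R : realType) (p : nat) (K : padic_field R p).
Context (mu : {sigma_finite_measure set (QpB K) -> \bar R}).
Context (V : finType) (U : V -> set (QpB K)) (G : rel V) (alpha : R).
Local Notation C := R[i].
Local Notation T := (QpB K).

Definition mu2 : {measure set (T * T) -> \bar R} := (mu \x mu)%E.

Definition OmegaV : set T := [set x | exists v, U v x].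
Definition OmegaE : set (T * T) :=
  [set z | exists v w, [/\ G v w, U v z.1 & U w z.2]].

Definition dist (x y : T) : R := pabs ((x : Qp K) - (y : Qp K)).

Definition d_alpha (f : T -> C) : T * T -> C := fun z =>
  (f z.1 - f z.2) / (2 * (dist z.1 z.2 `^ alpha))%:C%C.

Definition delta_alpha (h : T * T -> C) : T -> C := fun x =>
  cintegral mu [set y | OmegaV y /\ OmegaE (x, y)]
    (fun y => h (x, y) * (dist x y `^ (- alpha))%:C%C).

Definition loc_const (f : T -> C) := forall x, OmegaV x ->
  exists k : int, forall y, OmegaV y -> dist x y <= (p%:R : R) ^ k -> f y = f x.

(* d^alpha as a closed operator: the closure of its graph on locally constant
   functions. *)
Definition d_closed (f : T -> C) (h : T * T -> C) :=
  [/\ L2 mu OmegaV f, L2 mu2 OmegaE h &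
    exists u : nat -> T -> C, [/\ forall n, loc_const (u n),
      L2cvg mu OmegaV u f & L2cvg mu2 OmegaE (fun n => d_alpha (u n)) h]].

Definition D_closed (f k : T -> C) :=
  [/\ L2 mu OmegaV f, L2 mu OmegaV k &
    exists u : nat -> T -> C, [/\ forall n, loc_const (u n),
      L2cvg mu OmegaV u f &
      L2cvg mu OmegaV (fun n => delta_alpha (d_alpha (u n))) k]].

(* Antisymmetry can be required pointwise: replace h by
   (h (x, y) - h (y, x)) / 2 on OmegaE. *)
Definition L2sigma (h : T * T -> C) := L2 mu2 OmegaE h /\
  forall x y, OmegaE (x, y) -> h (x, y) = - h (y, x).

(* A class in this space has exactly one representative on OmegaE that is
   constant on the blocks, because the U v have positive measure. *)
Definition L2rho (h : T * T -> C) := L2sigma h /\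
  forall v w, G v w -> exists c, forall x y, U v x -> U w y -> h (x, y) = c.

Definition Delta_rho (h k : T * T -> C) :=
  L2rho h /\ ae_on mu2 OmegaE k (d_alpha (delta_alpha h)).

Definition ker_d : set (T -> C) := [set f | d_closed f (fun=> 0)].
Definition ker_delta_rho : set (T * T -> C) :=
  [set h | L2rho h /\ ae_on mu OmegaV (delta_alpha h) (fun=> 0)].

Definition is_index (n : int) := exists a b : nat,
  [/\ has_dim mu OmegaV ker_d a, has_dim mu2 OmegaE ker_delta_rho b
    & n = a%:Z - b%:Z].

Definition is_heat_trace_D := is_heat_trace mu OmegaV (L2 mu OmegaV) D_closed.
Definition is_heat_trace_Delta := is_heat_trace mu2 OmegaE L2rho Delta_rho.

End Operators.

(* Main.v *)
Require Import Defs.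
From HB Require Import structures.
From mathcomp Require Import all_boot all_order all_algebra.
From mathcomp Require Import complex ring lra zify.
From mathcomp Require Import all_classical all_reals all_analysis.
From mathcomp Require Import measurable_realfun.
Set Implicit Arguments.
Unset Strict Implicit.
Unset Printing Implicit Defensive.
Import Order.TTheory GRing.Theory Num.Theory numFieldNormedType.Exports.
Local Open Scope classical_set_scope.
Local Open Scope ring_scope.

(** The sets U v are unions of discs at constant mutual distances.  Hence
    L^2(Omega_V) is the orthogonal sum of the functions that are constant on every
    U v and of the functions of mean zero on every U v.

    The second space has an orthonormal basis of wavelets, each carried by a set
    U v or by a disc contained in it, and constant on the maximal proper subdiscs
    ([wave_orthonormal], [level_span]).  Since a point outside of the carrier has the
    same distance to all its points, the wavelets are eigenfunctions of D
    ([wave_eigen]); their eigenvalues have a positive lower bound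
    ([wave_uniform_gap]).  So they contribute neither to the kernel of d nor, in the
    limit, to the trace.

    On the first space, of dimension |V|, the operator d is in orthonormal bases a
    weighted incidence matrix M of the reduction graph and delta is its transpose
    ([d_vertex_fun], [delta_edge_fun]); loops do not matter because antisymmetric
    functions constant on U v x U v vanish there.  So D is M M^T and Delta is M^T M.
    The graph is connected, hence M has rank |V| - 1 ([rank_incidence_mx]): the
    kernel of d has dimension 1, and that of delta has dimension m - |V| + 1, where
    m is the number of edges.  The tree has |V| - 1 edges, because each vertex other
    than the root has a parent, and g edges are attached, so m = |V| - 1 + g
    ([orientation_exists]).  The index is therefore 1 - g = |V| - m, the Euler
    characteristic.

    By Parseval's identity, the trace does not depend on the eigenbasis
    ([heat_trace_unique]).  Its finite-dimensional parts tend to the numbers of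
    zero eigenvalues.  If the wavelet part is finite at a time t0, the spectral gap
    c bounds it at the time t by exp (- c (t - t0)) times its value at t0, which
    tends to 0 ([heat_sum_decay]).  For alpha >= 1/2 it is finite at large times,
    because the eigenvalues grow at least like the logarithm of the index of the
    wavelet ([wave_growth], [wave_heat_finite]).

    That these functions form a basis of L^2 rests on the density of the locally
    constant functions ([loc_const_dense]) and on the fact that such functions are
    constant on the discs of some common radius ([loc_const_uniform]). *)

(** * The p-adic absolute value *)
Section PadicNorm.
Context (R : realType) (p : nat) (p_prime : prime p) (K : padic_field R p).
Implicit Types (x y z : Qp K).
Local Notation q := (p%:R : R).
Local Notation abp x := (pabs (x : Qp K)).

Lemma p_gt1 : 1 < q. Proof. by rewrite ltr1n prime_gt1. Qed.
Lemma p_gt0 : 0 < q. Proof. exact: lt_trans p_gt1. Qed.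
Lemma p_neq0 : q != 0. Proof. by rewrite gt_eqF// p_gt0. Qed.
Lemma pexp_gt0 (k : int) : 0 < q ^ k. Proof. by rewrite exprz_gt0// p_gt0. Qed.
Lemma pexp_le (k l : int) : (q ^ k <= q ^ l) = (k <= l).
Proof. exact: ler_eXz2l p_gt1 k l. Qed.
Lemma pexp_lt (k l : int) : (q ^ k < q ^ l) = (k < l).
Proof. exact: ltr_eXz2l p_gt1 k l. Qed.
Lemma pexpD (k l : int) : q ^ (k + l) = q ^ k * q ^ l.
Proof. by rewrite expfzDr// p_neq0. Qed.

Lemma padic_norm_int (n : int) : n != 0 ->
  padic_norm R p n%:~R = q ^ (- (logn p `|n|%N)%:Z).
Proof.
move=> n0; rewrite /padic_norm intr_eq0 (negPf n0) -{2}[n]mulr1.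
by rewrite numq_int denq_int logn1 add0r mulr1.
Qed.

Lemma pabs0 : (abp 0) = 0. Proof. by apply/pabs_eq0. Qed.
Lemma pabs_mul x y : (abp (x * y)) = (abp x) * (abp y). Proof. exact: pabsM. Qed.
Lemma pabs_ratr (r : rat) : (abp (ratr r)) = padic_norm R p r. Proof. exact: pabs_rat. Qed.
Lemma pabs1 : (abp 1) = 1.
Proof.
have : (abp (1 * 1)) = (abp 1) * (abp 1) by rewrite pabs_mul.
rewrite mul1r => /esym/eqP; rewrite -subr_eq0 -{3}[(abp 1)]mulr1 -mulrBr mulf_eq0 subr_eq0.
by move=> /orP[/eqP/pabs_eq0/eqP|/eqP//]; rewrite oner_eq0.
Qed.
Lemma pabs_add x y : (abp (x + y)) <= Num.max (abp x) (abp y). Proof. exact: pabs_ultra. Qed.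
Lemma pabsN x : (abp (- x)) = (abp x).
Proof.
have e : (abp (-1)) = 1.
  have -> : (-1 : Qp K) = ratr (-1)%:~R by rewrite ratr_int.
  by rewrite pabs_ratr padic_norm_int//= logn1 oppr0.
by rewrite -mulN1r pabs_mul e mul1r.
Qed.
Lemma pabs_ge0 x : 0 <= (abp x).
Proof. by have := pabs_add x (- x); rewrite subrr pabs0 pabsN maxxx. Qed.
Lemma pabs_gt0 x : (0 < (abp x)) = (x != 0).
Proof.
rewrite lt_def pabs_ge0 andbT; congr (~~ _).
by apply/eqP/eqP => [/pabs_eq0//|->]; rewrite pabs0.
Qed.
Lemma pabs_sub x y : (abp (x - y)) = (abp (y - x)).
Proof. by rewrite -pabsN opprB. Qed.
Lemma pabs_addl (r : R) x y : (abp x) <= r -> (abp y) <= r -> (abp (x + y)) <= r.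
Proof. by move=> xr yr; apply: le_trans (pabs_add _ _) _; rewrite ge_max xr. Qed.
Lemma pabs_trans (r : R) x y z : (abp (x - y)) <= r -> (abp (y - z)) <= r -> (abp (x - z)) <= r.
Proof. by move=> xy yz; have := pabs_addl xy yz; rewrite addrA subrK. Qed.
Lemma pabs_addlt (r : R) x y : (abp x) < r -> (abp y) < r -> (abp (x + y)) < r.
Proof. by move=> xr yr; apply: le_lt_trans (pabs_add _ _) _; rewrite gt_max xr. Qed.

Lemma pabs_isosceles x y : (abp y) < (abp x) -> (abp (x + y)) = (abp x).
Proof.
move=> yx; apply/le_anti/andP; split.
  by apply: le_trans (pabs_add _ _) _; rewrite ge_max lexx ltW.
rewrite leNgt; apply/negP => h.
by have := pabs_addlt h (_ : (abp (- y)) < (abp x)); rewrite pabsN addrK ltxx => /(_ yx).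
Qed.

Lemma pabs_val x : x != 0 -> exists k : int, (abp x) = q ^ k.
Proof.
move=> x0; have [|r rx] := @padic_dense _ _ K x (abp x); first by rewrite pabs_gt0.
have -> : (abp x) = (abp (ratr r)).
  have : (abp (ratr r - x)) < (abp x) by rewrite pabs_sub.
  by move=> /pabs_isosceles; rewrite addrC subrK.
rewrite pabs_ratr /padic_norm; case: eqP => [r0|_]; last by eexists.
by move: rx; rewrite r0 -[0]/(0%:~R) ratr_int subr0 ltxx.
Qed.

Lemma padic_norm_le (n : int) (k : nat) :
  (padic_norm R p n%:~R <= q ^ (- k%:Z)) = (p ^ k %| `|n|)%N.
Proof.
have [->|n0] := eqVneq n 0.
  by rewrite dvdn0 /padic_norm eqxx ltW// pexp_gt0.
rewrite padic_norm_int// pexp_le lerN2 lez_nat pfactor_dvdn//.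
by rewrite absz_gt0.
Qed.

Lemma pabs_int_le (n : int) (k : nat) :
  ((abp (n%:~R)) <= q ^ (- k%:Z)) = (p ^ k %| `|n|)%N.
Proof. by rewrite -ratr_int pabs_ratr padic_norm_le. Qed.

(** A rational number close to x has a denominator prime to p, which is
    invertible modulo p^k. *)
Lemma padic_residue x (k : nat) : (abp x) <= 1 ->
  exists2 a : nat, (a < p ^ k)%N & (abp (x - a%:R)) <= q ^ (- k%:Z).
Proof.
move=> x1; have [r xr] := @padic_dense _ _ K x (q ^ (- k%:Z)) (pexp_gt0 _).
have xr' := ltW xr.
have k1 : q ^ (- k%:Z) <= 1 by rewrite -(expr0z q) pexp_le oppr_le0.
have r1 : (abp (ratr r)) <= 1.
  have := pabs_addl (r := 1) (x := ratr r - x) (y := x); rewrite subrK; apply => //.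
  by rewrite pabs_sub (le_trans xr').
have den : coprime p `|denq r|%N.
  rewrite prime_coprime//; apply/negP => pd.
  have r0 : r != 0.
    apply/eqP => r0; move: pd; rewrite r0 (_ : denq 0 = 1)//= dvdn1 => /eqP p1.
    by move: p_prime; rewrite p1.
  move: r1; rewrite pabs_ratr /padic_norm (negPf r0) -{2}(expr0z q) pexp_le.
  have -> : logn p `|numq r| = 0%N.
    rewrite lognE; case: and3P => // -[_ _ pn].
    have := coprime_num_den r; rewrite /coprime => /eqP g1.
    have : (p %| gcdn `|numq r| `|denq r|)%N by rewrite dvdn_gcd pn.
    by rewrite g1 dvdn1 => /eqP p1; move: p_prime; rewrite p1.
  rewrite subr0 lez_nat leqn0 => /eqP l0.
  have := pfactor_dvdn 1 p_prime (m := `|denq r|%N); rewrite expn1 pd l0.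
  by rewrite absz_gt0 denq_neq0 => /(_ isT).
have [u uP] : exists u : int, (p ^ k %| absz (numq r - u * denq r)%R)%N.
  have /coprimezP[[u v] /= uv] : coprimez (denq r) (p ^ k)%N%:Z.
    by rewrite coprimezE /= coprime_sym coprimeXl.
  exists (u * numq r); apply/dvdnP; exists (absz (v * numq r)).
  have -> : numq r - u * numq r * denq r = (v * numq r) * (p ^ k)%N%:Z.
    by rewrite -{1}[numq r]mul1r -uv; ring.
  by rewrite abszM absz_nat.
have pk0 : ((p ^ k)%N%:Z != 0) by rewrite -lt0n expn_gt0 prime_gt0.
have um : 0 <= (u %% (p ^ k)%N%:Z)%Z by rewrite modz_ge0.
exists (absz (u %% (p ^ k)%N%:Z)%Z).
  have := ltz_pmod u (d := (p ^ k)%N%:Z); rewrite ltz_nat expn_gt0 prime_gt0// => /(_ isT).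
  by move: um; case: (u %% _)%Z.
set a := absz _.
have aE : (a%:Z = (u %% (p ^ k)%N%:Z)%Z) by rewrite /a gez0_abs.
apply: pabs_trans xr' _.
have dn0 : (denq r)%:~R != 0 :> Qp K.
  rewrite -pabs_gt0 -ratr_int pabs_ratr /padic_norm intr_eq0 (negPf (denq_neq0 r)).
  exact: pexp_gt0.
have rE : (ratr r : Qp K) * (denq r)%:~R = (numq r)%:~R.
  by rewrite /ratr divfK.
have dn1 : (abp ((denq r)%:~R)) = 1.
  rewrite -ratr_int pabs_ratr padic_norm_int ?denq_neq0// logn_coprime//.
suff : abp ((ratr r - a%:R) * (denq r)%:~R) <= q ^ (- k%:Z).
  by rewrite pabs_mul dn1 mulr1.
rewrite mulrBl rE.
have -> : (a%:R : Qp K) = (a%:Z)%:~R by [].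
rewrite -intrM -intrB pabs_int_le aE.
have key (m : int) : (p ^ k %| absz m)%N = ((p ^ k)%N%:Z %| m)%Z by [].
move: uP; rewrite !key => uP.
have -> : numq r - (u %% (p ^ k)%N%:Z)%Z * denq r =
    (numq r - u * denq r) + ((u %/ (p ^ k)%N%:Z)%Z * denq r) * (p ^ k)%N%:Z.
  by rewrite {2}(divz_eq u (p ^ k)%N%:Z); ring.
by rewrite rpredD// dvdz_mull.
Qed.

Lemma nat_padic_inj (k a b : nat) : (a < p ^ k)%N -> (b < p ^ k)%N ->
  (abp (a%:R - b%:R)) <= q ^ (- k%:Z) -> a = b.
Proof.
wlog ab : a b / (a <= b)%N.
  move=> w a1 b1 h; have /orP[ab|ba] := leq_total a b; first exact: w.
  by apply/esym/w => //; rewrite pabs_sub.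
move=> ak bk; rewrite pabs_sub -natrB// -[(b - a)%:R]/((b - a)%N%:Z%:~R) pabs_int_le /=.
have [//|lt_ab] := eqVneq a b.
have ba0 : (0 < b - a)%N by rewrite subn_gt0 ltn_neqAle lt_ab.
by move=> /(dvdn_leq ba0) h; lia.
Qed.
End PadicNorm.

(** * Discs and Haar measure *)
Section Discs.
Context (R : realType) (p : nat) (p_prime : prime p) (K : padic_field R p).
Implicit Types (x y z : Qp K) (k l : int).
Local Notation q := (p%:R : R).

(** An element of absolute value p^k. *)
Definition scale k : Qp K := p%:R ^ (- k).

Lemma pabs_pnat : pabs (p%:R : Qp K) = q ^ (-1).
Proof.
rewrite -[p%:R]/(p%:Z%:~R : Qp K) -ratr_int pabs_ratr padic_norm_int//=.
  by rewrite logn_prime// eqxx.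
by have := prime_gt0 p_prime; case: (p).
Qed.

Lemma pabs_expn x (n : nat) : pabs (x ^+ n : Qp K) = pabs x ^+ n.
Proof.
elim: n => [|n IH]; first by rewrite !expr0 pabs1.
by rewrite !exprS pabs_mul IH.
Qed.

Lemma pabs_inv x : pabs (x^-1 : Qp K) = (pabs x)^-1.
Proof.
have [->|x0] := eqVneq x 0; first by rewrite invr0 pabs0 invr0.
have : pabs (x^-1 * x) = pabs (x^-1) * pabs x by rewrite pabs_mul.
rewrite mulVf// pabs1 => h; apply: (mulIf (x := pabs x)).
  by rewrite gt_eqF// pabs_gt0.
by rewrite -h mulVf// gt_eqF// pabs_gt0.
Qed.

Lemma pabs_scale k : pabs (scale k) = q ^ k.
Proof.
have pn (n : nat) : pabs ((p%:R : Qp K) ^+ n) = q ^ (- n%:Z).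
  by rewrite pabs_expn pabs_pnat exprnP exprz_exp mulN1r.
rewrite /scale; case: k => n; last by rewrite NegzE opprK -exprnP pn.
by rewrite -invr_expz pabs_inv -exprnP pn invr_expz opprK.
Qed.

Lemma disc_refl x k : disc x k x.
Proof. by rewrite /disc /= subrr pabs0 ltW// pexp_gt0. Qed.

Lemma disc_sym x y k : disc x k y -> disc y k x.
Proof. by rewrite /disc /= pabs_sub. Qed.

Lemma disc_le x k l : k <= l -> disc x k `<=` disc x l.
Proof. by move=> kl y /= /le_trans; apply; rewrite pexp_le. Qed.

Lemma disc_trans x y z k : disc x k y -> disc y k z -> disc x k z.
Proof. by rewrite /disc /= => xy yz; apply: pabs_trans yz xy. Qed.

Lemma disc_eq x y k : disc x k y -> disc x k = disc y k.
Proof.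
move=> xy; apply/seteqP; split=> z; last exact: disc_trans.
exact/disc_trans/disc_sym.
Qed.

Lemma disc_subset x y k l : disc x k `<=` disc y l -> k <= l /\ disc y l x.
Proof.
move=> s; have yx := s _ (disc_refl x k); split=> //.
have : disc y l (x + scale k) by apply: s; rewrite /disc /= addrAC subrr add0r pabs_scale.
move=> h; rewrite -(pexp_le R p_prime) -(pabs_scale k).
have := pabs_trans (K := K) (r := q ^ l) (x := x + scale k) (y := y) (z := x).
by rewrite [x + _]addrC addrK; apply; [rewrite addrC|rewrite pabs_sub].
Qed.

Lemma disc_inj x y k l : disc x k = disc y l -> k = l.
Proof.
move=> e; have [kl _] : k <= l /\ disc y l x by apply: disc_subset; rewrite e.
have [lk _] : l <= k /\ disc x k y by apply: disc_subset; rewrite e.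
by apply/le_anti; rewrite kl.
Qed.

Lemma disc_nested x y z k l : k <= l -> disc x k z -> disc y l z ->
  disc x k `<=` disc y l.
Proof.
move=> kl xz yz; rewrite (disc_eq xz) (disc_eq yz); exact: disc_le.
Qed.

Lemma disc_far x y x' k : disc x k x' -> ~ disc x k y -> pabs (x' - y) = pabs (x - y).
Proof.
rewrite /disc /= => xx' /negP; rewrite -ltNge => xy.
have -> : x' - y = (x - y) + (x' - x) by rewrite [RHS]addrC addrA subrK.
apply: pabs_isosceles.
by apply: le_lt_trans xx' _; rewrite pabs_sub.
Qed.

(** The absolute value takes no values strictly between p^(k-1) and p^k. *)
Lemma disc_shell x y k : disc x k y -> ~ disc x (k - 1) y -> pabs (x - y) = q ^ k.
Proof.
rewrite /disc /= => xy /negP; rewrite -ltNge => nxy.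
have yx0 : y - x != 0 by rewrite -pabs_gt0 (lt_trans _ nxy)// pexp_gt0.
have [l lE] := pabs_val yx0; rewrite pabs_sub lE.
move: xy nxy; rewrite lE pexp_le// pexp_lt// => lk kl.
by congr (_ ^ _); apply/le_anti; rewrite lk -ltzD1 -ltrBlDr.
Qed.

Lemma pabs_nat_le1 (n : nat) : pabs (n%:R : Qp K) <= 1.
Proof. by rewrite -(expr0z q) -[0]/(- 0%N%:Z) (pabs_int_le p_prime K n%:Z 0) dvd1n. Qed.

Definition subcentre x k (a : nat) : Qp K := x + a%:R * scale k.

Lemma subcentre_in x k a : disc x k (subcentre x k a).
Proof.
rewrite /disc /subcentre /= [x + _]addrC addrK pabs_mul pabs_scale.
by rewrite ler_piMl ?pabs_nat_le1// ltW// pexp_gt0.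
Qed.

Lemma subcentre_dist x k a b n :
  disc (subcentre x k a) (k - n%:Z) (subcentre x k b) =
  (pabs (a%:R - b%:R : Qp K) <= q ^ (- n%:Z)) :> Prop.
Proof.
rewrite /disc /subcentre /= pabs_sub opprD addrACA subrr add0r -mulrBl.
by rewrite pabs_mul pabs_scale [k - _]addrC pexpD// ler_pM2r// pexp_gt0.
Qed.

Lemma subcentre_exists x y k n : disc x k y ->
  exists2 a, (a < p ^ n)%N & disc (subcentre x k a) (k - n%:Z) y.
Proof.
move=> xy; have sk0 : scale k != 0 by rewrite -pabs_gt0 pabs_scale pexp_gt0.
have [|a an ya] := @padic_residue _ _ p_prime K ((y - x) / scale k) n.
  rewrite pabs_mul pabs_inv pabs_scale ler_pdivrMr ?mul1r//; exact: pexp_gt0.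
exists a => //; rewrite /disc /= /subcentre opprD addrA.
rewrite -[y - x](divfK sk0) -mulrBl pabs_mul pabs_scale [k - _]addrC pexpD//.
by rewrite ler_pM2r// pexp_gt0.
Qed.

Lemma subcentre_uniq x y k n a b : (a < p ^ n)%N -> (b < p ^ n)%N ->
  disc (subcentre x k a) (k - n%:Z) y -> disc (subcentre x k b) (k - n%:Z) y -> a = b.
Proof.
move=> an bn ay by_; apply: (nat_padic_inj p_prime (K := K) an bn).
rewrite -(subcentre_dist x k); exact: disc_trans ay (disc_sym by_).
Qed.

Lemma subcentre_mod x k n a : disc (subcentre x k a) (k - n%:Z) (subcentre x k (a %% p ^ n)).
Proof.
rewrite subcentre_dist {1}(divn_eq a (p ^ n)) natrD addrK.
by rewrite (pabs_int_le p_prime K (a %/ p ^ n * p ^ n)%N%:Z n); exact: dvdn_mull.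
Qed.

Section Haar.
Context (mu : {sigma_finite_measure set (QpB K) -> \bar R}) (mu_haar : is_haar mu).

Lemma measurable_disc x k : measurable (disc x k : set (QpB K)).
Proof. by apply: sub_gen_smallest; exists x, k. Qed.

Lemma haar_disc0 x k : mu (disc x k) = mu (disc 0 k).
Proof.
have [tr _] := mu_haar; rewrite -(tr x _ (measurable_disc 0 k)); congr (mu _).
apply/seteqP; split=> y /=.
  by move=> xy; exists (y - x); rewrite ?subrK// /disc /= subr0.
by move=> [z]; rewrite /disc /= subr0 => zk <-; rewrite addrK.
Qed.

(** The disc of radius p^k is the disjoint union of p^n translates of the disc
    of radius p^(k-n). *)
Lemma haar_split k (n : nat) : mu (disc 0 k) = ((p ^ n)%:R%:E * mu (disc (0%R : Qp K) (k - n%:Z)%R))%E.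
Proof.
have -> : disc (0 : Qp K) k = \big[setU/set0]_(a < p ^ n) disc (subcentre 0 k a) (k - n%:Z).
  rewrite -(bigcup_mkord _ (fun a => disc (subcentre 0 k a) (k - n%:Z))); apply/seteqP; split=> y.
    by move=> /(subcentre_exists n)[a an ay]; exists a.
  move=> [a _ ay]; apply: disc_trans (subcentre_in _ _ _) _.
  by apply: disc_le ay; rewrite gerDl oppr_le0.
rewrite measure_bigsetU_ord//=; last 2 first.
- by move=> a; exact: measurable_disc.
- apply/trivIsetP => a b _ _ ab; apply/seteqP; split=> // y [ay by_].
  move: ab; rewrite (_ : a = b) ?eqxx//.
  exact/val_inj/(subcentre_uniq (ltn_ord a) (ltn_ord b) ay by_).
rewrite (eq_bigr (fun=> mu (disc 0 (k - n%:Z)))) => [|a _]; last by rewrite haar_disc0.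
by rewrite sumr_const card_ord mule_natl.
Qed.

Lemma haar_disc x k : mu (disc x k) = (q ^ k)%:E.
Proof.
rewrite haar_disc0; have [_ one] := mu_haar.
have pn0 n : (p ^ n)%:R != 0 :> R by rewrite pnatr_eq0 expn_eq0 negb_and -lt0n prime_gt0.
case: k => n; last rewrite NegzE.
  by rewrite (haar_split n%:Z n) subrr one mule1 natrX.
have := haar_split 0 n.+1; rewrite one sub0r.
case: (mu _) => [r| |]; last 2 first.
- by rewrite gt0_muley// lte_fin lt0r pn0 ler0n.
- by rewrite gt0_muleNy// lte_fin lt0r pn0 ler0n.
move=> [h]; congr (_%:E); apply: (mulfI (pn0 n.+1)); rewrite -h natrX.
by rewrite exprnP -exprnN mulfV// expf_neq0// p_neq0.
Qed.

End Haar.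
End Discs.

(** * Square integrable complex functions *)
Section ComplexParts.
Context (R : realType).
Local Notation C := R[i].
Local Notation Re := complex.Re.
Local Notation Im := complex.Im.
Implicit Types z w : C.

Definition sqmod z : R := Re z ^+ 2 + Im z ^+ 2.

Lemma ReD z w : Re (z + w) = Re z + Re w. Proof. by case: z w => ? ? []. Qed.
Lemma ImD z w : Im (z + w) = Im z + Im w. Proof. by case: z w => ? ? []. Qed.
Lemma ReN z : Re (- z) = - Re z. Proof. by case: z. Qed.
Lemma ImN z : Im (- z) = - Im z. Proof. by case: z. Qed.
Lemma ReM z w : Re (z * w) = Re z * Re w - Im z * Im w. Proof. by case: z w => ? ? []. Qed.
Lemma ImM z w : Im (z * w) = Re z * Im w + Im z * Re w. Proof. by case: z w => ? ? []. Qed.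
Lemma ReJ z : Re (conjc z) = Re z. Proof. by case: z. Qed.
Lemma ImJ z : Im (conjc z) = - Im z. Proof. by case: z. Qed.
Lemma complex_eq z w : Re z = Re w -> Im z = Im w -> z = w.
Proof. by case: z w => a b [c d] /= -> ->. Qed.
Lemma conjcD z w : conjc (z + w) = conjc z + conjc w.
Proof. by case: z w => ? ? [? ?]; apply: complex_eq; rewrite //= opprD. Qed.
Lemma conjcM z w : conjc (z * w) = conjc z * conjc w.
Proof. exact: (rmorphM (@conjc R)). Qed.
Lemma conjcN z : conjc (- z) = - conjc z. Proof. by case: z. Qed.
Lemma conjc0 : conjc 0 = 0 :> C. Proof. by apply: complex_eq; rewrite //= oppr0. Qed.
Lemma conjc_sum (I : Type) (r : seq I) (P : pred I) (F : I -> C) :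
  conjc (\sum_(i <- r | P i) F i) = \sum_(i <- r | P i) conjc (F i).
Proof. exact: (big_morph _ conjcD conjc0). Qed.
Definition partE := (ReD, ImD, ReN, ImN, ReM, ImM, ReJ, ImJ).

Lemma sqmod_ge0 z : 0 <= sqmod z. Proof. by rewrite addr_ge0// sqr_ge0. Qed.
Lemma sqmod0 : sqmod 0 = 0. Proof. by rewrite /sqmod /= expr0n addr0. Qed.
Lemma sqmod_eq0 z : sqmod z = 0 -> z = 0.
Proof.
move=> /eqP; rewrite paddr_eq0 ?sqr_ge0// !sqrf_eq0 => /andP[/eqP a /eqP b].
by apply: complex_eq.
Qed.
Lemma sqmodN z : sqmod (- z) = sqmod z. Proof. by rewrite /sqmod !partE !sqrrN. Qed.
Lemma sqmodJ z : sqmod (conjc z) = sqmod z. Proof. by rewrite /sqmod !partE sqrrN. Qed.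
Lemma sqmodM z w : sqmod (z * w) = sqmod z * sqmod w. Proof. by rewrite /sqmod !partE; ring. Qed.
Lemma sqmod_real (r : R) : sqmod (r%:C)%C = r ^+ 2. Proof. by rewrite /sqmod /= expr0n addr0. Qed.
Lemma sqmodD z w : sqmod (z + w) <= 2 * sqmod z + 2 * sqmod w.
Proof.
rewrite /sqmod !partE -subr_ge0.
have -> : 2 * (Re z ^+ 2 + Im z ^+ 2) + 2 * (Re w ^+ 2 + Im w ^+ 2) -
  ((Re z + Re w) ^+ 2 + (Im z + Im w) ^+ 2) =
  (Re z - Re w) ^+ 2 + (Im z - Im w) ^+ 2 by ring.
by rewrite addr_ge0// sqr_ge0.
Qed.
Lemma mulJ z : z * conjc z = ((sqmod z)%:C)%C.
Proof. by apply: complex_eq; rewrite !partE /sqmod /=; ring. Qed.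
Lemma sqmod_nat (b : bool) : sqmod (b%:R) = b%:R.
Proof. by case: b; rewrite ?sqmod0// /sqmod /= expr0n addr0 expr1n. Qed.
Lemma conjc_real (r : R) : conjc (r%:C)%C = (r%:C)%C.
Proof. by rewrite /conjc /= oppr0. Qed.
Lemma realM (r s : R) : ((r * s)%:C)%C = (r%:C)%C * (s%:C)%C.
Proof. exact: (rmorphM (real_complex R)). Qed.
Lemma realB (r s : R) : ((r - s)%:C)%C = (r%:C)%C - (s%:C)%C.
Proof. exact: (rmorphB (real_complex R)). Qed.
Lemma real_nat (n : nat) : ((n%:R : R)%:C)%C = n%:R.
Proof. exact: (rmorph_nat (real_complex R)). Qed.
Lemma real_sum (I : Type) (r : seq I) (P : pred I) (F : I -> R) :
  ((\sum_(i <- r | P i) F i)%:C)%C = \sum_(i <- r | P i) ((F i)%:C)%C.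
Proof. exact: (rmorph_sum (real_complex R)). Qed.
Lemma real_inj (r s : R) : (r%:C)%C = (s%:C)%C -> r = s. Proof. by case. Qed.
Lemma conjc_nat (n : nat) : conjc (n%:R : C) = n%:R.
Proof. by rewrite rmorph_nat. Qed.

End ComplexParts.

Section L2theory.
Context d (T : measurableType d) (R : realType).
Context (mu : {measure set T -> \bar R}) (D : set T) (mD : measurable D).
Local Notation C := R[i].
Local Notation Re := complex.Re.
Local Notation Im := complex.Im.
Implicit Types (f g h : T -> C).
Local Notation L2 := (L2 mu D).
Local Notation inner := (inner mu D).
Local Notation sqnorm := (sqnorm mu D).

Definition cmeas f := measurable_fun D (fun x => Re (f x)) /\
  measurable_fun D (fun x => Im (f x)).

Lemma cmeasD f g : cmeas f -> cmeas g -> cmeas (fun x => f x + g x).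
Proof.
move=> [f1 f2] [g1 g2]; split.
  by under eq_fun do rewrite ReD; exact: measurable_funD.
by under eq_fun do rewrite ImD; exact: measurable_funD.
Qed.

Lemma cmeasM f g : cmeas f -> cmeas g -> cmeas (fun x => f x * g x).
Proof.
move=> [f1 f2] [g1 g2]; split.
  by under eq_fun do rewrite ReM; apply: measurable_funB; exact: measurable_funM.
by under eq_fun do rewrite ImM; apply: measurable_funD; exact: measurable_funM.
Qed.

Lemma cmeas_cst c : cmeas (fun=> c).
Proof. by split; exact: measurable_cst. Qed.

Lemma measurable_sqmod f : cmeas f -> measurable_fun D (fun x => sqmod (f x)).
Proof. by move=> [f1 f2]; apply: measurable_funD; exact: measurable_funX. Qed.

Lemma sqnormE f : sqnorm f = (\int[mu]_(x in D) (sqmod (f x))%:E)%E.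
Proof. by []. Qed.

Lemma sqnorm_ge0 f : (0 <= sqnorm f)%E.
Proof. by apply: integral_ge0 => x _; rewrite lee_fin sqmod_ge0. Qed.

Lemma eq_sqnorm f g : (forall x, D x -> f x = g x) -> sqnorm f = sqnorm g.
Proof.
by move=> fg; apply: eq_integral => x /set_mem Dx; rewrite (fg x Dx).
Qed.

Lemma eq_cmeas f g : (forall x, D x -> f x = g x) -> cmeas f -> cmeas g.
Proof.
move=> fg [f1 f2]; split.
  by apply: eq_measurable_fun f1 => x /set_mem Dx; rewrite fg.
by apply: eq_measurable_fun f2 => x /set_mem Dx; rewrite fg.
Qed.

Lemma eq_L2 f g : (forall x, D x -> f x = g x) -> L2 f -> L2 g.
Proof.
move=> fg [f1 f2 f3]; have [g1 g2] := eq_cmeas fg (conj f1 f2).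
by split=> //; rewrite -(eq_sqnorm fg).
Qed.

Lemma L2_cmeas f : L2 f -> cmeas f. Proof. by case. Qed.

Lemma measurable_sqmodE f : cmeas f -> measurable_fun D (fun x => (sqmod (f x))%:E).
Proof. by move=> mf; apply/measurable_EFinP; exact: measurable_sqmod. Qed.

Lemma sqnorm_le f g (a b : R) h : 0 <= a -> 0 <= b -> cmeas f -> cmeas g ->
  cmeas h ->
  (forall x, D x -> sqmod (h x) <= a * sqmod (f x) + b * sqmod (g x)) ->
  (sqnorm h <= a%:E * sqnorm f + b%:E * sqnorm g)%E.
Proof.
move=> a0 b0 mf mg mh H; rewrite !sqnormE.
rewrite -!ge0_integralZl_EFin//; do ?[by move=> x _; rewrite lee_fin sqmod_ge0];
  do ?exact: measurable_sqmodE.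
rewrite -ge0_integralD//; last 4 first.
- by move=> x _; rewrite mule_ge0 ?lee_fin ?sqmod_ge0.
- by apply: measurable_funeM; exact: measurable_sqmodE.
- by move=> x _; rewrite mule_ge0 ?lee_fin ?sqmod_ge0.
- by apply: measurable_funeM; exact: measurable_sqmodE.
apply: ge0_le_integral => //.
- by move=> x _; rewrite lee_fin sqmod_ge0.
- exact: measurable_sqmodE.
- by apply: emeasurable_funD; apply: measurable_funeM; exact: measurable_sqmodE.
Qed.

Lemma L2D f g : L2 f -> L2 g -> L2 (fun x => f x + g x).
Proof.
move=> Lf Lg; have [mf mg] := (L2_cmeas Lf, L2_cmeas Lg).
have mfg := cmeasD mf mg; have [h1 h2] := mfg; split=> //.
apply: (@le_lt_trans _ _ (2%:E * sqnorm f + 2%:E * sqnorm g)%E).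
  by apply: sqnorm_le => // x _; exact: sqmodD.
by case: Lf Lg => _ _ Lf [_ _ Lg]; rewrite lte_add_pinfty// lte_mul_pinfty.
Qed.

Lemma L2Z c f : L2 f -> L2 (fun x => c * f x).
Proof.
move=> Lf; have mf := L2_cmeas Lf; have mcf := cmeasM (cmeas_cst c) mf.
have [h1 h2] := mcf; split=> //.
apply: (@le_lt_trans _ _ ((sqmod c)%:E * sqnorm f + 0%:E * sqnorm f)%E).
  apply: sqnorm_le => //; first exact: sqmod_ge0.
  by move=> x _; rewrite sqmodM mul0r addr0.
by case: Lf => _ _ Lf; rewrite mul0e adde0 lte_mul_pinfty// lee_fin sqmod_ge0.
Qed.

Lemma L2_0 : L2 (fun=> 0).
Proof.
have [h1 h2] := cmeas_cst 0; split=> //.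
by rewrite sqnormE integral0_eq// => x _; rewrite sqmod0.
Qed.

Lemma L2B f g : L2 f -> L2 g -> L2 (fun x => f x - g x).
Proof.
move=> Lf Lg; have := L2D Lf (L2Z (-1) Lg).
by apply: eq_L2 => x _; rewrite mulN1r.
Qed.

Lemma L2_sum (I : Type) (r : seq I) (P : pred I) (F : I -> T -> C) :
  (forall i, P i -> L2 (F i)) -> L2 (fun x => \sum_(i <- r | P i) F i x).
Proof.
move=> LF; elim: r => [|i r IH].
  by apply: eq_L2 L2_0 => x _; rewrite big_nil.
have [Pi|nPi] := boolP (P i).
  by apply: eq_L2 (L2D (LF i Pi) IH) => x _; rewrite big_cons Pi.
by apply: eq_L2 IH => x _; rewrite big_cons (negPf nPi).
Qed.

Lemma sqnorm_fin f : L2 f -> sqnorm f \is a fin_num.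
Proof. by case=> _ _ h; rewrite ge0_fin_numE// sqnorm_ge0. Qed.

Definition sqnrm f : R := fine (sqnorm f).

Lemma sqnrmE f : L2 f -> sqnorm f = (sqnrm f)%:E.
Proof. by move=> Lf; rewrite fineK// sqnorm_fin. Qed.

Lemma sqnrm_ge0 f : 0 <= sqnrm f.
Proof. by rewrite fine_ge0// sqnorm_ge0. Qed.

Lemma integrable_re f g : L2 f -> L2 g ->
  mu.-integrable D (EFin \o (fun x => Re (f x) * Re (g x))) /\
  mu.-integrable D (EFin \o (fun x => Im (f x) * Im (g x))) /\
  mu.-integrable D (EFin \o (fun x => Re (f x) * Im (g x))) /\
  mu.-integrable D (EFin \o (fun x => Im (f x) * Re (g x))).
Proof.
move=> Lf Lg.
have key (u v : T -> R) : measurable_fun D u -> measurable_fun D v ->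
    (forall x, `|u x * v x| <= sqmod (f x) + sqmod (g x)) ->
    mu.-integrable D (EFin \o (fun x => u x * v x)).
  move=> mu_ mv H.
  apply: (@le_integrable _ _ _ mu D mD _ (fun x => (sqmod (f x))%:E + (sqmod (g x))%:E)%E).
  - by apply/measurable_EFinP; exact: measurable_funM.
  - move=> x _; rewrite -EFinD !abse_EFin lee_fin; apply: le_trans (H x) _.
    exact: ler_norm.
  - have i1 u_ : L2 u_ -> mu.-integrable D (fun x => (sqmod (u_ x))%:E).
      move=> Lu; apply/integrableP; split; first exact/measurable_sqmodE/L2_cmeas.
      under eq_integral do rewrite abse_EFin ger0_norm ?sqmod_ge0//.
      by case: Lu.
    by apply: integrableD => //; exact: i1.
have b (a1 a2 b1 b2 : R) : `|a1 * b1| <= (a1 ^+ 2 + a2 ^+ 2) + (b1 ^+ 2 + b2 ^+ 2).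
  rewrite normrM.
  have h0 : 0 <= (`|a1| - `|b1|) ^+ 2 by exact: sqr_ge0.
  have := sqr_ge0 a2; have := sqr_ge0 b2.
  have := sqr_ge0 `|a1|; have := sqr_ge0 `|b1|.
  rewrite -(real_normK (num_real a1)) -(real_normK (num_real b1)).
  move: `|a1| `|b1| h0 => x y h0 *; nra.
case: Lf Lg key => f1 f2 _ [g1 g2 _] key.
do !split; apply: key => // x; rewrite /sqmod; first exact: b.
- by rewrite [X in _ <= X + _]addrC [X in _ <= _ + X]addrC; exact: b.
- by rewrite [X in _ <= _ + X]addrC; exact: b.
- by rewrite [X in _ <= X + _]addrC; exact: b.
Qed.

Lemma inner_parts f g : L2 f -> L2 g -> inner f g = Complex
  (\int[mu]_(x in D) (Re (f x) * Re (g x)) + \int[mu]_(x in D) (Im (f x) * Im (g x)))%R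
  (\int[mu]_(x in D) (Im (f x) * Re (g x)) - \int[mu]_(x in D) (Re (f x) * Im (g x)))%R.
Proof.
move=> Lf Lg; have [i1 [i2 [i3 i4]]] := integrable_re Lf Lg.
rewrite -RintegralD// -RintegralB// /inner /cintegral; congr Complex;
  apply: eq_Rintegral => x _; rewrite !partE; ring.
Qed.

Lemma eq_inner f g f' g' : (forall x, D x -> f x = f' x) ->
  (forall x, D x -> g x = g' x) -> inner f g = inner f' g'.
Proof.
by move=> ff' gg'; rewrite /inner /cintegral; congr Complex;
  apply: eq_Rintegral => x /set_mem Dx; rewrite ff' ?gg'.
Qed.

Lemma innerC f g : L2 f -> L2 g -> inner g f = conjc (inner f g).
Proof.
move=> Lf Lg; rewrite !inner_parts//=; congr Complex.
  by congr (_ + _); apply: eq_Rintegral => x _; rewrite mulrC.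
by rewrite opprB; congr (_ - _); apply: eq_Rintegral => x _; rewrite mulrC.
Qed.

Lemma innerDl f f' g : L2 f -> L2 f' -> L2 g ->
  inner (fun x => f x + f' x) g = inner f g + inner f' g.
Proof.
move=> Lf Lf' Lg; rewrite !inner_parts//; last exact: L2D.
have [i1 [i2 [i3 i4]]] := integrable_re Lf Lg.
have [j1 [j2 [j3 j4]]] := integrable_re Lf' Lg.
have e (u v : T -> R) : (forall x, u x = v x) ->
  Rintegral mu D u = Rintegral mu D v by move=> uv; apply: eq_Rintegral.
rewrite (e (fun x => Re (f x + f' x) * Re (g x)) (fun x => Re (f x) * Re (g x) + Re (f' x) * Re (g x))); last first.
  by move=> x; rewrite !partE mulrDl.
rewrite (e (fun x => Im (f x + f' x) * Im (g x)) (fun x => Im (f x) * Im (g x) + Im (f' x) * Im (g x))); last first.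
  by move=> x; rewrite !partE mulrDl.
rewrite (e (fun x => Im (f x + f' x) * Re (g x)) (fun x => Im (f x) * Re (g x) + Im (f' x) * Re (g x))); last first.
  by move=> x; rewrite !partE mulrDl.
rewrite (e (fun x => Re (f x + f' x) * Im (g x)) (fun x => Re (f x) * Im (g x) + Re (f' x) * Im (g x))); last first.
  by move=> x; rewrite !partE mulrDl.
by rewrite !RintegralD//; apply: complex_eq; rewrite !partE /=; ring.
Qed.

Lemma innerZl c f g : L2 f -> L2 g -> inner (fun x => c * f x) g = c * inner f g.
Proof.
move=> Lf Lg; rewrite !inner_parts//; last exact: L2Z.
have [i1 [i2 [i3 i4]]] := integrable_re Lf Lg.
have iZ (a : R) (u : T -> R) : mu.-integrable D (EFin \o u) ->
    mu.-integrable D (EFin \o (fun x => a * u x)).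
  by move=> iu; exact: (integrableZl mD a iu).
have e (a b : R) (u v w : T -> R) : mu.-integrable D (EFin \o v) ->
    mu.-integrable D (EFin \o w) -> (forall x, u x = a * v x + b * w x) ->
    Rintegral mu D u = a * Rintegral mu D v + b * Rintegral mu D w.
  move=> iv iw uE; rewrite -!RintegralZl// -RintegralD//; do ?exact: iZ.
  exact: eq_Rintegral.
rewrite (e (Re c) (- Im c) (fun x => Re (c * f x) * Re (g x)) _ _ i1 i4) => [|x]; last by rewrite !partE; ring.
rewrite (e (Re c) (Im c) (fun x => Im (c * f x) * Im (g x)) _ _ i2 i3) => [|x]; last by rewrite !partE; ring.
rewrite (e (Re c) (Im c) (fun x => Im (c * f x) * Re (g x)) _ _ i4 i1) => [|x]; last by rewrite !partE; ring.
rewrite (e (Re c) (- Im c) (fun x => Re (c * f x) * Im (g x)) _ _ i3 i2) => [|x]; last by rewrite !partE; ring.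
by apply: complex_eq; rewrite !partE /=; ring.
Qed.

Lemma innerDr f g g' : L2 f -> L2 g -> L2 g' ->
  inner f (fun x => g x + g' x) = inner f g + inner f g'.
Proof.
move=> Lf Lg Lg'; rewrite (innerC (L2D Lg Lg') Lf) innerDl//.
by rewrite conjcD -(innerC Lg Lf) -(innerC Lg' Lf).
Qed.

Lemma innerZr c f g : L2 f -> L2 g ->
  inner f (fun x => c * g x) = conjc c * inner f g.
Proof.
move=> Lf Lg; rewrite (innerC (L2Z c Lg) Lf) innerZl//.
by rewrite conjcM -(innerC Lg Lf).
Qed.

Lemma inner0l g : L2 g -> inner (fun=> 0) g = 0.
Proof.
move=> Lg; rewrite (@eq_inner _ g (fun x => 0 * (fun=> 0) x) g)//.
  by rewrite innerZl ?mul0r//; exact: L2_0.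
by move=> x _; rewrite mul0r.
Qed.

Lemma innerBl f f' g : L2 f -> L2 f' -> L2 g ->
  inner (fun x => f x - f' x) g = inner f g - inner f' g.
Proof.
move=> Lf Lf' Lg; rewrite -[- inner f' g]mulN1r -innerZl// -innerDl//; last exact: L2Z.
by apply: eq_inner => // x _; rewrite mulN1r.
Qed.

Lemma inner_suml (I : Type) (r : seq I) (P : pred I) (c : I -> C) (F : I -> T -> C) g :
  (forall i, P i -> L2 (F i)) -> L2 g ->
  inner (fun x => \sum_(i <- r | P i) c i * F i x) g =
  \sum_(i <- r | P i) c i * inner (F i) g.
Proof.
move=> LF Lg; elim: r => [|i r IH].
  rewrite big_nil; transitivity (inner (fun=> 0) g); last exact: inner0l.
  by apply: eq_inner => x _ //; rewrite big_nil.
rewrite big_cons; case: ifPn => Pi; last first.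
  rewrite -IH; apply: eq_inner => // x _; by rewrite big_cons (negPf Pi).
rewrite -IH -innerZl//; last exact: LF.
rewrite -innerDl//; last 2 first.
- by apply: L2Z; exact: LF.
- by apply: L2_sum => j Pj; apply: L2Z; exact: LF.
by apply: eq_inner => // x _; rewrite big_cons Pi.
Qed.

Lemma inner_sumr (I : Type) (r : seq I) (P : pred I) (c : I -> C) (F : I -> T -> C) g :
  (forall i, P i -> L2 (F i)) -> L2 g ->
  inner g (fun x => \sum_(i <- r | P i) c i * F i x) =
  \sum_(i <- r | P i) conjc (c i) * inner g (F i).
Proof.
move=> LF Lg; have Ls : L2 (fun x => \sum_(i <- r | P i) c i * F i x).
  by apply: L2_sum => i Pi; apply: L2Z; exact: LF.
rewrite (innerC Ls Lg) inner_suml//.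
rewrite conjc_sum; apply: eq_bigr => i Pi; by rewrite conjcM -(innerC (LF i Pi) Lg).
Qed.

Lemma inner_self f : L2 f -> inner f f = ((sqnrm f)%:C)%C.
Proof.
move=> Lf; rewrite inner_parts//; have [i1 [i2 [i3 i4]]] := integrable_re Lf Lf.
rewrite -RintegralD//; apply: complex_eq => /=; last first.
  rewrite [X in X - _](_ : _ = \int[mu]_(x in D) (Re (f x) * Im (f x)))%R ?subrr//.
  by apply: eq_Rintegral => x _; rewrite mulrC.
by rewrite /sqnrm sqnormE.
Qed.

Lemma sqnrmD f g : L2 f -> L2 g ->
  sqnrm (fun x => f x + g x) = sqnrm f + sqnrm g + 2 * Re (inner f g).
Proof.
move=> Lf Lg; have Lfg := L2D Lf Lg.
rewrite -[LHS]/(Re ((sqnrm (fun x => f x + g x))%:C)%C) -inner_self//.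
rewrite innerDl// !innerDr// !inner_self// (innerC Lf Lg) !partE /=; ring.
Qed.

Lemma sqnrmZ c f : L2 f -> sqnrm (fun x => c * f x) = sqmod c * sqnrm f.
Proof.
move=> Lf; have Lcf := L2Z c Lf.
rewrite -[LHS]/(Re ((sqnrm (fun x => c * f x))%:C)%C) -inner_self//.
by rewrite innerZl// innerZr// mulrA mulJ inner_self// !partE mulr0 subr0.
Qed.

Lemma eq_sqnrm f g : (forall x, D x -> f x = g x) -> sqnrm f = sqnrm g.
Proof. by move=> fg; rewrite /sqnrm (eq_sqnorm fg). Qed.

Lemma cauchy_schwarz f g : L2 f -> L2 g -> sqmod (inner f g) <= sqnrm f * sqnrm g.
Proof.
move=> Lf Lg; have [c cE] : exists c, inner f g = c by eexists.
rewrite cE.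
have key (t : R) : 0 <= sqnrm f - 2 * t * sqmod c + t ^+ 2 * sqmod c * sqnrm g.
  have := sqnrm_ge0 (fun x => f x + (- (t%:C)%C * c) * g x).
  rewrite sqnrmD//; last exact: L2Z.
  rewrite sqnrmZ// innerZr// cE sqmodM sqmodN sqmod_real conjcM conjcN conjc_real /=.
  rewrite -[_ * conjc c * c]mulrA [conjc c * c]mulrC mulJ !partE /= oppr0 mul0r subr0.
  by congr (_ <= _); ring.
have [c0|c0] := eqVneq (sqmod c) 0.
  by rewrite c0 mulr_ge0// sqnrm_ge0.
have cp : 0 < sqmod c by rewrite lt_neqAle eq_sym c0 sqmod_ge0.
have [g0|g0] := eqVneq (sqnrm g) 0.
  have := key ((sqnrm f + 1) / (2 * sqmod c)); rewrite g0 mulr0 addr0.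
  have -> : 2 * ((sqnrm f + 1) / (2 * sqmod c)) * sqmod c = sqnrm f + 1 by field.
  by rewrite opprD addrA subrr add0r ler0N1.
have gp : 0 < sqnrm g by rewrite lt_neqAle eq_sym g0 sqnrm_ge0.
have := key (sqnrm g)^-1.
have -> : sqnrm f - 2 * (sqnrm g)^-1 * sqmod c + (sqnrm g)^-1 ^+ 2 * sqmod c * sqnrm g =
  sqnrm f - sqmod c / sqnrm g by field.
by rewrite subr_ge0 ler_pdivrMr.
Qed.

(** The inner product is continuous in its first argument, by the
    Cauchy-Schwarz inequality. *)
Lemma inner_cvg (u : nat -> T -> C) f g (e : R) : 0 < e ->
  (forall n, L2 (u n)) -> L2 f -> L2 g -> L2cvg mu D u f ->
  exists N, forall n, (N <= n)%N -> sqmod (inner (u n) g - inner f g) < e.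
Proof.
move=> e0 Lu Lf Lg uf.
have e1 : 0 < e / (sqnrm g + 1) by rewrite divr_gt0// ltr_wpDl// sqnrm_ge0.
have : \forall n \near \oo, (sqnorm (fun x => (u n x - f x)%R) < (e / (sqnrm g + 1))%:E)%E.
  by apply: (uf [set y | (y < (e / (sqnrm g + 1))%:E)%E]); apply: open_ereal_lt'; rewrite lte_fin.
move=> [N _ HN]; exists N => n Nn; have := HN n Nn; rewrite /= sqnrmE; last exact: L2B.
rewrite lte_fin => h; rewrite -innerBl//.
apply: le_lt_trans (cauchy_schwarz (L2B (Lu n) Lf) Lg) _.
have : sqnrm (fun x => u n x - f x) * sqnrm g <= sqnrm (fun x => u n x - f x) * (sqnrm g + 1).
  by rewrite ler_wpM2l ?sqnrm_ge0// lerDl.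
by move=> /le_lt_trans; apply; rewrite -ltr_pdivlMr// ltr_wpDl// sqnrm_ge0.
Qed.

End L2theory.

(** * Orthonormal bases and heat traces *)
Section EsumFacts.
Context (R : realType) (I : choiceType).
Implicit Types a : I -> \bar R.

Lemma esum_le_seq a (M : \bar R) :
  (forall J, uniq J -> (\sum_(i <- J) a i <= M)%E) ->
  (\esum_(i in [set: I]) a i <= M)%E.
Proof.
move=> H; apply: ge_ereal_sup => _ [X [fX _] <-].
by rewrite fsbig_finite//; apply: H; exact: finmap.fset_uniq.
Qed.

Lemma seq_le_esum a (J : seq I) : uniq J ->
  (\sum_(i <- J) a i <= \esum_(i in [set: I]) a i)%E.
Proof.
move=> uJ; apply: ereal_sup_ubound; exists [set` J] => //.
by rewrite -fsbig_seq.
Qed.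

Lemma esumZ (c : R) a : 0 <= c -> (forall i, (0 <= a i)%E) ->
  (\esum_(i in [set: I]) (c%:E * a i) = c%:E * \esum_(i in [set: I]) a i)%E.
Proof.
have key (c' : R) a' : 0 <= c' -> (forall i, (0 <= a' i)%E) ->
    (\esum_(i in [set: I]) (c'%:E * a' i) <= c'%:E * \esum_(i in [set: I]) a' i)%E.
  move=> c0 a0; apply: esum_le_seq => J uJ.
  rewrite -ge0_sume_distrr//; apply: lee_wpmul2l; first by rewrite lee_fin.
  exact: seq_le_esum.
move=> c0 a0; apply/eqP; rewrite eq_le key//=.
have [->|cn] := eqVneq c 0.
  by rewrite mul0e esum_ge0// => i _; rewrite mul0e.
have cp : 0 < c by rewrite lt_neqAle eq_sym cn.
have := @key c^-1 (fun i => c%:E * a i)%E.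
rewrite invr_ge0 c0 => /(_ isT) H.
have {}H := H (fun i => mule_ge0 (c0 : (0 <= c%:E)%E) (a0 i)).
rewrite -(@lee_pmul2l _ c^-1%:E)//; last by rewrite lte_fin invr_gt0.
apply: le_trans H; rewrite muleA -EFinM mulVf// mul1e.
by apply: le_esum => i _; rewrite muleA -EFinM mulVf// mul1e.
Qed.

End EsumFacts.

Lemma esum_finType (R : realType) (A : finType) (a : A -> \bar R) :
  (forall i, (0 <= a i)%E) -> (\esum_(i in [set: A]) a i = \sum_i a i)%E.
Proof.
move=> a0; apply/eqP; rewrite eq_le; apply/andP; split.
  apply: esum_le_seq => J uJ.
  rewrite big_uniq//=; apply: lee_sum_nneg_subset => //.
by apply: le_trans (seq_le_esum a (index_enum_uniq A)) _.
Qed.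

Lemma esum_sumType (R : realType) (A B : choiceType) (a : A + B -> \bar R) :
  (forall i, (0 <= a i)%E) ->
  (\esum_(i in [set: A + B]) a i =
   \esum_(i in [set: A]) a (inl i) + \esum_(i in [set: B]) a (inr i))%E.
Proof.
move=> a0; rewrite (esumID (range inl))//.
rewrite !setTI; congr (_ + _)%E.
  by rewrite esum_image// => x y _ _ [].
rewrite (_ : ~` _ = range inr); last first.
  apply/seteqP; split=> [[x|y] //= h|_ [y _ <-] [x _]//].
    by exfalso; apply: h; exists x.
  by exists y.
by rewrite esum_image// => x y _ _ [].
Qed.

Section Parseval.
Context d (T : measurableType d) (R : realType).
Context (mu : {measure set T -> \bar R}) (D : set T) (mD : measurable D).
Local Notation C := R[i].
Local Notation L2 := (L2 mu D).
Local Notation inner := (inner mu D).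
Local Notation sqnorm := (sqnorm mu D).
Local Notation sqnrm := (sqnrm mu D).

Lemma sum_undup (I : eqType) (J : seq I) (c : I -> C) (b : I -> C) :
  \sum_(i <- J) c i * b i =
  \sum_(i <- undup J) (c i *+ count_mem i J) * b i.
Proof.
rewrite -(@big_undup_iterop_count _ _ _ _ J predT (fun i => c i * b i)).
apply: eq_bigr => i _; rewrite mulrnAl /index_enum.
by case: (count_mem i J) => [|n]; rewrite ?mulr0n// -[LHS]/(_ *+ n.+1).
Qed.

Section Basis.
Context (I : choiceType) (b : I -> T -> C).
Hypothesis b_L2 : forall i, L2 (b i).
Hypothesis b_on : forall i j, inner (b i) (b j) = (i == j)%:R.

Lemma sqnrm_proj (J : seq I) (c : I -> C) (f : T -> C) : uniq J -> L2 f ->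
  sqnrm (fun x => f x - \sum_(i <- J) c i * b i x) =
  sqnrm f - \sum_(i <- J) sqmod (inner f (b i)) +
  \sum_(i <- J) sqmod (c i - inner f (b i)).
Proof.
move=> uJ Lf.
have Ls : L2 (fun x => \sum_(i <- J) c i * b i x).
  by apply: L2_sum => // i _; exact: L2Z.
transitivity (sqnrm (fun x => f x + (-1) * (\sum_(i <- J) c i * b i x))).
  by apply: eq_sqnrm => x _; rewrite mulN1r.
rewrite sqnrmD//; last exact: L2Z.
rewrite sqnrmZ// innerZr// inner_sumr//.
have -> : sqnrm (fun x => \sum_(i <- J) c i * b i x) = \sum_(i <- J) sqmod (c i).
  apply: real_inj; rewrite -inner_self// inner_suml//.
  rewrite rmorph_sum big_seq [RHS]big_seq; apply: eq_bigr => i iJ.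
  rewrite inner_sumr// (bigD1_seq i)//= b_on eqxx mulr1 big1 ?addr0 ?mulJ// => j ji.
  by rewrite b_on eq_sym (negPf ji) mulr0.
have -> : conjc (-1 : C) = -1 by apply: complex_eq; rewrite //= !oppr0.
rewrite mulN1r ReN.
have -> : complex.Re (\sum_(i <- J) conjc (c i) * inner f (b i)) =
    \sum_(i <- J) complex.Re (conjc (c i) * inner f (b i)).
  exact: (big_morph _ (@ReD R) erefl).
rewrite sqmodN (sqmod_nat R true) mul1r -addrA -[RHS]addrA; congr (_ + _).
rewrite -!sumrN mulr_sumr -!big_split/=; apply: eq_bigr => i _.
rewrite /sqmod !partE; ring.
Qed.

Lemma bessel (J : seq I) (f : T -> C) : uniq J -> L2 f ->
  \sum_(i <- J) sqmod (inner f (b i)) <= sqnrm f.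
Proof.
move=> uJ Lf; have := sqnrm_ge0 mu D (fun x => f x - \sum_(i <- J) inner f (b i) * b i x).
by rewrite sqnrm_proj// [X in _ + X]big1 ?addr0 ?subr_ge0// => i _; rewrite subrr sqmod0.
Qed.

(** The orthogonal projection is the best approximation in the span of
    finitely many basis vectors, so that approximability forces equality in
    Bessel's inequality. *)
Lemma parseval (f : T -> C) : L2 f ->
  (forall e : R, 0 < e -> exists (J : seq I) (c : I -> C),
     (sqnorm (fun x => f x - \sum_(i <- J) c i * b i x)%R < e%:E)%E) ->
  (\esum_(i in [set: I]) (sqmod (inner f (b i)))%:E = (sqnrm f)%:E)%E.
Proof.
move=> Lf H; apply/eqP; rewrite eq_le; apply/andP; split.
  by apply: esum_le_seq => J uJ; rewrite sumEFin lee_fin bessel.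
apply/lee_addgt0Pr => e e0; have [J [c Jc]] := H e e0.
have {}Jc : sqnrm f - \sum_(i <- undup J) sqmod (inner f (b i)) < e.
  have Ls : L2 (fun x => f x - \sum_(i <- J) c i * b i x).
    by apply: L2B => //; apply: L2_sum => // i _; exact: L2Z.
  move: Jc; rewrite sqnrmE// lte_fin; apply: le_lt_trans.
  have -> : sqnrm (fun x => f x - \sum_(i <- J) c i * b i x) =
      sqnrm (fun x => f x - \sum_(i <- undup J) (c i *+ count_mem i J) * b i x).
    by apply: eq_sqnrm => x _; congr (_ - _); exact: (sum_undup J c (fun i => b i x)).
  by rewrite sqnrm_proj ?undup_uniq// lerDl sumr_ge0// => i _; exact: sqmod_ge0.
have := @seq_le_esum R I (fun i => (sqmod (inner f (b i)))%:E) _ (undup_uniq J).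
rewrite sumEFin => /(leeD2r e%:E); apply: le_trans.
by rewrite -EFinD lee_fin -lerBlDl ltW.
Qed.

End Basis.

Context (W : set (T -> C)) (W_L2 : forall f, W f -> L2 f).
Context (A : (T -> C) -> (T -> C) -> Prop).
Hypothesis A_sym : forall f k f' k', W f -> W f' -> L2 k -> L2 k' ->
  A f k -> A f' k' -> inner k f' = inner f k'.

(** Both sides equal sum_(i, j) e^(- lam i t) |<b i, b' j>|^2: by Parseval's
    identity the sum over j gives the left-hand side; eigenvectors for
    different eigenvalues being orthogonal, lam i can be replaced with lam' j,
    and then the sum over i gives the right-hand side. *)
Lemma heat_trace_unique (I I' : choiceType) b lam b' lam' (t : R) :
  @orthonormal_eigenbasis d T R mu D W A I b lam ->
  @orthonormal_eigenbasis d T R mu D W A I' b' lam' ->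
  (\esum_(i in [set: I]) (expR (- (lam i * t)))%:E =
   \esum_(j in [set: I']) (expR (- (lam' j * t)))%:E)%E.
Proof.
move=> [Wb on dense eig] [Wb' on' dense' eig'].
have Lb i := W_L2 (Wb i); have Lb' j := W_L2 (Wb' j).
have one (f : T -> C) : L2 f -> inner f f = 1 -> sqnrm f = 1.
  by move=> Lf; rewrite inner_self// => -[].
have ort i j : sqmod (inner (b i) (b' j)) * expR (- (lam i * t)) =
    sqmod (inner (b' j) (b i)) * expR (- (lam' j * t)).
  rewrite (innerC mD (Lb i) (Lb' j)) sqmodJ.
  have [->|ne] := eqVneq (inner (b i) (b' j)) 0; first by rewrite sqmod0 !mul0r.
  have := A_sym (Wb i) (Wb' j) (L2Z mD _ (Lb i)) (L2Z mD _ (Lb' j)) (eig i) (eig' j).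
  rewrite innerZl// innerZr// conjc_real => /(mulIf ne)/real_inj ->//.
have swap (I1 I2 : choiceType) (a : I1 -> I2 -> \bar R) :
    (forall i j, (0 <= a i j)%E) ->
    (\esum_(i in [set: I1]) \esum_(j in [set: I2]) a i j =
     \esum_(j in [set: I2]) \esum_(i in [set: I1]) a i j)%E.
  move=> a0; rewrite esum_esum// esum_esum//.
  rewrite (@reindex_esum _ _ _ ([set: I1] `*`` (fun=> [set: I2]))
     ([set: I2] `*`` (fun=> [set: I1])) (fun k => (k.2, k.1)) (fun k => a k.2 k.1))//.
  by split=> [k|k k' _ _|k _] //=; [case: k k' => ? ? [? ?] /= [-> ->]|exists (k.2, k.1) => //=; case: k].
have expand (I1 I2 : choiceType) (b1 : I1 -> T -> C) (b2 : I2 -> T -> C) (l : I1 -> R) :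
    (forall i, W (b1 i)) -> (forall i, W (b2 i)) ->
    (forall i, inner (b1 i) (b1 i) = 1) ->
    (forall i j, inner (b2 i) (b2 j) = (i == j)%:R) ->
    (forall f (e : R), W f -> 0 < e -> exists (J : seq I2) (c : I2 -> C),
        (sqnorm (fun x => f x - \sum_(i <- J) c i * b2 i x)%R < e%:E)%E) ->
    (\esum_(i in [set: I1]) (expR (- (l i * t)))%:E =
     \esum_(i in [set: I1]) \esum_(j in [set: I2])
        (sqmod (inner (b1 i) (b2 j)) * expR (- (l i * t)))%:E)%E.
  move=> W1 W2 o1 o2 d2; apply: eq_esum => i _.
  under eq_esum do rewrite mulrC EFinM.
  rewrite esumZ ?expR_ge0//; last by move=> j; rewrite lee_fin sqmod_ge0.
  rewrite (parseval (I := I2) (b := b2))//; last 3 first.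
  - by move=> j; exact: W_L2.
  - exact: W_L2.
  - by move=> e e0; exact: d2.
  by rewrite one ?mule1//; exact: W_L2.
have on1 i : inner (b i) (b i) = 1 by rewrite on eqxx.
have on1' i : inner (b' i) (b' i) = 1 by rewrite on' eqxx.
rewrite (expand I I' b b')// (expand I' I b' b)// swap; last first.
  by move=> i j; rewrite lee_fin mulr_ge0 ?sqmod_ge0 ?expR_ge0.
by apply: eq_esum => j _; apply: eq_esum => i _; rewrite ort.
Qed.

Lemma heat_traceP (I : choiceType) b lam :
  @orthonormal_eigenbasis d T R mu D W A I b lam ->
  is_heat_trace mu D W A (fun t => \esum_(i in [set: I]) (expR (- (lam i * t)))%:E)%E.
Proof.
move=> basis; split; first by exists I, b, lam.
by move=> I' b' lam' basis' t _; exact: heat_trace_unique basis basis'.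
Qed.

End Parseval.

(** * Step functions on a finite subdivision *)
Section StepFunctions.
Context d (T : measurableType d) (R : realType) (mu : {measure set T -> \bar R}).
Context (J : finType) (c : J -> set T) (m : J -> R) (P : pred J).
Hypothesis c_meas : forall j, measurable (c j).
Hypothesis c_mu : forall j, mu (c j) = (m j)%:E.
Hypothesis c_disj : forall i j x, c i x -> c j x -> i = j.
Local Notation C := R[i].
Local Notation D := [set x | exists2 j, P j & c j x].

Lemma step_dom_bigcup : D = \big[setU/set0]_(j <- enum P) c j.
Proof.
rewrite -bigcup_seq; apply/seteqP; split=> x.
  by move=> [j Pj cj]; exists j => //=; rewrite mem_enum.
by move=> [j /=]; rewrite mem_enum => Pj cj; exists j.
Qed.

Lemma step_dom_measurable : measurable D.
Proof. by rewrite step_dom_bigcup; apply: bigsetU_measurable. Qed.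

Lemma step_measurable (v : T -> R) (w : J -> R) :
  (forall j x, P j -> c j x -> v x = w j) -> measurable_fun D v.
Proof.
move=> vw _ Y mY.
rewrite (_ : _ `&` _ = \bigcup_(j in [set j | P j /\ Y (w j)]) c j).
  by apply: fin_bigcup_measurable.
apply/seteqP; split=> x /=.
  by move=> [[j Pj cj]]; rewrite (vw j)// => Yj; exists j.
by move=> [j /= [Pj Yj] cj]; split; [exists j|rewrite (vw j)].
Qed.

Lemma step_integral (v : T -> R) (w : J -> R) :
  (forall j x, P j -> c j x -> v x = w j) ->
  (\int[mu]_(x in D) (v x)%:E = (\sum_(j | P j) w j * m j)%:E)%E.
Proof.
move=> vw; rewrite step_dom_bigcup integral_bigsetU_EFin//; last 3 first.
- exact: enum_uniq.
- by move=> i j _ _ [x [ci cj]]; exact: c_disj ci cj.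
- apply/measurable_EFinP; rewrite -step_dom_bigcup; exact: step_measurable vw.
rewrite -sumEFin big_enum_cond /= [RHS]big_mkcond [LHS]big_mkcond /=.
apply: eq_bigr => j _; rewrite andbT -[j \in P]/(P j); case: ifPn => // Pj.
transitivity (\int[mu]_(x in c j) (w j)%:E)%E.
  by apply: eq_integral => x /set_mem cj; rewrite (vw j).
by rewrite integral_cst// c_mu.
Qed.

Lemma step_L2 (f : T -> C) (F : J -> C) :
  (forall j x, P j -> c j x -> f x = F j) -> L2 mu D f.
Proof.
move=> fF; split.
- by apply: (step_measurable (w := fun j => complex.Re (F j))) => j x Pj cj; rewrite (fF j).
- by apply: (step_measurable (w := fun j => complex.Im (F j))) => j x Pj cj; rewrite (fF j).
- rewrite /sqnorm (step_integral (w := fun j => sqmod (F j))) ?ltry// => j x Pj cj.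
  by rewrite (fF j).
Qed.

Lemma step_cintegral (f : T -> C) (F : J -> C) :
  (forall j x, P j -> c j x -> f x = F j) ->
  cintegral mu D f = \sum_(j | P j) F j * ((m j)%:C)%C.
Proof.
move=> fF; rewrite /cintegral /Rintegral.
rewrite (step_integral (w := fun j => complex.Re (F j))); last first.
  by move=> j x Pj cj; rewrite (fF j).
rewrite (step_integral (w := fun j => complex.Im (F j))); last first.
  by move=> j x Pj cj; rewrite (fF j).
apply: complex_eq => /=.
  rewrite (big_morph _ (@ReD R) erefl); apply: eq_bigr => j _.
  by rewrite !partE /= mulr0 subr0.
rewrite (big_morph _ (@ImD R) erefl); apply: eq_bigr => j _.
by rewrite !partE /= mulr0 add0r.
Qed.

Lemma step_inner (f g : T -> C) (F F' : J -> C) :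
  (forall j x, P j -> c j x -> f x = F j) ->
  (forall j x, P j -> c j x -> g x = F' j) ->
  inner mu D f g = \sum_(j | P j) F j * conjc (F' j) * ((m j)%:C)%C.
Proof.
move=> fF gF; rewrite /inner (step_cintegral (F := fun j => F j * conjc (F' j)))//.
by move=> j x Pj cj; rewrite (fF j)// (gF j).
Qed.

End StepFunctions.

Section Cells.
Context (R : realType) (p : nat) (K : padic_field R p).
Context (mu : {sigma_finite_measure set (QpB K) -> \bar R}).
Context (V : finType) (U : V -> set (QpB K)).
Local Notation C := R[i].
Local Notation T := (QpB K).

(** A finite subdivision of the sets U v into measurable cells, empty cells
    being allowed, such that the distance between points of different cells
    depends only on the cells. *)
Record cells := Cells {
  cellI : finType;
  cell : cellI -> set T;
  cellv : cellI -> V;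
  cellm : cellI -> R;
  cellr : cellI -> cellI -> R;
  cell_meas : forall j, measurable (cell j);
  cell_mu : forall j, mu (cell j) = (cellm j)%:E;
  cell_disj : forall i j x, cell i x -> cell j x -> i = j;
  cell_U : forall v x, U v x <-> exists2 j, cellv j = v & cell j x;
  cell_dist : forall i j x y, i != j -> cell i x -> cell j y -> dist x y = cellr i j;
  cellr_sym : forall i j, cellr i j = cellr j i
}.

Context (G : rel V) (G_sym : symmetric G) (alpha : R).
Local Notation OmegaV := (OmegaV U).
Local Notation OmegaE := (OmegaE U G).
Local Notation d_alpha := (@d_alpha R p K alpha).
Local Notation delta_alpha := (delta_alpha mu U G alpha).
Local Notation mu2 := (mu2 mu).

Definition dker r : R := r `^ (- alpha).

Lemma d_alphaE (f : T -> C) x y :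
  d_alpha f (x, y) = (f x - f y) * ((2^-1 * dker (dist x y))%:C)%C.
Proof.
rewrite /Defs.d_alpha /dker powRN /=; congr (_ * _).
rewrite -invfM; apply: complex_eq => /=; last by rewrite mul0r oppr0.
set r := 2 * _; rewrite expr0n addr0.
have [->|r0] := eqVneq r 0; first by rewrite mul0r invr0.
by rewrite expr2 invfM mulrA mulfV ?mul1r.
Qed.

Section Fixed.
Context (X : cells).
Implicit Types (i j : cellI X).
Local Notation cell := (@cell X).
Local Notation m := (@cellm X).
Local Notation rho := (@cellr X).
Local Notation vt := (@cellv X).

Definition isstep (f : T -> C) (F : cellI X -> C) := forall j x, cell j x -> f x = F j.
Definition isstep2 (h : T * T -> C) (H : cellI X -> cellI X -> C) :=
  forall i j x y, G (vt i) (vt j) -> cell i x -> cell j y -> h (x, y) = H i j.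

Lemma cell_in j x : cell j x -> U (vt j) x.
Proof. by move=> cj; apply/(@cell_U X); exists j. Qed.

Lemma OmegaV_cells : OmegaV = [set x | exists2 j, true & cell j x].
Proof.
apply/seteqP; split=> x; first by move=> [v /(@cell_U X)[j _ cj]]; exists j.
by move=> [j _ cj]; exists (vt j); exact: cell_in.
Qed.

Lemma cell_vt j v x : cell j x -> U v x -> vt j = v.
Proof. by move=> cj /(@cell_U X)[i <- ci]; rewrite (cell_disj cj ci). Qed.

Lemma OmegaE_cells : OmegaE = [set z | exists2 k : cellI X * cellI X,
  G (vt k.1) (vt k.2) & (cell k.1 `*` cell k.2) z].
Proof.
apply/seteqP; split=> -[x y] /=.
  move=> [v [w [Gvw /(@cell_U X)[i iv ci] /(@cell_U X)[j jw cj]]]].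
  by exists (i, j); rewrite /= ?iv ?jw.
by move=> [[i j] /= Gij [ci cj]]; exists (vt i), (vt j); split=> //; exact: cell_in.
Qed.

Lemma nbr_cells i x : cell i x ->
  [set y | OmegaV y /\ OmegaE (x, y)] = [set y | exists2 j, G (vt i) (vt j) & cell j y].
Proof.
move=> ci; apply/seteqP; split=> y /=.
  move=> [_ [v [w [Gvw xv /(@cell_U X)[j jw cj]]]]]; exists j => //.
  by rewrite jw (cell_vt ci xv).
move=> [j Gij cj]; split; first by exists (vt j); exact: cell_in.
by exists (vt i), (vt j); split=> //; exact: cell_in.
Qed.

Lemma cell2_mu (k : cellI X * cellI X) :
  mu2 (cell k.1 `*` cell k.2) = (m k.1 * m k.2)%:E.
Proof.
rewrite /Defs.mu2 /= product_measure1E; try exact: cell_meas.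
by rewrite EFinM -2!cell_mu.
Qed.

Lemma cell2_meas (k : cellI X * cellI X) : measurable (cell k.1 `*` cell k.2).
Proof. by apply: measurableX; exact: cell_meas. Qed.

Lemma cell2_disj (k l : cellI X * cellI X) z :
  (cell k.1 `*` cell k.2) z -> (cell l.1 `*` cell l.2) z -> k = l.
Proof.
case: k l => i j [i' j'] /= [zi zj] [zi' zj'].
by rewrite (cell_disj zi zi') (cell_disj zj zj').
Qed.

Lemma measurable_OmegaV : measurable OmegaV.
Proof. by rewrite OmegaV_cells; apply: (step_dom_measurable predT (@cell_meas X)). Qed.

Lemma measurable_OmegaE : measurable OmegaE.
Proof. by rewrite OmegaE_cells; apply: (step_dom_measurable _ cell2_meas). Qed.

Lemma isstep_L2 f F : isstep f F -> L2 mu OmegaV f.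
Proof.
move=> fF; rewrite OmegaV_cells; apply: (step_L2 (P := predT) (@cell_meas X) (@cell_mu X) (@cell_disj X) (F := F)).
by move=> j x _; exact: fF.
Qed.

Lemma isstep2_L2 h H : isstep2 h H -> L2 mu2 OmegaE h.
Proof.
move=> hH; rewrite OmegaE_cells.
apply: (step_L2 cell2_meas cell2_mu cell2_disj (F := fun k => H k.1 k.2)).
by move=> [i j] [x y] /= Gij [ci cj]; exact: hH.
Qed.

Lemma isstep_inner f F g F' : isstep f F -> isstep g F' ->
  inner mu OmegaV f g = \sum_j F j * conjc (F' j) * ((m j)%:C)%C.
Proof.
move=> fF gF; rewrite OmegaV_cells.
by apply: (step_inner (P := predT) (@cell_meas X) (@cell_mu X) (@cell_disj X)) => j x _;
  [exact: fF|exact: gF].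
Qed.

Lemma isstep2_inner h H h' H' : isstep2 h H -> isstep2 h' H' ->
  inner mu2 OmegaE h h' =
  \sum_i \sum_(j | G (vt i) (vt j)) H i j * conjc (H' i j) * ((m i * m j)%:C)%C.
Proof.
move=> hH hH'; rewrite OmegaE_cells pair_big_dep /=.
by apply: (step_inner cell2_meas cell2_mu cell2_disj
  (F := fun k => H k.1 k.2) (F' := fun k => H' k.1 k.2)) => -[i j] [x y] /= Gij [ci cj];
  [exact: hH|exact: hH'].
Qed.

Definition dstep (F : cellI X -> C) i j : C := (F i - F j) * ((2^-1 * dker (rho i j))%:C)%C.
Definition deltastep (H : cellI X -> cellI X -> C) i : C :=
  \sum_(j | G (vt i) (vt j)) H i j * ((dker (rho i j))%:C)%C * ((m j)%:C)%C.

Lemma isstep2_d f F : isstep f F -> isstep2 (d_alpha f) (dstep F).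
Proof.
move=> fF i j x y _ ci cj; rewrite d_alphaE (fF i x ci) (fF j y cj) /dstep.
have [->|ij] := eqVneq i j; first by rewrite subrr !mul0r.
by rewrite (cell_dist ij ci cj).
Qed.

Lemma isstep_delta h H : isstep2 h H -> (forall i, H i i = 0) ->
  isstep (delta_alpha h) (deltastep H).
Proof.
move=> hH H0 i x ci; rewrite /Defs.delta_alpha (nbr_cells ci).
apply: (step_cintegral (@cell_meas X) (@cell_mu X) (@cell_disj X)
  (F := fun j => H i j * ((dker (rho i j))%:C)%C)) => j y Gij cj.
rewrite (hH i j x y)//; have [->|ij] := eqVneq i j; first by rewrite H0 !mul0r.
by rewrite (cell_dist ij ci cj).
Qed.

Lemma dstep_diag F i : dstep F i i = 0.
Proof. by rewrite /dstep subrr mul0r. Qed.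

Lemma dstep_anti F i j : dstep F i j = - dstep F j i.
Proof. by rewrite /dstep cellr_sym -mulNr opprB. Qed.

Lemma isstep_D f F : isstep f F ->
  isstep (delta_alpha (d_alpha f)) (deltastep (dstep F)).
Proof. by move=> fF; apply: isstep_delta; [exact: isstep2_d|exact: dstep_diag]. Qed.

(** As h is antisymmetric, the two terms of (f x - f y) h (x, y) have the same
    integral; together they make up for the factor 1/2 in d. *)
Lemma step_adjoint f F h H : isstep f F -> isstep2 h H ->
  (forall i, H i i = 0) ->
  (forall i j, G (vt i) (vt j) -> H i j = - H j i) ->
  inner mu2 OmegaE (d_alpha f) h = inner mu OmegaV f (delta_alpha h).
Proof.
move=> fF hH H0 Ha.
rewrite (isstep2_inner (isstep2_d fF) hH) (isstep_inner fF (isstep_delta hH H0)).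
pose a i j := F i * conjc (H i j) * ((dker (rho i j) * (m i * m j))%:C)%C.
have e1 i j : dstep F i j * conjc (H i j) * ((m i * m j)%:C)%C =
    2^-1 * a i j - 2^-1 * (F j * conjc (H i j) * ((dker (rho i j) * (m i * m j))%:C)%C).
  by rewrite /a /dstep; apply: complex_eq; rewrite !partE /=; field.
have half : \sum_i \sum_(j | G (vt i) (vt j))
    F j * conjc (H i j) * ((dker (rho i j) * (m i * m j))%:C)%C =
    - \sum_i \sum_(j | G (vt i) (vt j)) a i j.
  transitivity (\sum_j \sum_(i | G (vt i) (vt j))
      F j * conjc (H i j) * ((dker (rho i j) * (m i * m j))%:C)%C).
    exact: exchange_big_dep.
  rewrite -sumrN; apply: eq_bigr => k _.
  rewrite -sumrN; apply: eq_big => [l|l Glk]; first by rewrite G_sym.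
  by rewrite /a Ha// conjcN (cellr_sym l) [m l * _]mulrC mulrN mulNr.
transitivity (\sum_i \sum_(j | G (vt i) (vt j)) a i j).
  rewrite (eq_bigr (fun i => 2^-1 * (\sum_(j | G (vt i) (vt j)) a i j) -
    2^-1 * (\sum_(j | G (vt i) (vt j)) F j * conjc (H i j) *
       ((dker (rho i j) * (m i * m j))%:C)%C))) => [|i _]; last first.
    by rewrite !mulr_sumr -sumrB; apply: eq_bigr => j _; exact: e1.
  rewrite sumrB -!mulr_sumr half mulrN opprK -mulrDl.
  rewrite (_ : 2^-1 + 2^-1 = 1 :> C) ?mul1r//.
  by rewrite -div1r -splitr.
apply: eq_bigr => i _; rewrite /deltastep conjc_sum mulr_sumr mulr_suml.
apply: eq_bigr => j _; rewrite /a !conjcM !conjc_real.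
by apply: complex_eq; rewrite !partE /=; ring.
Qed.

Lemma step_D_sym f F g F' : isstep f F -> isstep g F' ->
  inner mu OmegaV (delta_alpha (d_alpha f)) g =
  inner mu OmegaV f (delta_alpha (d_alpha g)).
Proof.
move=> fF gF.
have ad f1 F1 f2 F2 : isstep f1 F1 -> isstep f2 F2 ->
    inner mu2 OmegaE (d_alpha f1) (d_alpha f2) =
    inner mu OmegaV f1 (delta_alpha (d_alpha f2)).
  move=> s1 s2; exact: (step_adjoint s1 (isstep2_d s2) (dstep_diag F2)
    (fun k l _ => dstep_anti F2 k l)).
rewrite -(ad _ _ _ _ fF gF) (innerC measurable_OmegaV (isstep_L2 gF) (isstep_L2 (isstep_D fF))).
rewrite -(ad _ _ _ _ gF fF) -(innerC measurable_OmegaE (isstep2_L2 (isstep2_d gF)) (isstep2_L2 (isstep2_d fF))).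
by [].
Qed.

End Fixed.
End Cells.

(** * Almost everywhere equality and closures *)
Section AlmostEverywhere.
Context d (T : measurableType d) (R : realType).
Context (mu : {measure set T -> \bar R}) (D : set T) (mD : measurable D).
Local Notation C := R[i].
Local Notation L2 := (L2 mu D).
Local Notation inner := (inner mu D).
Local Notation sqnrm := (sqnrm mu D).

Lemma eq_ae (f g : T -> C) : (forall x, D x -> f x = g x) -> ae_on mu D f g.
Proof. exact: aeW. Qed.

Lemma sqnrm0_ae (f g : T -> C) : L2 f -> L2 g ->
  sqnrm (fun x => f x - g x) = 0 <-> ae_on mu D f g.
Proof.
move=> Lf Lg; have Lfg := L2B mD Lf Lg.
have mf : measurable_fun D (fun x => (sqmod (f x - g x))%:E).
  exact: measurable_sqmodE (L2_cmeas Lfg).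
have -> : sqnrm (fun x => f x - g x) = 0 <->
    (\int[mu]_(x in D) `|(sqmod (f x - g x))%:E| = 0)%E.
  under eq_integral do rewrite abse_EFin ger0_norm ?sqmod_ge0//.
  rewrite -sqnormE sqnrmE//; split=> [->//|[]//].
rewrite (ae_eq_integral_abs mu mD mf); split; apply: filterS => x h Dx.
  by have [/sqmod_eq0/eqP] := h Dx; rewrite subr_eq0 => /eqP.
by rewrite h// subrr sqmod0.
Qed.

Lemma inner_ae (f f' g : T -> C) : L2 f -> L2 f' -> L2 g ->
  ae_on mu D f f' -> inner f g = inner f' g.
Proof.
move=> Lf Lf' Lg /(sqnrm0_ae Lf Lf') n0.
apply/eqP; rewrite -subr_eq0; apply/eqP/sqmod_eq0/le_anti.
rewrite sqmod_ge0 andbT -(innerBl mD)//; apply: le_trans (cauchy_schwarz mD _ Lg) _.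
  exact: L2B.
by rewrite n0 mul0r.
Qed.

(** An almost everywhere orthonormal expansion has the inner products as its
    only possible coefficients. *)
Lemma has_dim_orthonormal (W : set (T -> C)) n (e : 'I_n -> T -> C) :
  (forall f, W f -> L2 f) -> (forall i, W (e i)) ->
  (forall i j, inner (e i) (e j) = (i == j)%:R) ->
  (forall f, W f -> ae_on mu D f (fun x => \sum_i inner f (e i) * e i x)) ->
  has_dim mu D W n.
Proof.
move=> WL We on H; exists e; split=> // f Wf.
exists [ffun i => inner f (e i)]; split.
  by apply: filterS (H f Wf) => x h Dx; rewrite (h Dx); apply: eq_bigr => i _; rewrite ffunE.
move=> c fc; apply/ffunP => i; rewrite ffunE.
have Ls : L2 (fun x => \sum_i c i * e i x).
  by apply: L2_sum => // j _; apply: L2Z => //; exact: WL.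
rewrite (inner_ae (WL _ Wf) Ls (WL _ (We i)) fc).
rewrite (inner_suml mD)//; [|by move=> j _; exact: WL|exact: WL].
by rewrite (bigD1 i)//= on eqxx mulr1 big1 ?addr0// => j /negPf ji; rewrite on ji mulr0.
Qed.

End AlmostEverywhere.

(** Operators are given on locally constant functions and extended by closure;
    this is how identities between inner products pass to the closure. *)
Lemma inner_limit_eq (R : realType) d (T : measurableType d)
    (mu : {measure set T -> \bar R}) (D : set T) (mD : measurable D)
    d' (T' : measurableType d') (mu' : {measure set T' -> \bar R}) (D' : set T')
    (mD' : measurable D') u f g u' f' g' :
  (forall n, L2 mu D (u n)) -> L2 mu D f -> L2 mu D g -> L2cvg mu D u f ->
  (forall n, L2 mu' D' (u' n)) -> L2 mu' D' f' -> L2 mu' D' g' -> L2cvg mu' D' u' f' ->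
  (forall n, inner mu D (u n) g = inner mu' D' (u' n) g') ->
  inner mu D f g = inner mu' D' f' g'.
Proof.
move=> Lu Lf Lg uf Lu' Lf' Lg' uf' e.
set a := inner mu D f g; set a' := inner mu' D' f' g'.
apply/eqP; rewrite -subr_eq0; apply/eqP/sqmod_eq0/eqP; apply/negPn/negP => ne.
have pos : 0 < sqmod (a - a') / 8 by rewrite divr_gt0// lt_neqAle eq_sym ne sqmod_ge0.
have [N HN] := inner_cvg mD pos Lu Lf Lg uf.
have [N' HN'] := inner_cvg mD' pos Lu' Lf' Lg' uf'.
have := HN (maxn N N') (leq_maxl _ _); have := HN' (maxn N N') (leq_maxr _ _).
rewrite e -/a -/a'; set b := inner _ _ _ _ => h1 h2.
have : sqmod (a - a') <= 2 * sqmod (b - a') + 2 * sqmod (b - a).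
  have -> : a - a' = (b - a') + - (b - a) by ring.
  by rewrite -(sqmodN (b - a)); exact: sqmodD.
move: pos h1 h2; set x := sqmod (a - a'); set y := sqmod (b - a'); set z := sqmod (b - a).
by move=> *; lra.
Qed.

Section ClosedOperators.
Context (R : realType) (p : nat) (K : padic_field R p).
Context (mu : {sigma_finite_measure set (QpB K) -> \bar R}).
Context (V : finType) (U : V -> set (QpB K)).
Context (G : rel V) (G_sym : symmetric G) (alpha : R).
Local Notation C := R[i].
Local Notation T := (QpB K).
Local Notation OmegaV := (OmegaV U).
Local Notation OmegaE := (OmegaE U G).
Local Notation d_alpha := (@d_alpha R p K alpha).
Local Notation delta_alpha := (delta_alpha mu U G alpha).
Local Notation mu2 := (mu2 mu).

Context (X : nat -> cells mu U).
Definition level n (f : T -> C) := exists F, @isstep _ _ _ _ _ _ (X n) f F.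
Hypothesis lc_level : forall u : T -> C, loc_const U u ->
  exists N, forall n, (N <= n)%N -> level n u.

Lemma levelP n f : (forall j x y, cell (c := X n) j x -> cell (c := X n) j y -> f x = f y) ->
  level n f.
Proof.
move=> H; exists (fun j => if pselect (exists x, cell (c := X n) j x) is left e
  then f (projT1 (cid e)) else 0) => j x cj.
case: pselect => [e|[]]; last by exists x.
by apply: H cj _; case: (cid e).
Qed.

Let mOV : measurable OmegaV := measurable_OmegaV (X 0).
Let mOE : measurable OmegaE := measurable_OmegaE G (X 0).

Lemma level2 u u' : loc_const U u -> loc_const U u' -> exists n, level n u /\ level n u'.
Proof.
move=> /lc_level[N HN] /lc_level[N' HN']; exists (maxn N N').
by split; [apply: HN; exact: leq_maxl|apply: HN'; exact: leq_maxr].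
Qed.

Lemma lc_L2 u : loc_const U u -> L2 mu OmegaV u.
Proof. by move=> lu; have [n [[F uF] _]] := level2 lu lu; exact: isstep_L2 uF. Qed.

Lemma lc_D_L2 u : loc_const U u -> L2 mu OmegaV (delta_alpha (d_alpha u)).
Proof.
move=> lu; have [n [[F uF] _]] := level2 lu lu; apply: isstep_L2; exact: isstep_D uF.
Qed.

Lemma lc_d_L2 u : loc_const U u -> L2 mu2 OmegaE (d_alpha u).
Proof.
move=> lu; have [n [[F uF] _]] := level2 lu lu; apply: isstep2_L2; exact: isstep2_d uF.
Qed.

Lemma lc_D_sym u u' : loc_const U u -> loc_const U u' ->
  inner mu OmegaV (delta_alpha (d_alpha u)) u' =
  inner mu OmegaV u (delta_alpha (d_alpha u')).
Proof. by move=> lu lu'; have [n [[F uF] [F' uF']]] := level2 lu lu'; exact: (step_D_sym G_sym alpha uF uF'). Qed.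

Lemma lc_d_adjoint u u' : loc_const U u -> loc_const U u' ->
  inner mu2 OmegaE (d_alpha u) (d_alpha u') =
  inner mu OmegaV u (delta_alpha (d_alpha u')).
Proof.
move=> lu lu'; have [n [[F uF] [F' uF']]] := level2 lu lu'.
have s2 : isstep2 G (d_alpha u') (dstep alpha F') by exact: isstep2_d.
exact: (step_adjoint G_sym alpha uF s2 (dstep_diag alpha F')
  (fun k l _ => dstep_anti alpha F' k l)).
Qed.

Lemma D_closed_sym f k f' k' : D_closed mu U G alpha f k -> D_closed mu U G alpha f' k' ->
  inner mu OmegaV k f' = inner mu OmegaV f k'.
Proof.
move=> [Lf Lk [u [lu uf uk]]] [Lf' Lk' [u' [lu' uf' uk']]].
have Lu n : L2 mu OmegaV (u n) by exact: lc_L2.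
have LDu n : L2 mu OmegaV (delta_alpha (d_alpha (u n))) by exact: lc_D_L2.
have Lu' n : L2 mu OmegaV (u' n) by exact: lc_L2.
have LDu' n : L2 mu OmegaV (delta_alpha (d_alpha (u' n))) by exact: lc_D_L2.
have e1 m : inner mu OmegaV k (u' m) = inner mu OmegaV f (delta_alpha (d_alpha (u' m))).
  apply: (inner_limit_eq mOV mOV LDu Lk (Lu' m) uk Lu Lf (LDu' m) uf) => n.
  exact: lc_D_sym.
have e2 : inner mu OmegaV f' k = inner mu OmegaV k' f.
  apply: (inner_limit_eq mOV mOV Lu' Lf' Lk uf' LDu' Lk' Lf uk') => m.
  by rewrite (innerC mOV Lk (Lu' m)) e1 -(innerC mOV Lf (LDu' m)).
by rewrite (innerC mOV Lf' Lk) e2 -(innerC mOV Lk' Lf).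
Qed.

Lemma const_cvg d (S : measurableType d) (nu : {measure set S -> \bar R}) (D : set S)
  (f g : S -> C) : (forall x, D x -> f x = g x) -> L2cvg nu D (fun=> f) g.
Proof.
move=> fg; rewrite /L2cvg [X in X @ \oo --> _](_ : _ = fun=> 0%E); first exact: cvg_cst.
apply/funext => n; rewrite (@eq_sqnorm _ _ _ _ _ _ (fun=> 0)).
  by rewrite sqnormE integral0_eq// => x _; rewrite sqmod0.
by move=> x Dx; rewrite fg// subrr.
Qed.

Lemma D_closed_lc f k : loc_const U f ->
  (forall x, OmegaV x -> delta_alpha (d_alpha f) x = k x) ->
  D_closed mu U G alpha f k.
Proof.
move=> lf Dk; split; first exact: lc_L2.
  by apply: eq_L2 (lc_D_L2 lf) => x /Dk.
by exists (fun=> f); split => //; apply: const_cvg.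
Qed.

Lemma ker_d_orthogonal f w (l : C) : ker_d mu U G alpha f -> loc_const U w -> l != 0 ->
  (forall x, OmegaV x -> delta_alpha (d_alpha w) x = l * w x) ->
  inner mu OmegaV f w = 0.
Proof.
move=> [Lf L0 [u [lu uf du]]] lw l0 Dw.
have : inner mu OmegaV f (delta_alpha (d_alpha w)) =
    inner mu2 OmegaE (fun=> 0) (d_alpha w).
  apply: (inner_limit_eq mOV mOE _ Lf (lc_D_L2 lw) uf _ L0 (lc_d_L2 lw) du) => n.
  - exact: lc_L2.
  - exact: lc_d_L2.
  - by rewrite lc_d_adjoint.
rewrite inner0l//; last exact: lc_d_L2.
rewrite (@eq_inner _ _ _ _ _ _ _ f (fun x => l * w x))// innerZr//; last exact: lc_L2.
move=> /eqP; rewrite mulf_eq0 => /orP[|/eqP//] /eqP l0'.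
by move: l0; rewrite -[l]conjcK l0' conjc0 eqxx.
Qed.

End ClosedOperators.

(** * Euler characteristic and Gram matrices *)
Section Orientation.
Context (V : finType) (e : rel V) (m : nat) (src tgt : 'I_m -> V).

(** An enumeration without repetition of the edges of the undirected simple
    graph e, each with a direction. *)
Record orientation : Prop := {
  orient_edge : forall v w, e v w <->
    exists j, (src j = v /\ tgt j = w) \/ (src j = w /\ tgt j = v);
  orient_inj : forall i j, src i = src j -> tgt i = tgt j -> i = j;
  orient_simple : forall i j, src i = tgt j -> tgt i = src j -> False
}.

Hypothesis ori : orientation.

Let cochain (j : 'I_m) := edge_cochain (src j, tgt j).

Lemma cochain_free : free [tuple cochain j | j < m].
Proof.
apply/freeP => k k0 j; have /ffunP/(_ (src j, tgt j)) := k0.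
rewrite sum_ffunE ffunE (bigD1 j)//= big1 => [|i ij].
  rewrite addr0 !ffunE /= (nth_map j) ?size_enum_ord// nth_ord_enum !ffunE eqxx.
  case: eqP => [[a b]|_]; first by case: (orient_simple ori (i := j) (j := j)).
  by rewrite subr0 => /eqP; rewrite mulf_eq0 oner_eq0 orbF => /eqP.
rewrite !ffunE /= (nth_map j) ?size_enum_ord// nth_ord_enum !ffunE.
case: eqP => [[a b]|_]; first by case/eqP: ij; apply: (orient_inj ori).
case: eqP => [[a b]|_]; first by case: (orient_simple ori (i := j) (j := i)).
by rewrite subrr; exact: mulr0.
Qed.

Lemma cochain_rev (a : V * V) : edge_cochain (a.2, a.1) = - edge_cochain a.
Proof. by apply/ffunP => b; rewrite !ffunE /= opprB; case: a. Qed.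

Lemma dim_cochains1 : \dim (cochains1 e) = m.
Proof.
have -> : cochains1 e = <<[tuple cochain j | j < m]>>%VS.
  apply/subv_anti/andP; split; apply/span_subvP => f.
    move=> /mapP[[v w]]; rewrite mem_enum inE /= => /(orient_edge ori)[j h] ->.
    have cj : cochain j \in <<[tuple cochain j | j < m]>>%VS.
      by apply/memv_span/mapP; exists j; rewrite ?mem_enum.
    by case: h => -[<- <-] //; rewrite (cochain_rev (src j, tgt j)) memvN.
  move=> /mapP[j _ ->]; apply/memv_span/mapP; exists (src j, tgt j) => //.
  by rewrite mem_enum inE /=; apply/(orient_edge ori); exists j; left.
by have := cochain_free; rewrite /free size_tuple => /eqP.
Qed.

(** By the rank-nullity theorem, the kernel and the image of the coboundary
    contribute the number of vertices. *)
Lemma euler_char_orientation : euler_char e = #|V|%:Z - m%:Z.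
Proof.
rewrite /euler_char dim_cochains1.
have := limg_ker_dim (linfun (coboundary e)) fullv; rewrite capfv dimvf.
have -> : dim {ffun V -> rat^o} = #|V| by rewrite /dim /= muln1.
by move=> <-; rewrite PoszD; ring.
Qed.

End Orientation.

Section Gram.
Context (R : realType).
Local Notation C := R[i].
Local Open Scope sesquilinear_scope.

Lemma mul_adj_eq0 m n (A : 'M[C]_(m, n)) : A *m A ^t* = 0 -> A = 0.
Proof.
move=> A0; apply/matrixP => i j; rewrite mxE.
have /matrixP/(_ i i) := A0; rewrite !mxE => s0.
have : \sum_k sqmod (A i k) = 0.
  apply: real_inj; rewrite rmorph_sum -[RHS]s0; apply: eq_bigr => k _.
  by rewrite !mxE /= -mulJ.
move/eqP; rewrite psumr_eq0 => [|k _]; last exact: sqmod_ge0.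
by move=> /allP/(_ j); rewrite mem_index_enum => /(_ isT)/eqP/sqmod_eq0.
Qed.

Lemma rank_mul_adj m n (Q : 'M[C]_(m, n)) : \rank (Q *m Q ^t*) = \rank Q.
Proof.
have kQ : (kermx Q :=: kermx (Q *m Q ^t*))%MS.
  apply/eqmxP/andP; split; first by apply/sub_kermxP; rewrite mulmxA mulmx_ker mul0mx.
  apply/sub_kermxP; apply: mul_adj_eq0.
  by rewrite trmx_mul map_mxM mulmxA -(mulmxA _ Q) mulmx_ker mul0mx.
have := mxrank_ker Q; rewrite kQ mxrank_ker => h.
have := rank_leq_row Q; have := rank_leq_row (Q *m Q ^t*); lia.
Qed.

(** When P diagonalizes the Hermitian matrix N N^t, the rows of P N are
    orthogonal and their squared lengths are the eigenvalues; the rank of N is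
    the number of nonzero rows. *)
Lemma gram_spectral m n (N : 'M[C]_(m, n)) :
  exists (P : 'M[C]_m) (l : 'I_m -> R),
    [/\ P *m P ^t* = 1%:M, P ^t* *m P = 1%:M, forall i, 0 <= l i,
        forall i j, (P *m (N *m N ^t*)) i j = ((l i)%:C)%C * P i j
      & #|[pred i | l i == 0]| = (m - \rank N)%N].
Proof.
set A := N *m N ^t*.
have Aherm : A ^t* = A.
  by rewrite /A trmx_mul map_mxM trmxCK.
have /orthomx_spectralP AE : A \is normalmx by apply/normalmxP; rewrite Aherm.
set P := spectralmx A in AE; set sp := spectral_diag A in AE.
have Pu : P \is unitarymx := spectral_unitarymx A.
have PA : P *m A = diag_mx sp *m P.
  by rewrite AE !mulmxA mulmxV ?mul1mx// spectral_unit.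
have PP : P *m P ^t* = 1%:M by apply/unitarymxP.
have PP' : P ^t* *m P = 1%:M by apply: mulmx1C.
pose Q := P *m N.
have QQ : Q *m Q ^t* = diag_mx sp.
  rewrite /Q trmx_mul map_mxM mulmxA -(mulmxA P) -/A PA -mulmxA.
  by rewrite [P *m _]PP mulmx1.
pose l i := \sum_k sqmod (Q i k).
have spl i : sp 0 i = ((l i)%:C)%C.
  have /matrixP/(_ i i) := QQ; rewrite !mxE eqxx mulr1n => <-.
  by rewrite /l rmorph_sum; apply: eq_bigr => k _; rewrite /= -mulJ; congr (_ * _); rewrite [LHS]mxE [in LHS]mxE.
exists P, l; split=> //.
- by move=> i; rewrite sumr_ge0// => k _; exact: sqmod_ge0.
- by move=> i j; rewrite PA mul_diag_mx mxE spl.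
have rk : \rank N = \rank (diag_mx sp).
  by rewrite -QQ rank_mul_adj /Q eqmxMfull// row_full_unit spectral_unit.
pose S := [pred i | l i == 0]; pose E : 'M[C]_(#|S|, m) := rowsub (@enum_val _ S) 1%:M.
have EE : E *m E^T = 1%:M.
  apply/matrixP => i j; rewrite !mxE (bigD1 (enum_val i))//= !mxE eqxx mul1r.
  rewrite big1 ?addr0 => [|k /negPf ki]; last by rewrite !mxE eq_sym ki mul0r.
  by rewrite (inj_eq enum_val_inj) eq_sym.
have rE : \rank E = #|S|.
  by apply/eqP; apply/row_freeP; exists E^T.
have key (u : 'rV_m) : u *m diag_mx sp = 0 -> (u <= E)%MS.
  move=> u0; have uS k : l k != 0 -> u 0 k = 0.
    move=> lk; have /matrixP/(_ 0 k) := u0; rewrite mul_mx_diag !mxE spl => /eqP.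
    rewrite mulf_eq0 => /orP[/eqP//|/eqP/real_inj lk0].
    by rewrite lk0 eqxx in lk.
  apply/submxP; exists (u *m E^T); apply/rowP => k; rewrite -mulmxA mxE.
  rewrite (bigD1 k)//= big1 ?addr0 => [|j jk].
    rewrite !mxE; have [lk|lk] := boolP (S k); last by rewrite uS ?mul0r.
    rewrite (bigD1 (enum_rank_in lk k))//= !mxE enum_rankK_in// eqxx mul1r.
    rewrite big1 ?addr0 ?mulr1// => i' ne; rewrite !mxE.
    case: eqP => [e|]; last by rewrite mul0r.
    by case/eqP: ne; apply: enum_val_inj; rewrite enum_rankK_in.
  rewrite !mxE big1 ?mulr0// => i' _; rewrite !mxE.
  by case: eqP => [->|]; rewrite ?mul0r// (negPf jk) mulr0.
have kE : (kermx (diag_mx sp) :=: E)%MS.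
  apply/eqmxP/andP; split.
    apply/row_subP => i; apply: key.
    by apply: (sub_kermxP _); exact: row_sub.
  apply/sub_kermxP/matrixP => i j; rewrite mul_mx_diag !mxE spl.
  case: eqP => [<-|_]; last by rewrite mul0r.
  by have /eqP -> := enum_valP i; rewrite mulr0.
have := mxrank_ker (diag_mx sp); rewrite kE rE rk => ->//.
Qed.

End Gram.

(** * Weighted incidence matrices *)
Section Incidence.
Context (R : realType) (V : finType) (e : rel V) (m : nat) (src tgt : 'I_m -> V).
Local Notation C := R[i].
Hypothesis ori : orientation e src tgt.
Hypothesis connected : forall v w, connect e v w.
Context (w : V -> R) (w_gt0 : forall v, 0 < w v) (k : 'I_m -> R) (k_neq0 : forall j, k j != 0).

(** For k = 1 and w = 1 this is the usual incidence matrix. *)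
Definition incidence (v : V) (j : 'I_m) : R :=
  k j * ((v == src j)%:R * w (tgt j) - (v == tgt j)%:R * w (src j)).

Definition incidence_mx : 'M[C]_(#|V|, m) :=
  \matrix_(i, j) ((incidence (enum_val i) j)%:C)%C.

Lemma src_neq_tgt j : src j != tgt j.
Proof. by apply/eqP => h; case: (orient_simple ori (i := j) (j := j)). Qed.

Lemma sum_incidence (F : V -> C) j :
  \sum_v F v * ((incidence v j)%:C)%C =
  ((k j)%:C)%C * (F (src j) * ((w (tgt j))%:C)%C - F (tgt j) * ((w (src j))%:C)%C).
Proof.
have st := src_neq_tgt j.
rewrite (bigD1 (src j))//= (bigD1 (tgt j))/=; last by rewrite eq_sym.
rewrite big1 ?addr0 => [|v /andP[/negPf vs /negPf vt]]; last first.
  by rewrite /incidence vs vt !mul0r subrr mulr0 mulr0.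
rewrite /incidence !eqxx (negPf st) eq_sym (negPf st) !mul0r !mul1r subr0 sub0r.
by apply: complex_eq; rewrite !partE /=; ring.
Qed.

(** A row vector u belongs to the kernel if and only if u v / w v has the same
    value at the two ends of every edge; for a connected graph, the kernel is
    thus the line generated by w. *)
Lemma rank_incidence_mx : (0 < #|V|)%N -> (\rank incidence_mx).+1 = #|V|.
Proof.
move=> V0; pose W : 'rV[C]_#|V| := \row_i ((w (enum_val i))%:C)%C.
have sumE (u : 'rV[C]_#|V|) j : (u *m incidence_mx) 0 j =
    \sum_v u 0 (enum_rank v) * ((incidence v j)%:C)%C.
  rewrite mxE (reindex enum_rank) /=; last exact/onW_bij/enum_rank_bij.
  by apply: eq_bigr => v _; rewrite mxE enum_rankK.
have rkW : \rank W = 1%N.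
  rewrite rank_rV; case: eqP => // /matrixP W0.
  have [v _] : exists v : V, True by case/card_gt0P: V0 => v; exists v.
  have := W0 0 (enum_rank v); rewrite !mxE enum_rankK => /real_inj w0.
  by have := w_gt0 v; rewrite w0 ltxx.
have kW : (kermx incidence_mx :=: W)%MS.
  apply/eqmxP/andP; split; last first.
    apply/sub_kermxP/rowP => j; rewrite sumE sum_incidence !mxE !enum_rankK.
    by rewrite mulrC [X in _ - X]mulrC subrr mul0r.
  have key (u : 'rV_#|V|) : u *m incidence_mx = 0 -> (u <= W)%MS.
    move=> u0; pose f v := u 0 (enum_rank v) / ((w v)%:C)%C.
    have wc v : ((w v)%:C)%C != 0 :> C.
      by apply/eqP => /real_inj w0; have := w_gt0 v; rewrite w0 ltxx.
    have fe v v' : e v v' -> f v = f v'.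
      move=> /(orient_edge ori)[j h].
      have : f (src j) = f (tgt j).
        have /matrixP/(_ 0 j) := u0; rewrite sumE sum_incidence mxE => /eqP.
        rewrite mulf_eq0 => /orP[/eqP/real_inj k0|]; first by move: (k_neq0 j); rewrite k0 eqxx.
        by rewrite subr_eq0 /f => /eqP h'; apply/eqP; rewrite eqr_div// h'.
      by case: h => -[<- <-].
    have fc v v' : f v = f v'.
      have /connectP[s] := connected v v'.
      elim: s v => [|x s IH] v /=; first by move=> _ ->.
      by move=> /andP[/fe ->]; exact: IH.
    have [v0 _] : exists v : V, True by case/card_gt0P: V0 => v; exists v.
    apply/sub_rVP; exists (f v0); apply/rowP => i; rewrite !mxE.
    by rewrite (fc v0 (enum_val i)) /f enum_valK divfK.
  apply/row_subP => i; apply: key; apply: (sub_kermxP _); exact: row_sub.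
have := mxrank_ker incidence_mx; rewrite kW rkW.
have := rank_leq_row incidence_mx; lia.
Qed.

End Incidence.

(** * The tree of a fundamental domain *)
Section Tree.
Context (R : realType) (p : nat) (p_prime : prime p) (K : padic_field R p).
Context (g : nat) (g_gt0 : (0 < g)%N) (D : holes K g).
Hypothesis holes_disjoint : forall h h', h != h' ->
  closed_hole D h `&` closed_hole D h' = set0.
Context (s : hole g -> Qp K).
Hypothesis s_hole : forall h, h != outer D -> open_hole D h (Some (s h)).
Context (V : finType) (B : V -> set (Qp K)) (B_inj : injective B).
Hypothesis B_vertices : range B = [set A | TF_vertex D s A].
Hypothesis U_neq0 : forall v, holed_disc D B v !=set0.
Implicit Types (v w : V) (h : hole g) (x y : Qp K) (k l : int).
Local Notation q := (p%:R : R).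
Local Notation U := (holed_disc D B).
Local Notation rad := Defs.rad.
Local Notation o := (outer D).

Lemma pabs_lt_pexp x k : (pabs x < q ^ k) = (pabs x <= q ^ (k - 1)).
Proof.
have [->|/pabs_val[l ->]] := eqVneq x 0; first by rewrite pabs0 pexp_gt0// ltW// pexp_gt0.
by rewrite pexp_lt// pexp_le// lerBrDr lezD1.
Qed.

Lemma open_inner h x : h != o -> open_hole D h (Some x) <-> disc (ctr D h) (rad D h - 1) x.
Proof. by move=> /negPf ho; rewrite /open_hole /disc /= ho pabs_lt_pexp. Qed.

Lemma open_outer x : ~ open_hole D o (Some x) <-> boundary_vertex D o x.
Proof.
rewrite /open_hole /boundary_vertex /disc /= eqxx leNgt.
by split=> [/negP|/negP].
Qed.

Lemma inner_exists : exists h, h != o.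
Proof. by exists (o.1, ~~ o.2); case: o => i b; apply/eqP => -[]; case: b. Qed.

Lemma boundary_sub h : boundary_vertex D h `<=` boundary_vertex D o.
Proof.
have [->//|ho] := eqVneq h o; move=> x hx.
have /seteqP[/(_ (Some x)) + _] := holes_disjoint ho.
rewrite /closed_hole /= (negPf ho) eqxx => H; apply/ltW; rewrite ltNge.
by apply/negP => ox; apply: H; split.
Qed.

Lemma vertexP A : TF_vertex D s A <-> [/\ is_disc A, A `<=` boundary_vertex D o &
  exists2 h, h != o & A (s h) /\ ~ (forall x, A x -> open_hole D h (Some x))].
Proof.
split; last by move=> [d sub ex]; split=> //; split=> // x /sub /open_outer.
by move=> [d [sub ex]]; split=> // x /sub /open_outer.
Qed.

Lemma boundary_vertexP h : TF_vertex D s (boundary_vertex D h).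
Proof.
have inner h' : h' != o -> boundary_vertex D h' (s h') /\
    ~ (forall x, boundary_vertex D h' x -> open_hole D h' (Some x)).
  move=> ho; split.
    have /(open_inner _ ho) := s_hole ho; apply: disc_le => //.
    by rewrite gerBl.
  move=> H; have : disc (ctr D h') (rad D h') `<=` disc (ctr D h') (rad D h' - 1).
    by move=> x /H/(open_inner _ ho).
  by move=> /(disc_subset p_prime)[]; rewrite lerBrDr gerDl.
apply/vertexP; split; [by eexists; eexists|exact: boundary_sub|].
have [->|ho] := eqVneq h o; last by exists h => //; exact: inner.
have [h' ho'] := inner_exists; exists h' => //; have [i1 i2] := inner _ ho'.
split; first exact: boundary_sub i1.
by move=> H; apply: i2 => x hx; apply: H; exact: boundary_sub hx.
Qed.

(** The discs between a vertex and the root are vertices, which makes T(F) a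
    rooted tree. *)
Lemma vertex_up A x k : TF_vertex D s A -> A `<=` disc x k ->
  disc x k `<=` boundary_vertex D o -> TF_vertex D s (disc x k).
Proof.
move=> /vertexP[_ _ [h ho [Ah nA]]] Ak ko; apply/vertexP; split=> //.
  by eexists; eexists.
exists h => //; split; first exact: Ak.
by move=> H; apply: nA => y /Ak/H.
Qed.

Lemma vertex_ofP A : TF_vertex D s A -> exists v, B v = A.
Proof. by have := B_vertices => /seteqP[_ +] Av => /(_ A Av)[v _ <-]; exists v. Qed.

Lemma vertexB v : TF_vertex D s (B v).
Proof. by have := B_vertices => /seteqP[+ _]; apply; exists v. Qed.

Definition base v : Qp K := projT1 (cid (U_neq0 v)).
Lemma base_U v : U v (base v). Proof. exact: projT2 (cid (U_neq0 v)). Qed.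

Lemma U_sub v : U v `<=` B v. Proof. by move=> x []. Qed.

Lemma radius_ex v : exists k, B v = disc (base v) k.
Proof.
have /vertexP[[x [k Bv]] _ _] := vertexB v; exists k.
by rewrite Bv; apply: disc_eq; rewrite -Bv; apply/U_sub/base_U.
Qed.

Definition radius v : int := projT1 (cid (radius_ex v)).
Lemma B_disc v : B v = disc (base v) (radius v).
Proof. exact: projT2 (cid (radius_ex v)). Qed.

Lemma B_disc_at v x : B v x -> B v = disc x (radius v).
Proof.
move=> vx; have := vx; rewrite [X in X x]B_disc => /disc_eq <-; exact: B_disc.
Qed.

Lemma B_root v : B v `<=` boundary_vertex D o.
Proof. by have /vertexP[] := vertexB v. Qed.

Lemma disc_proper v w x : B v x -> B w x -> radius w < radius v -> B w `<` B v.
Proof.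
move=> vx wx wv; rewrite (B_disc_at vx) (B_disc_at wx); split.
  by apply: disc_le => //; exact: ltW.
by move=> /(disc_subset p_prime)[]; rewrite leNgt wv.
Qed.

Lemma U_disjoint v w x : U v x -> U w x -> v = w.
Proof.
move=> [Fx vx vU] [_ wx wU]; have [wv|vw|e] := ltgtP (radius w) (radius v).
- by case: (vU w); first exact: disc_proper vx wx wv.
- by case: (wU v); first exact: disc_proper wx vx vw.
- by apply: B_inj; rewrite (B_disc_at vx) (B_disc_at wx) e.
Qed.

(** A maximal proper subdisc of B v that contains a vertex disc is itself a
    vertex disc, and the disc bounding a hole is a vertex disc; hence U v is a
    union of maximal proper subdiscs of B v. *)
Lemma U_subdisc v x : U v x -> disc x (radius v - 1) `<=` U v.
Proof.
move=> [Fx vx vU] y xy; have vy : B v y.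
  by rewrite (B_disc_at vx); apply: disc_le xy => //; rewrite gerBl.
have noB w : B w y -> radius w < radius v -> False.
  move=> wy wv.
  have [w' w'E] : exists w', B w' = disc y (radius v - 1).
    apply: vertex_ofP; apply: (vertex_up (vertexB w)).
      by rewrite (B_disc_at wy); apply: disc_le => //; rewrite lerBrDr lezD1.
    apply: subset_trans (@B_root v); rewrite (B_disc_at vy).
    by apply: disc_le => //; rewrite gerBl.
  apply: (vU w'); last by rewrite w'E; exact: disc_sym.
  rewrite w'E (B_disc_at vy); split; first by apply: disc_le => //; rewrite gerBl.
  by move=> /(disc_subset p_prime)[]; rewrite lerBrDr gerDl.
split=> //; last first.
  move=> w wv wy; apply: (noB w wy); rewrite ltNge; apply/negP => vw.
  case: wv => _; apply; rewrite (B_disc_at vy) (B_disc_at wy); exact: disc_le.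
move=> h hy; have [ho|ho] := eqVneq h o.
  by move: hy; rewrite ho; apply/open_outer; exact: B_root vy.
have {}hy := (open_inner _ ho).1 hy.
have [hv|vh] := ltP (rad D h) (radius v); last first.
  apply: (Fx h); apply/(open_inner _ ho).
  rewrite (disc_eq hy); apply: disc_le (disc_sym xy) => //.
  by rewrite lerD2r.
have [w wE] := vertex_ofP (boundary_vertexP h).
have wy : B w y by rewrite wE; apply: disc_le hy => //; rewrite gerBl.
apply: (noB w wy); apply: le_lt_trans hv; rewrite le_eqVlt; apply/orP; left; apply/eqP.
by apply: (disc_inj p_prime (x := y) (y := ctr D h)); rewrite -(B_disc_at wy) wE.
Qed.

(** If y lies in B v, then it lies in another maximal proper subdisc of B v than
    x, hence at distance p^(radius v); otherwise its distance is the same to all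
    points of B v. *)
Lemma U_dist v w x y x' y' : v != w -> U v x -> U v x' -> U w y -> U w y' ->
  pabs (x - y) = pabs (x' - y').
Proof.
have half v1 w1 x1 x2 y1 : v1 != w1 -> U v1 x1 -> U v1 x2 -> U w1 y1 ->
    pabs (x1 - y1) = pabs (x2 - y1).
  move=> vw vx1 vx2 wy.
  have sep z : U v1 z -> ~ disc z (radius v1 - 1) y1.
    move=> vz /(U_subdisc vz) vy; move: vw.
    by rewrite (U_disjoint vy wy) eqxx.
  have b1 := U_sub vx1; have b2 := U_sub vx2.
  have [vy|vy] := pselect (B v1 y1).
    rewrite (disc_shell p_prime (k := radius v1)) -?(B_disc_at b1)//; last exact: sep.
    by rewrite (disc_shell p_prime (k := radius v1)) -?(B_disc_at b2)//; exact: sep.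
  apply: (disc_far (k := radius v1)); last by rewrite -(B_disc_at b2).
  by rewrite -(B_disc_at b2).
move=> vw vx vx' wy wy'; rewrite (half _ _ _ _ _ vw vx vx' wy) pabs_sub.
by rewrite (half w v y y' x') 1?eq_sym// pabs_sub.
Qed.

Hypothesis E_simple : simple_attachment D.

Let bv h : V := projT1 (cid (vertex_ofP (boundary_vertexP h))).
Let bvE h : B (bv h) = boundary_vertex D h.
Proof. exact: projT2 (cid (vertex_ofP (boundary_vertexP h))). Qed.

Let root := bv o.

Lemma parent_ex v : v != root -> exists w, B w = disc (base v) (radius v + 1).
Proof.
move=> vr; apply: vertex_ofP; apply: (vertex_up (vertexB v)).
  by rewrite (B_disc v); apply: disc_le => //; rewrite lerDl.
have bo : B root (base v) by rewrite bvE; apply: B_root; exact/U_sub/base_U.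
rewrite -bvE (B_disc_at bo); apply: disc_le => //; rewrite lezD1 ltNge.
apply/negP => rv; move/eqP: vr; apply; apply: B_inj; apply/seteqP; split.
  by rewrite bvE; exact: B_root.
by rewrite (B_disc_at bo) (B_disc v); exact: disc_le.
Qed.

Let parent v : V := if pselect (exists w, B w = disc (base v) (radius v + 1)) is left e
  then projT1 (cid e) else v.
Let parentE v : v != root -> B (parent v) = disc (base v) (radius v + 1).
Proof.
move=> /parent_ex e; rewrite /parent; case: pselect => // e'.
exact: projT2 (cid e').
Qed.

Let radius_eq v x k : B v = disc x k -> radius v = k.
Proof. by rewrite B_disc => /(disc_inj p_prime). Qed.

Let child v w : B w = disc (base v) (radius v + 1) -> v != root /\ parent v = w.
Proof.
move=> wE; have vr : v != root.
  apply/eqP => vr; have := @B_root w; rewrite wE -bvE -/root -vr (B_disc v).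
  by move=> /(disc_subset p_prime)[]; rewrite gerDl.
by split=> //; apply: B_inj; rewrite parentE.
Qed.

Let bt_adjP v w : bt_adj (B v) (B w) <->
  (v != root /\ parent v = w) \/ (w != root /\ parent w = v).
Proof.
split.
  have half v1 w1 x k : B v1 = disc x k -> B w1 = disc x (k + 1) ->
      v1 != root /\ parent v1 = w1.
    move=> v1E w1E; apply: child; rewrite w1E (radius_eq v1E).
    have xk : disc x k (base v1) by rewrite -v1E; exact/U_sub/base_U.
    by apply: disc_eq; apply: disc_le xk => //; rewrite lerDl.
  move=> [x [k [[v1 w1]|[w1 v1]]]]; first by left; exact: half v1 w1.
  by right; exact: half w1 v1.
move=> [[vr <-]|[wr <-]]; rewrite parentE//.
  by exists (base v), (radius v); left; split=> //; exact: B_disc.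
by exists (base w), (radius w); right; split=> //; exact: B_disc.
Qed.

Let attachedP i v w : attached_edge D i (B v) (B w) <->
  (bv (i, false) = v /\ bv (i, true) = w) \/ (bv (i, false) = w /\ bv (i, true) = v).
Proof.
rewrite /attached_edge -!bvE; split.
  by move=> [[/B_inj -> /B_inj ->]|[/B_inj -> /B_inj ->]]; [left|right].
by move=> [[-> ->]|[-> ->]]; [left|right].
Qed.

(** The edges of the tree correspond to the vertices other than the root, each
    joined to its parent, the disc of p times its radius; the g attached edges
    correspond to the generators. *)
Lemma orientation_exists : exists m (src tgt : 'I_m -> V),
  orientation (reduction_graph D B) src tgt /\ (m.+1 = #|V| + g)%N.
Proof.
pose J : finType := ({v : V | v != root} + 'I_g)%type.
pose s0 (j : J) := match j with inl v => val v | inr i => bv (i, false) end.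
pose t0 (j : J) := match j with inl v => parent (val v) | inr i => bv (i, true) end.
have btJ (v : {v : V | v != root}) : bt_adj (B (val v)) (B (parent (val v))).
  by apply/bt_adjP; left; split=> //; exact: (valP v).
have bt_sym v w : bt_adj (B v) (B w) -> bt_adj (B w) (B v).
  by move=> /bt_adjP h; apply/bt_adjP; case: h; [right|left].
have nbt i : ~ bt_adj (B (bv (i, false))) (B (bv (i, true))).
  by rewrite !bvE; exact: (E_simple.1 i).2.
have nloop i : bv (i, false) <> bv (i, true).
  by move=> h; apply: (E_simple.1 i).1; rewrite -!bvE h.
have par_lt v : v != root -> radius (parent v) = radius v + 1.
  by move=> /parentE/radius_eq.
have nat_ i j : attached_edge D i (B (bv (j, false))) (B (bv (j, true))) -> i = j.
  by rewrite !bvE => h; apply/eqP/negPn/negP => ij; exact: (E_simple.2 i j ij h).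
exists #|J|, (s0 \o enum_val), (t0 \o enum_val); split; last first.
  rewrite card_sum card_ord -addSn; congr (_ + g)%N.
  rewrite card_sig; have := cardC (pred1 root); rewrite card1 add1n => <-.
  by congr _.+1; apply: eq_card => v.
have key (i j : J) : s0 i = s0 j -> t0 i = t0 j -> i = j.
  case: i j => [v|i] [w|j] /=.
  - by move=> vw _; congr inl; exact: val_inj.
  - by move=> vs vt; case: (nbt j); rewrite -vs -vt; exact: btJ.
  - by move=> vs vt; case: (nbt i); rewrite vs vt; exact: btJ.
  - by move=> e1 e2; congr inr; apply: nat_; apply/attachedP; left.
have key2 (i j : J) : s0 i = t0 j -> t0 i = s0 j -> False.
  case: i j => [v|i] [w|j] /=.
  - move=> vw wv; have := par_lt _ (valP v); have := par_lt _ (valP w).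
    rewrite /= -vw wv; move: (radius _) (radius _) => a b -> h; lia.
  - by move=> vs vt; case: (nbt j); rewrite -vs -vt; exact/bt_sym/btJ.
  - by move=> vs vt; case: (nbt i); rewrite vs vt; exact/bt_sym/btJ.
  - move=> e1 e2; have ij : i = j by apply: nat_; apply/attachedP; right.
    by case: (nloop j); rewrite -{1}ij.
split=> [v w|i j /= h1 h2|i j /= h1 h2]; last 2 first.
- by apply: enum_val_inj; exact: key.
- exact: key2 h1 h2.
split.
  move=> /asboolP[/bt_adjP h|[i /attachedP h]].
    case: h => -[xr <-].
      by exists (enum_rank (inl (exist (fun v : V => v != root) _ xr) : J)); left; rewrite /= enum_rankK.
    by exists (enum_rank (inl (exist (fun v : V => v != root) _ xr) : J)); right; rewrite /= enum_rankK.
  by exists (enum_rank (inr i : J)); rewrite /= enum_rankK.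
move=> [j] /=; case: (enum_val j) => [u|i] /= h; apply/asboolP.
  by left; case: h => -[<- <-]; [exact: btJ|exact/bt_sym/btJ].
by right; exists i; apply/attachedP.
Qed.

Lemma reduction_graph_sym : symmetric (reduction_graph D B).
Proof.
have bt_sym A A' : bt_adj A A' -> bt_adj (A' : set (Qp K)) A.
  by move=> [x [k h]]; exists x, k; case: h; [right|left].
have at_sym i A A' : attached_edge D i A A' -> attached_edge D i A' A.
  by case; [right|left].
move=> v w; apply/asboolP/asboolP => -[h|[i h]];
  by [left; exact: bt_sym|right; exists i; exact: at_sym].
Qed.

Lemma card_V_gt0 : (0 < #|V|)%N.
Proof. by apply/card_gt0P; exists root. Qed.

End Tree.

(** * Subdivisions of the vertex sets into discs *)
(** These are the properties of the holed discs of a fundamental domain on which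
    the analysis of the operators rests. *)
Record disc_family (R : realType) (p : nat) (K : padic_field R p) (V : finType)
    (U : V -> set (QpB K)) (base : V -> Qp K) (radius : V -> int) : Prop := {
  df_base : forall v, U v (base v);
  df_sub : forall v, U v `<=` disc (base v) (radius v);
  df_subdisc : forall v x, U v x -> disc x (radius v - 1) `<=` U v;
  df_disjoint : forall v w x, U v x -> U w x -> v = w;
  df_dist : forall v w x y x' y', v != w -> U v x -> U v x' -> U w y -> U w y' ->
    pabs ((x : Qp K) - (y : Qp K)) = pabs ((x' : Qp K) - (y' : Qp K))
}.

Section Levels.
Context (R : realType) (p : nat) (p_prime : prime p) (K : padic_field R p).
Context (mu : {sigma_finite_measure set (QpB K) -> \bar R}) (mu_haar : is_haar mu).
Context (V : finType) (U : V -> set (QpB K)) (base : V -> Qp K) (radius : V -> int).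
Hypothesis family : disc_family U base radius.
Let base_U := df_base family.
Let U_sub := df_sub family.
Let U_subdisc := df_subdisc family.
Let U_disjoint := df_disjoint family.
Let U_dist := df_dist family.
Local Notation q := (p%:R : R).
Local Notation C := R[i].
Local Notation T := (QpB K).
Implicit Types (v w : V) (x y z : Qp K).

Definition centre v (a : nat) : Qp K := subcentre (base v) (radius v) a.
Definition rad_at v (n : nat) : int := radius v - n%:Z.
Definition levelI n := (V * 'I_(p ^ n))%type.
(** For n = 0 this is U v; for n > 0 it is either empty or a disc contained in
    U v. *)
Definition lcell n (c : levelI n) : set T := U c.1 `&` disc (centre c.1 c.2) (rad_at c.1 n).

Lemma centre0 v : centre v 0 = base v.
Proof. by rewrite /centre /subcentre mul0r addr0. Qed.

Lemma rad_at_le v n k : (n <= k)%N -> rad_at v k <= rad_at v n.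
Proof. by move=> nk; rewrite /rad_at lerD2l lerN2 lez_nat. Qed.

Lemma rad_atS v n : rad_at v n.+1 = rad_at v n - 1.
Proof. by rewrite /rad_at -addrA -opprD -PoszD addn1. Qed.

Lemma rad_at_le1 v n : (0 < n)%N -> rad_at v n <= radius v - 1.
Proof. exact: (@rad_at_le v 1 n). Qed.

Lemma lcell_exists v x n : U v x -> exists a : 'I_(p ^ n), lcell (v, a) x.
Proof.
move=> vx; have [a an ax] := subcentre_exists p_prime n (U_sub vx).
by exists (Ordinal an).
Qed.

Lemma lcell_centre v a n : U v (centre v a) -> disc (centre v a) (rad_at v n.+1) `<=` U v.
Proof.
move=> /U_subdisc; apply: subset_trans; apply: disc_le => //; exact: rad_at_le1.
Qed.

Lemma lcell_full n (c : levelI n.+1) : U c.1 (centre c.1 c.2) ->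
  lcell c = disc (centre c.1 c.2) (rad_at c.1 n.+1).
Proof. by move=> Uc; rewrite /lcell setIidr//; exact: lcell_centre. Qed.

Lemma lcell_meet n (c : levelI n.+1) x : lcell c x -> U c.1 (centre c.1 c.2).
Proof.
move=> [Ux cx]; apply: (U_subdisc Ux); apply: disc_le (disc_sym cx) => //.
exact: rad_at_le1.
Qed.

Lemma lcell_empty n (c : levelI n.+1) : ~ U c.1 (centre c.1 c.2) -> lcell c = set0.
Proof. by move=> nU; apply/seteqP; split=> // x /lcell_meet. Qed.

Lemma measurable_lcellS n (c : levelI n.+1) : measurable (lcell c).
Proof.
have [Uc|nUc] := pselect (U c.1 (centre c.1 c.2)).
  by rewrite lcell_full//; exact: measurable_disc.
by rewrite lcell_empty.
Qed.

Lemma measurable_U v : measurable (U v).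
Proof.
rewrite (_ : U v = \bigcup_(a in [set: 'I_(p ^ 1)]) lcell (v, a)).
  by apply: fin_bigcup_measurable => // a _; exact: measurable_lcellS.
apply/seteqP; split=> x; last by move=> [a _ []].
by move=> /(lcell_exists 1)[a ax]; exists a.
Qed.

Lemma measurable_lcell n (c : levelI n) : measurable (lcell c).
Proof. by apply: measurableI; [exact: measurable_U|exact: measurable_disc]. Qed.

Lemma lcell_mu_fin n (c : levelI n) : mu (lcell c) \is a fin_num.
Proof.
rewrite ge0_fin_numE//; apply: (@le_lt_trans _ _ (mu (disc (centre c.1 c.2) (rad_at c.1 n)))).
  apply: le_measure; rewrite ?inE; [exact: measurable_lcell|exact: measurable_disc|].
  exact: subIsetr.
by rewrite haar_disc// ltry.
Qed.

Definition lcellm n (c : levelI n) : R := fine (mu (lcell c)).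

Lemma lcell_disj n (c c' : levelI n) x : lcell c x -> lcell c' x -> c = c'.
Proof.
case: c c' => v a [w b] [vx ax] [wx bx]; have /= e := U_disjoint vx wx; subst w.
congr pair; apply: val_inj; exact: subcentre_uniq (ltn_ord a) (ltn_ord b) ax bx.
Qed.

Definition lcellr n (c c' : levelI n) : R :=
  if c.1 == c'.1 then pabs (centre c.1 c.2 - centre c'.1 c'.2)
  else pabs (base c.1 - base c'.1).

Lemma lcell_dist n (c c' : levelI n) (x y : T) : c != c' -> lcell c x -> lcell c' y ->
  dist x y = lcellr c c'.
Proof.
case: c c' => v a [w b] cc' [vx ax] [wy by_]; rewrite /lcellr /dist /=.
have [e|vw] := eqVneq v w; last exact: (U_dist vw).
subst w; have nd x' y' : disc (centre v a) (rad_at v n) x' ->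
    disc (centre v b) (rad_at v n) y' -> ~ disc x' (rad_at v n) y'.
  move=> ax' by' xy; move/eqP: cc'; apply; congr pair; apply: val_inj.
  exact: subcentre_uniq (ltn_ord a) (ltn_ord b) (disc_trans ax' xy) by'.
have rf z : disc z (rad_at v n) z by exact: disc_refl.
rewrite (disc_far (k := rad_at v n) (x := centre v a) ax); last first.
  by move=> h; apply: (nd (centre v a) y) => //; exact: disc_refl.
rewrite pabs_sub (disc_far (k := rad_at v n) (x := centre v b) by_); last first.
  move=> h; apply: (nd (centre v a) (centre v b)); [exact: rf|exact: rf|exact: disc_sym].
by rewrite pabs_sub.
Qed.

Lemma lcellr_sym n (c c' : levelI n) : lcellr c c' = lcellr c' c.
Proof. by rewrite /lcellr eq_sym pabs_sub [pabs (base _ - _)]pabs_sub; case: eqP => // ->. Qed.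

Definition level_cells (n : nat) : cells mu U.
Proof.
apply: (@Cells R p K mu V U (levelI n : finType) (@lcell n) fst (@lcellm n) (@lcellr n)).
- exact: measurable_lcell.
- by move=> c; rewrite /lcellm fineK// lcell_mu_fin.
- exact: lcell_disj.
- move=> v x; split=> [/(lcell_exists n)[a ax]|[[w a] /= <- []//]].
  by exists (v, a).
- exact: lcell_dist.
- exact: lcellr_sym.
Defined.

Lemma U_mu_fin v : mu (U v) \is a fin_num.
Proof.
rewrite ge0_fin_numE//; apply: (@le_lt_trans _ _ (mu (disc (base v) (radius v)))).
  apply: le_measure; rewrite ?inE; [exact: measurable_U|exact: measurable_disc|].
  exact: U_sub.
by rewrite haar_disc// ltry.
Qed.

Definition Um v : R := fine (mu (U v)).

Lemma Um_gt0 v : 0 < Um v.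
Proof.
have : ((q ^ (radius v - 1))%:E <= mu (U v))%E.
  rewrite -(haar_disc p_prime mu_haar (base v)).
  apply: le_measure; rewrite ?inE; [exact: measurable_disc|exact: measurable_U|].
  exact: U_subdisc.
rewrite -[mu (U v)]fineK ?U_mu_fin// lee_fin; apply: lt_le_trans; exact: pexp_gt0.
Qed.

Definition block_cells : cells mu U.
Proof.
apply: (@Cells R p K mu V U V U id Um (fun v w => pabs (base v - base w))).
- exact: measurable_U.
- by move=> c; rewrite /Um fineK// U_mu_fin.
- exact: U_disjoint.
- by move=> v x; split=> [vx|[w <-]//]; exists v.
- by move=> v w x y vw vx wy; exact: (U_dist vw).
- by move=> v w; rewrite pabs_sub.
Defined.

(** This is the compactness of U v: if a locally
    constant function were not constant on the discs of any common radius, this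
    would persist in a nested sequence of discs shrinking to a point. *)
Lemma loc_const_uniform (u : T -> C) v : loc_const U u ->
  exists N : nat, forall y z, U v y -> U v z -> pabs (y - z) <= q ^ rad_at v N -> u y = u z.
Proof.
move=> lu; pose good x n N := forall y z, U v y -> U v z ->
  disc x (rad_at v n) y -> pabs (y - z) <= q ^ rad_at v N -> u y = u z.
pose bad (xn : Qp K * nat) := U v xn.1 /\ forall N, ~ good xn.1 xn.2 N.
suff : ~ bad (base v, 0%N).
  move=> nb; have [N gN] : exists N, good (base v) 0 N.
    apply/not_existsP => h; apply: nb; split=> //=; exact: base_U.
  exists N => y z vy vz; apply: gN => //; rewrite /rad_at subr0; exact: U_sub.
move=> bad0.
have step xn : bad xn -> exists yn, [/\ bad yn, yn.2 = xn.2.+1 &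
    disc xn.1 (rad_at v xn.2) yn.1].
  case: xn => x n [/= vx bx]; apply/not_existsP => H.
  have good_y y : U v y -> disc x (rad_at v n) y -> exists N, good y n.+1 N.
    move=> vy xy; apply/not_existsP => h; apply: (H (y, n.+1)); split=> //.
  pose hit (a : 'I_(p ^ n.+1)) (N : nat) := exists2 y, U v y &
    [/\ disc x (rad_at v n) y, lcell (v, a) y & good y n.+1 N].
  pose Na a := if pselect (exists N, hit a N) is left e then projT1 (cid e) else 0%N.
  apply: (bx (maxn (\max_a Na a)%N n.+1)) => y z vy vz xy yz.
  have [a ay] := lcell_exists n.+1 vy.
  have eh : exists N, hit a N.
    by have [N gN] := good_y y vy xy; exists N, y.
  have [y' vy' [xy' ay' gy']] : hit a (Na a).
    by rewrite /Na; case: pselect => // e; exact: projT2 (cid e).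
  have d1 : disc y' (rad_at v n.+1) y.
    by case: ay' => _ ay'; case: ay => _; apply: disc_trans (disc_sym ay').
  apply: (gy' y z vy vz d1); apply: le_trans yz _.
  rewrite pexp_le// rad_at_le// leq_max; apply/orP; left.
  refine (@leq_bigmax _ Na a).
have [xs [xs0 xsS]] : {xs : nat -> Qp K * nat | xs 0%N = (base v, 0%N) /\
    forall n, bad (xs n) -> [/\ bad (xs n.+1), (xs n.+1).2 = (xs n).2.+1 &
    disc (xs n).1 (rad_at v (xs n).2) (xs n.+1).1]}.
  have /choice[next nextP] : forall xn, exists yn, bad xn ->
      [/\ bad yn, yn.2 = xn.2.+1 & disc xn.1 (rad_at v xn.2) yn.1].
    move=> xn; have [b|nb] := pselect (bad xn); last by exists xn.
    by have [yn ynP] := step xn b; exists yn.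
  by exists (fun n => iter n next (base v, 0%N)); split=> // n bn; exact: nextP.
have allbad n : bad (xs n) by elim: n => [|n /xsS[]//]; rewrite xs0.
have lvl n : (xs n).2 = n.
  by elim: n => [|n IH]; [rewrite xs0|have [_ -> _] := xsS n (allbad n); rewrite IH].
have nest n k : disc (xs n).1 (rad_at v n) (xs (n + k)%N).1.
  elim: k => [|k IH]; first by rewrite addn0; exact: disc_refl.
  apply: disc_trans IH _; rewrite addnS; have [_ _] := xsS _ (allbad (n + k)%N).
  by rewrite lvl; apply: disc_le => //; apply: rad_at_le; exact: leq_addr.
have small (e : R) : 0 < e -> exists n, q ^ rad_at v n < e.
  move=> e0; have := cvg_geometric (q ^ radius v) (z := q^-1).
  rewrite ger0_norm ?invr_ge0 ?ltW ?p_gt0// invf_lt1 ?p_gt0// p_gt1// => /(_ isT).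
  move=> /cvgrPdist_lt/(_ e e0)[N _ /(_ N (leqnn N))] h; exists N; move: h => /=.
  rewrite /geometric/= sub0r normrN ger0_norm; last first.
    by rewrite mulr_ge0 ?exprn_ge0 ?invr_ge0// ltW ?pexp_gt0 ?p_gt0.
  by rewrite /rad_at pexpD// exprVn exprnN.
have small_le n k : (n <= k)%N -> disc (xs n).1 (rad_at v n) (xs k).1.
  by move=> nk; rewrite -(subnKC nk); exact: nest.
have [|l lP] := @padic_complete _ _ K (fun n => (xs n).1).
  move=> e e0; have [N Ne] := small e e0; exists N => i j Ni Nj; apply: le_lt_trans Ne.
  exact: (disc_trans (disc_sym (small_le N j Nj)) (small_le N i Ni)).
have inl_ n : disc (xs n).1 (rad_at v n) l.
  have [M HM] := lP _ (pexp_gt0 R p_prime (rad_at v n)).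
  apply: (disc_trans (small_le n (maxn n M) (leq_maxl _ _))).
  by rewrite /disc /= pabs_sub ltW// HM// leq_maxr.
have vl : U v l.
  have [v1 _] := allbad 1%N; apply: (U_subdisc v1).
  by have := inl_ 1%N.
have [k lk] := lu l (ex_intro _ v vl).
have [n nk] := small _ (pexp_gt0 R p_prime k).
have ll z : disc l (rad_at v n) z -> U v z -> u z = u l.
  move=> lz vz; apply: lk; first by exists v.
  by rewrite /dist pabs_sub; apply: le_trans lz (ltW nk).
have [_ /(_ n)] := allbad n; apply; rewrite lvl => y z vy vz xy yz.
have ly := disc_trans (disc_sym (inl_ n)) xy.
by rewrite (ll y)// (ll z)//; apply: disc_trans ly _; rewrite /disc /= pabs_sub.
Qed.

Lemma loc_const_level (u : T -> C) : loc_const U u ->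
  exists N, forall n, (N <= n)%N -> level level_cells n u.
Proof.
move=> lu; have /choice[Nv NvP] := fun v => loc_const_uniform v lu.
exists (\max_v Nv v)%N => n Nn; apply: levelP => -[v a] y z [vy ay] [vz az].
apply: (NvP v) => //; apply: le_trans (disc_trans (disc_sym az) ay) _.
rewrite pexp_le// rad_at_le//; apply: leq_trans Nn; exact: (@leq_bigmax _ Nv v).
Qed.

Lemma level_loc_const n (u : T -> C) : level level_cells n u -> loc_const U u.
Proof.
move=> [F uF] x [v vx]; have [a ax] := lcell_exists n vx.
have [k kP] : exists k : int, forall w, k <= rad_at w n.
  have [M HM] : exists M : nat, forall w, (absz (rad_at w n) <= M)%N.
    by exists (\max_w absz (rad_at w n))%N => w; exact: (@leq_bigmax _ (fun w => absz (rad_at w n)) w).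
  by exists (- M%:Z) => w; have := HM w; lia.
have [k' k'P] : exists k' : int, forall w, v != w -> q ^ k' < pabs (base v - base w).
  have /choice[kw kwP] : forall w, exists k' : int, v != w -> q ^ k' < pabs (base v - base w).
    move=> w; have [->|vw] := eqVneq v w; first by exists 0.
    have [|k' k'E] := @pabs_val R p K (base v - base w).
      rewrite subr_eq0; apply/eqP => e; move/eqP: vw; apply.
      by apply: (U_disjoint (base_U v)); rewrite e; exact: base_U.
    by exists (k' - 1) => _; rewrite k'E pexp_lt// gtrBl.
  have [M HM] : exists M : nat, forall w, (absz (kw w) <= M)%N.
    by exists (\max_w absz (kw w))%N => w; exact: (@leq_bigmax _ (fun w => absz (kw w)) w).
  exists (- M%:Z) => w vw; apply: le_lt_trans (kwP w vw); rewrite pexp_le//.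
  by have := HM w; lia.
exists (Num.min k k') => y [w wy] xy.
have vw : v = w.
  apply/eqP/negPn/negP => vw; have := k'P w vw; rewrite ltNge => /negP; apply.
  rewrite (@U_dist v w _ _ x y vw (base_U v) vx (base_U w) wy).
  by apply: le_trans xy _; rewrite pexp_le// ge_min lexx orbT.
subst w; rewrite (uF (v, a) x ax) (uF (v, a) y)//; split=> //=; case: ax => _ /= ax.
apply: disc_trans ax _; rewrite /disc /= pabs_sub; apply: le_trans xy _.
by rewrite pexp_le//; apply: le_trans (kP v); rewrite ge_min lexx.
Qed.

Lemma level_le n k (u : T -> C) : (n <= k)%N -> level level_cells n u -> level level_cells k u.
Proof.
move=> nk [F uF]; apply: levelP => -[v a] x y [vx ax] [vy ay].
have [b [_ bx]] := lcell_exists n vx; rewrite (uF (v, b) x)//.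
rewrite (uF (v, b) y)//; split=> //=; apply: (disc_trans bx).
apply: disc_le (disc_trans (disc_sym ax) ay) => //; exact: rad_at_le.
Qed.

End Levels.

(** * Density in the space of square integrable functions *)
Import HBSimple HBNNSimple.
Section L2Density.
Context d (T : measurableType d) (R : realType).
Context (mu : {measure set T -> \bar R}) (D : set T) (mD : measurable D).
Hypothesis muD : (mu D < +oo)%E.
Local Notation C := R[i].
Local Notation L2 := (L2 mu D).
Local Notation sqnorm := (sqnorm mu D).

(** Dominated convergence for the squared distances. *)
Lemma L2_dominated (u : nat -> T -> C) (f : T -> C) (h : T -> R) :
  (forall n, cmeas D (u n)) -> cmeas D f -> mu.-integrable D (EFin \o h) ->
  (forall n x, D x -> sqmod (f x - u n x) <= h x) ->
  (forall x, D x -> (fun n => sqmod (f x - u n x)) @ \oo --> 0) ->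
  forall e : R, 0 < e -> exists n, (sqnorm (fun x => f x - u n x)%R < e%:E)%E.
Proof.
move=> mu_ mf ih uh cv e e0.
have mfu n : cmeas D (fun x => f x - u n x).
  have := cmeasD mf (cmeasM (cmeas_cst D (-1)) (mu_ n)).
  by apply: eq_cmeas => x _; rewrite mulN1r.
have [] := @dominated_convergence _ T R mu D mD
  (fun n x => (sqmod (f x - u n x))%:E) (fun=> 0%E) (EFin \o h).
- by move=> n; exact: measurable_sqmodE.
- exact: measurable_cst.
- by apply: aeW => x Dx; apply: cvg_EFin; [exact: nearW|exact: cv].
- exact: ih.
- apply: aeW => x n Dx; rewrite abse_EFin lee_fin ger0_norm ?sqmod_ge0//; exact: uh.
move=> _ _; rewrite integral0 => cv0.
have : \forall n \near \oo, (sqnorm (fun x => f x - u n x)%R < e%:E)%E.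
  by apply: (cv0 [set y | (y < e%:E)%E]); apply: open_ereal_lt'; rewrite lte_fin.
by move=> [N _ HN]; exists N; exact: HN (leqnn N).
Qed.

Context (S : set (T -> C)).
Hypothesis S_L2 : forall f, S f -> L2 f.
Hypothesis S_add : forall f g, S f -> S g -> S (fun x => f x + g x).
Hypothesis S_scale : forall c f, S f -> S (fun x => c * f x).

Let appr (f : T -> C) := L2 f /\
  forall e : R, 0 < e -> exists2 g, S g & (sqnorm (fun x => f x - g x)%R < e%:E)%E.

Lemma S_appr f : S f -> appr f.
Proof.
move=> Sf; split=> [|e e0]; first exact: S_L2.
exists f => //; rewrite sqnormE integral0_eq ?lte_fin// => x _.
by rewrite subrr sqmod0.
Qed.

Lemma appr_eq f g : (forall x, D x -> f x = g x) -> appr f -> appr g.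
Proof.
move=> fg [Lf H]; split=> [|e e0]; first exact: eq_L2 fg Lf.
have [h Sh fh] := H e e0; exists h => //.
rewrite (@eq_sqnorm _ _ _ _ _ _ (fun x => f x - h x))// => x Dx.
by rewrite fg.
Qed.

Lemma appr_lim f : L2 f ->
  (forall e : R, 0 < e -> exists2 g, appr g & (sqnorm (fun x => f x - g x)%R < e%:E)%E) ->
  appr f.
Proof.
move=> Lf H; split=> // e e0; have e4 : 0 < e / 4 by rewrite divr_gt0.
have [g [Lg gS] fg] := H _ e4; have [h Sh gh] := gS _ e4; exists h => //.
have Lh := S_L2 Sh; have L1 := L2B mD Lf Lg; have L2' := L2B mD Lg Lh.
have L3 := L2B mD Lf Lh.
apply: (@le_lt_trans _ _ (2%:E * sqnorm (fun x => f x - g x)%R +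
    2%:E * sqnorm (fun x => g x - h x)%R)%E).
  apply: (@sqnorm_le d T R mu D mD (fun x => f x - g x) (fun x => g x - h x) 2 2
    (fun x => f x - h x) (ler0n _ 2) (ler0n _ 2) (L2_cmeas L1) (L2_cmeas L2') (L2_cmeas L3)).
  move=> x _; apply: le_trans (sqmodD _ _); rewrite addrA subrK; exact: lexx.
move: fg gh; rewrite !sqnrmE// !lte_fin => fg gh.
by lra.
Qed.

Lemma appr_add f g : appr f -> appr g -> appr (fun x => f x + g x).
Proof.
move=> [Lf Hf] [Lg Hg]; split=> [|e e0]; first exact: L2D.
have e4 : 0 < e / 4 by rewrite divr_gt0.
have [f' Sf ff] := Hf _ e4; have [g' Sg gg] := Hg _ e4.
exists (fun x => f' x + g' x); first exact: S_add.
have [Lf' Lg'] := (S_L2 Sf, S_L2 Sg).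
have L1 := L2B mD Lf Lf'; have L2' := L2B mD Lg Lg'.
have L3 := L2B mD (L2D mD Lf Lg) (L2D mD Lf' Lg').
apply: (@le_lt_trans _ _ (2%:E * sqnorm (fun x => f x - f' x)%R +
    2%:E * sqnorm (fun x => g x - g' x)%R)%E).
  apply: (@sqnorm_le d T R mu D mD (fun x => f x - f' x) (fun x => g x - g' x) 2 2
    (fun x => (f x + g x) - (f' x + g' x)) (ler0n _ 2) (ler0n _ 2)
    (L2_cmeas L1) (L2_cmeas L2') (L2_cmeas L3)).
  move=> x _; apply: le_trans (sqmodD _ _); rewrite addrACA -opprD; exact: lexx.
move: ff gg; rewrite !sqnrmE// !lte_fin => fg gh.
by lra.
Qed.

Lemma appr_scale c f : appr f -> appr (fun x => c * f x).
Proof.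
move=> [Lf Hf]; split=> [|e e0]; first exact: L2Z.
have c0 : 0 < sqmod c + 1 by rewrite ltr_wpDl// sqmod_ge0.
have e4 : 0 < e / (sqmod c + 1) by rewrite divr_gt0.
have [g Sg fg] := Hf _ e4; exists (fun x => c * g x); first exact: S_scale.
have Lfg := L2B mD Lf (S_L2 Sg).
rewrite (@eq_sqnorm _ _ _ _ _ _ (fun x => c * (f x - g x))%R); last first.
  by move=> x _; rewrite mulrBr.
move: fg; rewrite sqnrmE// sqnrmE; last exact: L2Z.
rewrite !lte_fin sqnrmZ// => fg.
apply: le_lt_trans (_ : sqnrm mu D (fun x => f x - g x) * (sqmod c + 1) < e).
  by rewrite mulrC ler_wpM2l ?sqnrm_ge0// lerDl.
by rewrite -ltr_pdivlMr.
Qed.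

Lemma appr_sum (I : Type) (r : seq I) (F : I -> T -> C) : appr (fun=> 0) ->
  (forall i, appr (F i)) -> appr (fun x => \sum_(i <- r) F i x).
Proof.
move=> a0 aF; elim: r => [|i r IH].
  by apply: appr_eq a0 => x _; rewrite big_nil.
by apply: appr_eq (appr_add (aF i) IH) => x _; rewrite big_cons.
Qed.

Context (G : set (set T)) (GE : @measurable _ T = <<s G >>) (GI : setI_closed G).
Let ind (A : set T) : T -> C := fun x => ((\1_A x : R)%:C)%C.
Hypothesis S_ind : forall A, G A -> S (ind A).
Hypothesis S_one : S (fun=> 1).

Let appr0 : appr (fun=> 0).
Proof. by apply: appr_eq (appr_scale 0 (S_appr S_one)) => x _; rewrite mul0r. Qed.

Let ind_L2 A : measurable A -> L2 (ind A).
Proof.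
move=> mA; have mi : measurable_fun D (\1_A : T -> R) by exact: measurable_indic.
split=> //; rewrite sqnormE.
apply: (@le_lt_trans _ _ (\int[mu]_(x in D) 1%:E)%E); last first.
  by rewrite integral_cst// mul1e.
apply: ge0_le_integral => //.
- by move=> x _; rewrite lee_fin sqmod_ge0.
- by apply: measurable_sqmodE.
- by move=> x _; rewrite lee_fin sqmod_real indicE; case: (_ \in _); rewrite ?expr1n ?expr0n.
Qed.

Let appr_ind A : measurable A -> appr (ind A).
Proof.
rewrite GE; apply: (dynkin_induction (P := fun A => appr (ind A)) GE GI).
- by apply: appr_eq (S_appr S_one) => x _; rewrite /ind indicE in_setT.
- by move=> B GB; apply: S_appr; exact: S_ind.
- move=> B mB aB; apply: appr_eq (appr_add (S_appr S_one) (appr_scale (-1) aB)) => x _.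
  rewrite /ind !indicE in_setC; case: (_ \in _); rewrite ?mulr1 ?subrr// mulr0 addr0//.
move=> F mF tF aF.
have mU : measurable (\bigcup_k F k) by exact: bigcup_measurable.
apply: appr_lim; first exact: ind_L2.
move=> e e0; pose u n x : C := \sum_(i <- iota 0 n) ind (F i) x.
have au n : appr (u n) by apply: appr_sum.
have uE k x n : F k x -> u n x = ((k < n)%N)%:R.
  move=> Fk; rewrite /u; have ind0 i : i != k -> ind (F i) x = 0.
    move=> ik; rewrite /ind indicE memNset// => Fi; move/eqP: ik; apply.
    by apply: (tF i k) => //; exists x.
  have [kn|nk] := ltnP k n.
    rewrite (bigD1_seq k) ?iota_uniq ?mem_iota//= big1 ?addr0 => [|i /ind0//].
    by rewrite /ind indicE mem_set.
  rewrite big_seq big1// => i; rewrite mem_iota add0n => /andP[_ ik].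
  by apply: ind0; rewrite neq_ltn (leq_trans ik nk).
have indE k x : F k x -> ind (\bigcup_k F k) x = 1.
  by move=> Fk; rewrite /ind indicE mem_set//; exists k.
have ind0 x n : ~ (\bigcup_k F k) x -> u n x = 0 /\ ind (\bigcup_k F k) x = 0.
  move=> nF; rewrite /ind indicE memNset// /u big1// => i _.
  by rewrite /ind indicE memNset// => Fi; apply: nF; exists i.
have [n un] : exists n, (sqnorm (fun x => ind (\bigcup_k F k) x - u n x)%R < e%:E)%E.
  apply: (@L2_dominated _ _ (fun=> 1)) => //.
  - by move=> n; have [Lu _] := au n; exact: (L2_cmeas Lu).
  - exact: (L2_cmeas (ind_L2 mU)).
  - apply/integrableP; split; first exact: measurable_cst.
    by under eq_integral do rewrite abse_EFin normr1; rewrite integral_cst// mul1e.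
  - move=> n x _; have [[k _ Fk]|nF] := pselect ((\bigcup_k F k) x).
      rewrite (indE k)// (uE k)//; case: (_ < _)%N; first by rewrite subrr sqmod0.
      by rewrite subr0 (sqmod_nat R true).
    by have [-> ->] := ind0 x n nF; rewrite subrr sqmod0.
  - move=> x _; have [[k _ Fk]|nF] := pselect ((\bigcup_k F k) x).
      apply: cvg_near_cst; exists k.+1 => // n /= kn.
      by rewrite (indE k)// (uE k)// kn subrr sqmod0.
    apply: cvg_near_cst; apply: nearW => n.
    by have [-> ->] := ind0 x n nF; rewrite subrr sqmod0.
by exists (u n).
Qed.

Let appr_nonneg (f : T -> R) : measurable_fun D f -> (forall x, 0 <= f x) ->
  mu.-integrable D (EFin \o (fun x => f x ^+ 2)) -> appr (fun x => ((f x)%:C)%C).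
Proof.
move=> mf f0 if2.
have mf' : measurable_fun D (EFin \o f) by apply/measurable_EFinP.
have [u [ndu uf]] := @approximation _ T R D mD _ mf' (fun x _ => f0 x).
have {}uf x : D x -> (fun n => u n x) @ \oo --> f x by move=> /uf /fine_cvg.
have u_le n x : D x -> u n x <= f x.
  move=> Dx; rewrite -(cvg_lim (@Rhausdorff R) (uf x Dx)).
  apply: (nondecreasing_cvgn_le (u_ := fun n => u n x)).
    by move=> a b ab; have /lefP := ndu a b ab; apply.
  exact: (cvgP _ (uf x Dx)).
have ag n : appr (fun x => ((u n x)%:C)%C).
  pose s := finmap.enum_fset (fset_set (u n @` setT)).
  have aF (i : 'I_(size s)) : appr (fun x => ((s`_i)%:C)%C * ind (u n @^-1` [set s`_i]) x).
    apply: appr_scale; apply: appr_ind.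
    rewrite -[X in measurable X]setTI; exact: measurable_funP.
  apply: appr_eq (appr_sum (index_enum _) appr0 aF) => x _.
  rewrite (fimfunEord (u n) x) rmorph_sum; apply: eq_bigr => i _.
  by rewrite rmorphM.
have Lf : L2 (fun x => ((f x)%:C)%C).
  split=> //; rewrite sqnormE; under eq_integral do rewrite sqmod_real.
  have /integrableP[_] := if2; apply: le_lt_trans; rewrite le_eqVlt; apply/orP; left.
  by apply/eqP/eq_integral => x _ /=; rewrite ger0_norm// sqr_ge0.
apply: appr_lim => // e e0.
have [n un] : exists n, (sqnorm (fun x => ((f x)%:C)%C - ((u n x)%:C)%C)%R < e%:E)%E.
  apply: (@L2_dominated (fun n x => ((u n x)%:C)%C) _ (fun x => f x ^+ 2)) => //.
  - by move=> n; have [Lu _] := ag n; exact: (L2_cmeas Lu).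
  - move=> n x Dx; rewrite -rmorphB sqmod_real ler_sqr ?nnegrE//.
    + by rewrite gerBl.
    + by rewrite subr_ge0 u_le.
  - move=> x Dx; have -> : (fun n => sqmod (((f x)%:C)%C - ((u n x)%:C)%C)) =
        (fun n => (f x - u n x) ^+ 2).
      by apply/funext => n; rewrite -rmorphB sqmod_real.
    have c1 : (fun n => f x - u n x) @ \oo --> (0 : R).
      by rewrite -(subrr (f x)); apply: cvgB; [exact: cvg_cst|exact: uf].
    by rewrite -[X in _ --> X](mulr0 (0 : R)); apply: cvgM.
by exists (fun x => ((u n x)%:C)%C).
Qed.

(** By Dynkin's lemma, approximability extends from the generator to the
    indicators of all measurable sets; it extends to nonnegative functions since
    these are limits of simple functions, and then by linearity. *)
Lemma L2_dense f : L2 f -> forall e : R, 0 < e ->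
  exists2 g, S g & (sqnorm (fun x => f x - g x)%R < e%:E)%E.
Proof.
suff H : L2 f -> appr f by move=> /H[].
move=> Lf; have [f1 f2 _] := Lf.
have i2 (v : T -> R) : measurable_fun D v -> (forall x, v x ^+ 2 <= sqmod (f x)) ->
    mu.-integrable D (EFin \o (fun x => v x ^+ 2)).
  move=> mv vf; apply: (@le_integrable _ _ _ mu D mD _ (fun x => (sqmod (f x))%:E)).
  - by apply/measurable_EFinP; exact: measurable_funX.
  - move=> x _ /=; rewrite !ger0_norm ?lee_fin ?sqr_ge0 ?sqmod_ge0//; exact: vf.
  - apply/integrableP; split; first exact: measurable_sqmodE (L2_cmeas Lf).
    under eq_integral do rewrite abse_EFin ger0_norm ?sqmod_ge0//.
    by case: Lf.
have part (v : T -> R) : measurable_fun D v -> (forall x, v x ^+ 2 <= sqmod (f x)) ->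
    appr (fun x => ((v x)%:C)%C).
  move=> mv vf; have c0 : measurable_fun D (fun=> 0 : R) by exact: measurable_cst.
  have sq (a : R) : Num.max a 0 ^+ 2 <= a ^+ 2.
    by rewrite /Num.max; case: ltP => a0; rewrite ?lexx // expr0n /= sqr_ge0.
  have a1 : appr (fun x => ((Num.max (v x) 0)%:C)%C).
    have m1 : measurable_fun D (fun x => Num.max (v x) 0) by exact: measurable_maxr.
    apply: appr_nonneg => //; first by move=> x; rewrite le_max lexx orbT.
    by apply: i2 => // x; exact: le_trans (sq _) (vf x).
  have a2 : appr (fun x => ((Num.max (- v x) 0)%:C)%C).
    have m1 : measurable_fun D (fun x => Num.max (- v x) 0).
      by apply: measurable_maxr => //; exact: measurableT_comp.
    apply: appr_nonneg => //; first by move=> x; rewrite le_max lexx orbT.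
    by apply: i2 => // x; apply: le_trans (sq _) _; rewrite sqrrN.
  apply: appr_eq (appr_add a1 (appr_scale (-1) a2)) => x _.
  rewrite mulN1r -rmorphB; congr (_%:C)%C.
  by rewrite /Num.max; case: ltP => a; case: ltP => b; lra.
have aR := part _ f1 (fun x => _); have aI := part _ f2 (fun x => _).
apply: appr_eq (appr_add (aR _) (appr_scale 'i%C (aI _))) => x.
- by move=> _; rewrite [RHS]complexE.
- by rewrite /sqmod lerDl sqr_ge0.
- by rewrite /sqmod lerDr sqr_ge0.
Qed.

End L2Density.

(** * Householder wavelets *)
Section Indicators.
Context d (T : measurableType d) (R : realType).
Context (mu : {measure set T -> \bar R}) (D : set T) (mD : measurable D).
Local Notation C := R[i].

Definition rind (S : set T) : T -> C := fun x => ((\1_S x : R)%:C)%C.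

Lemma rindT S x : S x -> rind S x = 1.
Proof. by move=> Sx; rewrite /rind indicE mem_set. Qed.

Lemma rindF S x : ~ S x -> rind S x = 0.
Proof. by move=> Sx; rewrite /rind indicE memNset. Qed.

Lemma rind_inner (S S' : set T) : measurable S -> measurable S' ->
  inner mu D (rind S) (rind S') = ((fine (mu (S `&` S' `&` D)))%:C)%C.
Proof.
move=> mS mS'; have mSS : measurable (S `&` S') by exact: measurableI.
rewrite /inner /cintegral /Rintegral; apply: complex_eq => /=.
  rewrite (eq_integral (fun x => (\1_(S `&` S') x)%:E)) => [|x _].
    by rewrite integral_indic.
  by rewrite /rind oppr0 mulr0 subr0 indicI.
rewrite (eq_integral (fun=> 0%E)) ?integral0// => x _.
by rewrite /rind oppr0 mulr0 mul0r addr0.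
Qed.

Lemma rind_L2 (S : set T) : measurable S -> (mu D < +oo)%E -> L2 mu D (rind S).
Proof.
move=> mS Dfin; have mi : measurable_fun D (\1_S : T -> R) by exact: measurable_indic.
split=> //; apply: (@le_lt_trans _ _ (\int[mu]_(x in D) 1%:E)%E); last first.
  by rewrite integral_cst// mul1e.
apply: ge0_le_integral => //.
- by move=> x _; rewrite lee_fin sqmod_ge0.
- exact: (@measurable_sqmodE _ _ _ D (rind S)).
- move=> x _; rewrite lee_fin -[X in X <= _]/(sqmod (rind S x)) sqmod_real indicE.
  by case: (_ \in _); rewrite ?expr1n ?expr0n.
Qed.

(** If A has measure M and contains disjoint sets c and c0 of measure m, this is
    the image of the normalized indicator of c under the reflection that
    exchanges the normalized indicators of c0 and A.  For fixed c0 and A, these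
    functions are therefore orthonormal, and orthogonal to the constants. *)
Definition house (m M : R) (c c0 A : set T) : T -> C :=
  let u := Num.sqrt (m / M) in let k := u / (1 - u) in
  fun x => (((Num.sqrt m)^-1)%:C)%C *
    (rind c x + (k%:C)%C * (rind c0 x - (u%:C)%C * rind A x)).

Section House.
Context (m M : R) (m_gt0 : 0 < m) (mM : m < M) (c c' c0 A : set T).
Hypothesis meas : [/\ measurable c, measurable c', measurable c0 & measurable A].
Hypothesis sub : [/\ c `<=` A, c' `<=` A, c0 `<=` A & A `<=` D].
Hypothesis mus : [/\ mu c = m%:E, mu c' = m%:E, mu c0 = m%:E & mu A = M%:E].
Hypothesis disj : [/\ c `&` c0 = set0 & c' `&` c0 = set0].
Hypothesis Dfin : (mu D < +oo)%E.

Let u := Num.sqrt (m / M).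
Let k := u / (1 - u).

Lemma house_M : 0 < M. Proof. exact: lt_trans mM. Qed.

Lemma house_u2 : u ^+ 2 = m / M.
Proof. by rewrite /u sqr_sqrtr// divr_ge0 ?ltW// house_M. Qed.

Lemma house_u : 0 < u < 1.
Proof.
have M0 := house_M; rewrite /u sqrtr_gt0 divr_gt0//=.
by rewrite -sqrtr1 ltr_sqrt ?ltr01// ltr_pdivrMr// mul1r.
Qed.

Lemma house_k : k * (1 - u) = u.
Proof. by rewrite /k divfK// subr_eq0 gt_eqF//; case/andP: house_u. Qed.

Lemma house_L2 b : measurable b -> L2 mu D (house m M b c0 A).
Proof.
move=> mb; case: meas => _ _ m0 mA; rewrite /house.
apply: L2Z => //; apply: L2D => //; first exact: rind_L2.
apply: L2Z => //; apply: L2B => //; first exact: rind_L2.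
by apply: L2Z => //; exact: rind_L2.
Qed.

Let sq : (Num.sqrt m) * (Num.sqrt m) = m.
Proof. by rewrite -expr2 sqr_sqrtr// ltW. Qed.

Let L2b b : measurable b -> L2 mu D (rind b).
Proof. by move=> mb; exact: rind_L2. Qed.

Lemma house_innerr f b : L2 mu D f -> measurable b ->
  inner mu D f (house m M b c0 A) = (((Num.sqrt m)^-1)%:C)%C *
   (inner mu D f (rind b) + (k%:C)%C *
     (inner mu D f (rind c0) - (u%:C)%C * inner mu D f (rind A))).
Proof.
move=> Lf mb; have [_ _ m0 mA] := meas.
have [Lb L0 LA] := And3 (L2b mb) (L2b m0) (L2b mA).
have LuA := L2Z mD (- (u%:C)%C) LA.
have L1 : L2 mu D (fun x => rind c0 x + (- (u%:C)%C) * rind A x) by exact: L2D.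
have L2_ := L2Z mD ((k%:C)%C) L1.
rewrite (@eq_inner _ _ _ _ _ _ _ f (fun x => (((Num.sqrt m)^-1)%:C)%C *
  (rind b x + (k%:C)%C * (rind c0 x + (- (u%:C)%C) * rind A x))))//; last first.
  by move=> x _; rewrite /house -/u -/k mulNr.
rewrite innerZr//; last exact: L2D.
rewrite innerDr// innerZr// innerDr// innerZr//.
by rewrite conjcN !conjc_real mulNr.
Qed.

Lemma house_innerl f b : L2 mu D f -> measurable b ->
  inner mu D (house m M b c0 A) f = (((Num.sqrt m)^-1)%:C)%C *
   (inner mu D (rind b) f + (k%:C)%C *
     (inner mu D (rind c0) f - (u%:C)%C * inner mu D (rind A) f)).
Proof.
move=> Lf mb; rewrite (innerC mD Lf (house_L2 mb)) house_innerr//.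
have [_ _ m0 mA] := meas.
rewrite !(conjcM, conjcD, conjcN) !conjc_real.
by rewrite -!(innerC mD Lf) //; exact: L2b.
Qed.

Let muI (S S' S'' : set T) (r : R) : S `&` S' = S'' -> S'' `<=` D -> mu S'' = r%:E ->
  ((fine (mu (S `&` S' `&` D)))%:C)%C = (r%:C)%C :> C.
Proof. by move=> -> SD mE; rewrite setIidl// mE. Qed.

Lemma house_mean : inner mu D (fun=> 1) (house m M c c0 A) = 0.
Proof.
have [mc mc' m0 mA] := meas; have [cA c'A c0A AD] := sub; have [mu1 mu1' mu0 muA] := mus.
have L1 : L2 mu D (rind D) by exact: L2b.
rewrite (@eq_inner _ _ _ _ _ _ _ (rind D) (house m M c c0 A))//; last first.
  by move=> x Dx; rewrite rindT.
have cD := subset_trans cA AD; have c0D := subset_trans c0A AD.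
rewrite house_innerr// !rind_inner// (@muI _ _ c m)//; last by rewrite setIidr.
rewrite (@muI _ _ c0 m)//; last by rewrite setIidr.
rewrite (@muI _ _ A M)//; last by rewrite setIidr.
have mE : m = M * u ^+ 2 by rewrite house_u2 mulrC divfK// gt_eqF// house_M.
have hk := house_k; apply: complex_eq; rewrite !partE /=; last by ring.
transitivity ((Num.sqrt m)^-1 * (m + k * (m - u * M))); first by ring.
have -> : m + k * (m - u * M) = M * u * (u - k * (1 - u)) by rewrite mE; ring.
by rewrite hk subrr !mulr0.
Qed.

Lemma house_orthonormal (b : bool) : (if b then c = c' else c `&` c' = set0) ->
  inner mu D (house m M c c0 A) (house m M c' c0 A) = b%:R.
Proof.
move=> cc'.
have [mc mc' m0 mA] := meas; have [cA c'A c0A AD] := sub; have [mu1 mu1' mu0 muA] := mus.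
have [d1 d2] := disj; have mu0s : mu set0 = 0%:E := measure0 mu.
have [cD c'D c0D] := And3 (subset_trans cA AD) (subset_trans c'A AD) (subset_trans c0A AD).
have Lh := house_L2 mc'.
rewrite house_innerl// !house_innerr//; do ?exact: L2b.
rewrite !rind_inner//.
rewrite (@muI c c' (if b then c else set0) (b%:R * m)); last 3 first.
- by case: (b) cc' => [<-|//]; rewrite setIid.
- by case: (b).
- by case: (b); rewrite ?mul1r ?mul0r.
rewrite (@muI c c0 set0 0)// (@muI c A c m)//; last by rewrite setIidl.
rewrite (@muI c0 c' set0 0)//; last by rewrite setIC.
rewrite (@muI c0 c0 c0 m (setIid _) c0D mu0) (@muI c0 A c0 m)//; last by rewrite setIidl.
rewrite (@muI A c' c' m)//; last by rewrite setIidr.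
rewrite (@muI A c0 c0 m)//; last by rewrite setIidr.
rewrite (@muI A A A M (setIid _) AD muA).
have hk := house_k; have hu := house_u2.
have s0 : Num.sqrt m != 0 by rewrite gt_eqF// sqrtr_gt0.
have ME : M * u ^+ 2 = m by rewrite hu mulrC divfK// gt_eqF// house_M.
have m0' : m != 0 by rewrite gt_eqF.
have sm : (Num.sqrt m)^-1 * (Num.sqrt m)^-1 * m = 1.
  by rewrite -invfM sq mulVf.
have bE : ((b%:R * m)%:C)%C = b%:R * (m%:C)%C :> C by rewrite rmorphM rmorph_nat.
have z0 : (0%:C)%C = 0 :> C by [].
have smC : (((Num.sqrt m)^-1)%:C)%C * (((Num.sqrt m)^-1)%:C)%C * (m%:C)%C = 1 :> C.
  by rewrite -!rmorphM /= sm.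
have MEC : (M%:C)%C * (u%:C)%C * (u%:C)%C = (m%:C)%C :> C.
  by rewrite -!rmorphM /= -mulrA -expr2 ME.
have hkC : (k%:C)%C - (k%:C)%C * (u%:C)%C = (u%:C)%C :> C.
  by rewrite -rmorphM -rmorphB /=; congr (_%:C)%C; rewrite -{2}hk; ring.
rewrite bE z0; move: (((Num.sqrt m)^-1)%:C)%C (m%:C)%C (M%:C)%C (k%:C)%C (u%:C)%C smC MEC hkC.
move=> t m1 M1 k1 u1 smC MEC hkC.
transitivity (t * t * m1 * b%:R +
  t * t * k1 * (k1 * (M1 * u1 * u1) + k1 * m1 - 2 * k1 * u1 * m1 - 2 * u1 * m1)); first by ring.
rewrite MEC smC mul1r.
have -> : k1 * m1 + k1 * m1 - 2 * k1 * u1 * m1 - 2 * u1 * m1 = 2 * m1 * (k1 - k1 * u1 - u1) by ring.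
by rewrite hkC subrr !mulr0 addr0.
Qed.

End House.
End Indicators.

(** * The wavelet basis *)
Section Wavelets.
Context (R : realType) (p : nat) (p_prime : prime p) (K : padic_field R p).
Context (mu : {sigma_finite_measure set (QpB K) -> \bar R}) (mu_haar : is_haar mu).
Context (V : finType) (U : V -> set (QpB K)) (base : V -> Qp K) (radius : V -> int).
Hypothesis family : disc_family U base radius.
Local Notation q := (p%:R : R).
Local Notation C := R[i].
Local Notation T := (QpB K).
Local Notation Om := (OmegaV U).
Implicit Types (v w : V) (x y z : T) (n : nat).
Local Notation centre := (centre base radius).
Local Notation rad_at := (rad_at radius).
Local Notation XL := (level_cells p_prime mu_haar family).
Local Notation lcell := (lcell U base radius).
Local Notation level := (level XL).

(** The cells are indexed here by all natural numbers, although a and b give the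
    same cell of level n when they are congruent modulo p^n. *)
Definition dcell v n (a : nat) : set T := U v `&` disc (centre v a) (rad_at v n).
Definition valid v a := U v (centre v a).
Definition dmu v n a : R := fine (mu (dcell v n a)).

Lemma dcell_eq v n a b : disc (centre v a) (rad_at v n) (centre v b) ->
  dcell v n a = dcell v n b.
Proof. by move=> ab; rewrite /dcell (disc_eq ab). Qed.

Lemma dcell_mod v n a : dcell v n a = dcell v n (a %% p ^ n).
Proof. apply: dcell_eq; exact: subcentre_mod. Qed.

Lemma dcell_lt v n a : exists2 b : 'I_(p ^ n), (a %% p ^ n)%N = b & dcell v n a = dcell v n b.
Proof.
have ab : (a %% p ^ n < p ^ n)%N by rewrite ltn_mod expn_gt0 prime_gt0.
by exists (Ordinal ab) => //=; exact: dcell_mod.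
Qed.

Lemma dcell_sub v n k a : (n <= k)%N -> dcell v k a `<=` dcell v n a.
Proof.
move=> nk x [Ux ax]; split=> //; apply: disc_le ax => //; exact: rad_at_le.
Qed.

Lemma dcell_Om v n a : dcell v n a `<=` Om.
Proof. by move=> x [Ux _]; exists v. Qed.

Lemma measurable_dcell v n a : measurable (dcell v n a).
Proof.
have [b _ ->] := dcell_lt v n a.
exact: (@measurable_lcell _ _ p_prime _ _ _ _ _ family n (v, b)).
Qed.

Lemma dcell_mu v n a : mu (dcell v n a) = (dmu v n a)%:E.
Proof.
rewrite /dmu fineK//; have [b _ ->] := dcell_lt v n a.
exact: (@lcell_mu_fin _ _ p_prime _ mu mu_haar _ _ _ _ family n (v, b)).
Qed.

Lemma valid_in v n a : valid v a -> dcell v n a (centre v a).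
Proof. by move=> va; split=> //; exact: disc_refl. Qed.

Lemma valid_sub v n a b : valid v a ->
  disc (centre v a) (rad_at v n.+1) (centre v b) -> valid v b.
Proof. by move=> va ab; exact: (lcell_centre p_prime family va ab). Qed.

Lemma valid0 v : valid v 0.
Proof. by rewrite /valid centre0; exact: df_base family v. Qed.

Lemma valid_mod v n a : valid v a -> valid v (a %% p ^ n).
Proof.
case: n => [|n] va; last by apply: (valid_sub (n := n) va); exact: subcentre_mod.
by rewrite modn1; exact: valid0.
Qed.

Lemma dmuS v n a : valid v a -> dmu v n.+1 a = q ^ rad_at v n.+1.
Proof.
move=> va; rewrite /dmu; have -> : dcell v n.+1 a = disc (centre v a) (rad_at v n.+1).
  by rewrite /dcell setIidr//; exact: lcell_centre.
by rewrite haar_disc.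
Qed.

Lemma dmuS_gt0 v n a : valid v a -> 0 < dmu v n.+1 a.
Proof. by move=> va; rewrite dmuS//; exact: pexp_gt0. Qed.

Lemma dcell_disj v n a b : a != b -> (a < p ^ n)%N -> (b < p ^ n)%N ->
  dcell v n a `&` dcell v n b = set0.
Proof.
move=> ab an bn; apply/seteqP; split=> // x [[_ ax] [_ bx]].
by move: ab; rewrite (subcentre_uniq p_prime an bn ax bx) eqxx.
Qed.

(** The child of centre b has positive measure and is disjoint from the child of
    centre a. *)
Lemma dmu_lt v n a b : valid v a -> valid v b -> a != b -> (a < p ^ n.+1)%N -> (b < p ^ n.+1)%N ->
  dcell v n a = dcell v n b -> dmu v n.+1 a < dmu v n a.
Proof.
move=> va vb ab an bn e.
have : ((dmu v n.+1 a + dmu v n.+1 b)%:E <= (dmu v n a)%:E)%E.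
  rewrite EFinD -!dcell_mu -measureU; last 3 first.
  - exact: measurable_dcell.
  - exact: measurable_dcell.
  - exact: dcell_disj.
  apply: le_measure; rewrite ?inE.
  - by apply: measurableU; exact: measurable_dcell.
  - exact: measurable_dcell.
  - by move=> x [|]; [exact: dcell_sub|rewrite e; exact: dcell_sub].
rewrite lee_fin; apply: lt_le_trans; rewrite ltrDl; exact: dmuS_gt0.
Qed.

Lemma dcell_level v n k a x y (c : levelI p V k) : (n <= k)%N ->
  lcell c x -> lcell c y -> dcell v n a x -> dcell v n a y.
Proof.
case: c => w b nk [/= wx bx] [/= wy by_] [vx ax].
have e := df_disjoint family vx wx; subst w; split=> //; apply: (disc_trans ax).
apply: disc_le (disc_trans (disc_sym bx) by_) => //; exact: rad_at_le.
Qed.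

Lemma rind_level v n k a x y (c : levelI p V k) : (n <= k)%N ->
  lcell c x -> lcell c y -> rind R (dcell v n a) x = rind R (dcell v n a) y.
Proof.
move=> nk cx cy; have [ax|nax] := pselect (dcell v n a x).
  by rewrite !rindT//; exact: dcell_level nk cx cy ax.
rewrite !rindF// => ay; apply: nax; exact: dcell_level nk cy cx ay.
Qed.

Lemma measure_Om_fin : (mu Om < +oo)%E.
Proof.
have mOm := measurable_OmegaV (XL 0).
have := step_integral (P := predT) (@cell_meas _ _ _ _ _ _ (XL 0)) (@cell_mu _ _ _ _ _ _ (XL 0))
  (@cell_disj _ _ _ _ _ _ (XL 0)) (v := fun=> 1) (w := fun=> 1) (fun _ _ _ _ => erefl).
by rewrite -OmegaV_cells integral_cst// mul1e => ->; rewrite ltry.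
Qed.

Let mOm : measurable Om := measurable_OmegaV (XL 0).

(** A wavelet is indexed by its vertex v and by an integer a > 0 such that
    centre v a lies in U v.  If p^n <= a < p^(n+1), then the cell of centre a at
    level n+1 is a child, other than the one of the same centre as its parent,
    of the cell of centre a modulo p^n at level n: every nondistinguished cell
    is obtained exactly once. *)
Definition wave_index := {va : V * nat | (0 < va.2)%N && `[< valid va.1 va.2 >]}.
Implicit Types (i j : wave_index).
Definition wv i : V := (val i).1.
Definition wa i : nat := (val i).2.
Definition wn i : nat := trunc_log p (wa i).
Definition w0 i : nat := (wa i %% p ^ wn i)%N.
Definition wcell i : set T := dcell (wv i) (wn i) (wa i).

Definition wave i : T -> C := house (dmu (wv i) (wn i).+1 (wa i)) (dmu (wv i) (wn i) (wa i))
  (dcell (wv i) (wn i).+1 (wa i)) (dcell (wv i) (wn i).+1 (w0 i)) (wcell i).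

Lemma wv_valid i : valid (wv i) (wa i).
Proof. by have /andP[_ /asboolP] := valP i. Qed.

Lemma wa_lt i : (wa i < p ^ (wn i).+1)%N.
Proof. exact/trunc_log_ltn/prime_gt1. Qed.

Lemma wa_ge i : (p ^ wn i <= wa i)%N.
Proof. by apply: trunc_logP; [exact: prime_gt1|have /andP[] := valP i]. Qed.

Lemma w0_lt i : (w0 i < p ^ wn i)%N.
Proof. by rewrite ltn_mod expn_gt0 prime_gt0. Qed.

Lemma w0_lt' i : (w0 i < p ^ (wn i).+1)%N.
Proof. by apply: leq_trans (w0_lt i) _; rewrite leq_exp2l// prime_gt1. Qed.

Lemma wa_neq_w0 i : wa i != w0 i.
Proof. by rewrite neq_ltn (leq_trans (w0_lt i) (wa_ge i)) orbT. Qed.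

Lemma w0_valid i : valid (wv i) (w0 i).
Proof. exact/valid_mod/wv_valid. Qed.

Lemma wcellE i : wcell i = dcell (wv i) (wn i) (w0 i).
Proof. exact: dcell_mod. Qed.

Lemma wave_house i : let v := wv i in let n := wn i in
  [/\ 0 < dmu v n.+1 (wa i), dmu v n.+1 (wa i) < dmu v n (wa i),
      dmu v n.+1 (w0 i) = dmu v n.+1 (wa i),
      dcell v n.+1 (wa i) `<=` wcell i & dcell v n.+1 (w0 i) `<=` wcell i].
Proof.
split.
- exact/dmuS_gt0/wv_valid.
- apply: (dmu_lt (b := w0 i)); [exact: wv_valid|exact: w0_valid|exact: wa_neq_w0
    |exact: wa_lt|exact: w0_lt'|exact: wcellE].
- by rewrite !dmuS//; [exact: wv_valid|exact: w0_valid].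
- exact: dcell_sub.
- by rewrite wcellE; exact: dcell_sub.
Qed.

Lemma waveE i : wave i = house (q ^ rad_at (wv i) (wn i).+1) (dmu (wv i) (wn i) (w0 i))
  (dcell (wv i) (wn i).+1 (wa i)) (dcell (wv i) (wn i).+1 (w0 i))
  (dcell (wv i) (wn i) (w0 i)).
Proof.
rewrite /wave dmuS; last exact: wv_valid.
by rewrite wcellE /dmu -/(wcell i) wcellE.
Qed.

Lemma wave_level i : level (wn i).+1 (wave i).
Proof.
apply: levelP => c x y cx cy; rewrite /wave /house /wcell.
by rewrite !(rind_level _ _ _ cx cy).
Qed.

Lemma wave_supp i x : ~ wcell i x -> wave i x = 0.
Proof.
have [_ _ _ s1 s2] := wave_house i; move=> nx; rewrite /wave /house !rindF//.
- by rewrite mulr0 subrr mulr0 addr0 mulr0.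
- by move/s2.
- by move/s1.
Qed.

Lemma wave_L2 i : L2 mu Om (wave i).
Proof. by have [F wF] := wave_level i; exact: isstep_L2 wF. Qed.

Lemma wave_hyps i :
  [/\ [/\ measurable (dcell (wv i) (wn i).+1 (wa i)), measurable (dcell (wv i) (wn i).+1 (wa i)),
     measurable (dcell (wv i) (wn i).+1 (w0 i)) & measurable (wcell i)],
   [/\ mu (dcell (wv i) (wn i).+1 (wa i)) = (dmu (wv i) (wn i).+1 (wa i))%:E,
     mu (dcell (wv i) (wn i).+1 (w0 i)) = (dmu (wv i) (wn i).+1 (wa i))%:E &
     mu (wcell i) = (dmu (wv i) (wn i) (wa i))%:E] &
   dcell (wv i) (wn i).+1 (wa i) `&` dcell (wv i) (wn i).+1 (w0 i) = set0].
Proof.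
have [_ _ e _ _] := wave_house i; split.
- by split; exact: measurable_dcell.
- by rewrite !dcell_mu e.
- exact: dcell_disj (wa_neq_w0 i) (wa_lt i) (w0_lt' i).
Qed.

Lemma wave_mean i : inner mu Om (fun=> 1) (wave i) = 0.
Proof.
have [m0 mM e s1 s2] := wave_house i; have [ms [mu1 mu0 muA] dj] := wave_hyps i.
apply: (house_mean mOm m0 mM (c' := dcell (wv i) (wn i).+1 (wa i))) => //.
- by split=> //; exact: dcell_Om.
- exact: measure_Om_fin.
Qed.

Lemma inner_disjoint (f g : T -> C) :
  (forall x, Om x -> f x = 0 \/ g x = 0) -> inner mu Om f g = 0.
Proof.
move=> H; rewrite /inner /cintegral /Rintegral.
have e x : x \in Om -> f x * conjc (g x) = 0.
  by move=> /set_mem/H[->|->]; rewrite ?conjc0 ?mul0r ?mulr0.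
rewrite (eq_integral (fun=> 0%E)) => [|x /e -> //].
rewrite [X in Complex _ (fine X)](eq_integral (fun=> 0%E)) => [|x /e -> //].
by rewrite !integral0.
Qed.

(** A wavelet has mean zero on its cell, hence is orthogonal to all functions
    that are constant on the cells of its level. *)
Lemma level_wave_orth (f : T -> C) n i : level n f -> (n <= wn i)%N ->
  inner mu Om f (wave i) = 0.
Proof.
move=> lf ni; have Lf : L2 mu Om f by case: lf => F fF; exact: isstep_L2 fF.
have [F fF] := level_le ni lf.
have w0l : (w0 i < p ^ wn i)%N := w0_lt i.
pose c : levelI p V (wn i) := (wv i, Ordinal w0l).
have cE : lcell c = wcell i by rewrite wcellE.
pose f0 := F c.
have fc x : wcell i x -> f x = f0 by rewrite -cE => /fF.
have L1 : L2 mu Om (fun=> f0).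
  by have lc : level 0 (fun=> f0) by [apply: levelP]; case: lc => F' h; exact: isstep_L2 h.
have Lo : L2 mu Om (fun=> 1).
  by have lc : level 0 (fun=> 1) by [apply: levelP]; case: lc => F' h; exact: isstep_L2 h.
have Lw := wave_L2 i.
transitivity (inner mu Om (fun x => f x - f0) (wave i) + inner mu Om (fun=> f0) (wave i)).
  rewrite -innerDl//; last exact: L2B.
  by apply: eq_inner => // x _; rewrite subrK.
rewrite inner_disjoint ?add0r; last first.
  move=> x _; have [wx|nwx] := pselect (wcell i x); first by left; rewrite fc ?subrr.
  by right; exact: wave_supp.
rewrite (@eq_inner _ _ _ _ _ _ _ (fun x => f0 * (fun=> 1) x) (wave i))//; last first.
  by move=> x _; rewrite mulr1.
by rewrite innerZl// wave_mean mulr0.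
Qed.

Lemma wave_inj i j : wv i = wv j -> wa i = wa j -> i = j.
Proof. by move=> e1 e2; apply: val_inj; move: e1 e2; rewrite /wv /wa; case: (val i) (val j) => ? ? [? ?] /= -> ->. Qed.

Lemma wave_orthonormal i j : inner mu Om (wave i) (wave j) = (i == j)%:R.
Proof.
have lt_case k l : (wn k < wn l)%N -> inner mu Om (wave k) (wave l) = 0.
  by move=> kl; apply: level_wave_orth (wave_level k) kl.
have [ij|ji|e] := ltngtP (wn i) (wn j).
- by rewrite lt_case//; case: eqP ij => // ->; rewrite ltnn.
- rewrite (innerC mOm (wave_L2 j) (wave_L2 i)) lt_case// conjc0.
  by case: eqP ji => // ->; rewrite ltnn.
have [/andP[/eqP ev /eqP e0]|ne] := boolP ((wv i == wv j) && (w0 i == w0 j)); last first.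
  have -> : i == j = false by apply/eqP => h; move: ne; rewrite h !eqxx.
  apply: inner_disjoint => x _; have [wx|nwx] := pselect (wcell i x); last by left; exact: wave_supp.
  right; apply: wave_supp; move: wx; rewrite !wcellE -e => -[vx ax] [vx' ax'].
  have ev := df_disjoint family vx vx'; move: ne; rewrite ev eqxx /= => /negP; apply.
  rewrite -ev in ax'; have l0 : (w0 j < p ^ wn i)%N by rewrite e; exact: w0_lt.
  by apply/eqP; exact: (subcentre_uniq p_prime (w0_lt i) l0 ax ax').
have [m0 mM em s1 s2] := wave_house i; have [[mc _ mc0 mA] [mu1 mu0 muA] dj] := wave_hyps i.
have [n0 nN en t1 t2] := wave_house j; have [[nc _ nc0 nA] [nu1 nu0 nuA] dj'] := wave_hyps j.
have mm : dmu (wv j) (wn j).+1 (wa j) = dmu (wv i) (wn i).+1 (wa i).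
  by rewrite !dmuS; [rewrite e ev|exact: wv_valid|exact: wv_valid].
have AA : wcell j = wcell i by rewrite !wcellE e ev e0.
have MM : dmu (wv j) (wn j) (wa j) = dmu (wv i) (wn i) (wa i).
  by rewrite /dmu -!/(wcell _) AA.
have -> : wave j = house (dmu (wv i) (wn i).+1 (wa i)) (dmu (wv i) (wn i) (wa i))
    (dcell (wv i) (wn i).+1 (wa j)) (dcell (wv i) (wn i).+1 (w0 i)) (wcell i).
  by rewrite /wave mm MM AA -e -ev -e0.
apply: (house_orthonormal mOm m0 mM) => //.
- by split=> //; rewrite ?e ?ev.
- by split=> //; [rewrite e ev -AA|exact: dcell_Om].
- by split=> //; rewrite -?mm ?e ?ev.
- by split=> //; rewrite e ev e0.
- exact: measure_Om_fin.
case: eqP => [->//|/eqP ij]; apply: dcell_disj; last 2 first.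
- exact: wa_lt.
- by rewrite e; exact: wa_lt.
by apply: contra ij => /eqP ea; apply/eqP/wave_inj.
Qed.

End Wavelets.

(** * Wavelets are eigenfunctions *)
Section WaveletEigen.
Context (R : realType) (p : nat) (p_prime : prime p) (K : padic_field R p).
Context (mu : {sigma_finite_measure set (QpB K) -> \bar R}) (mu_haar : is_haar mu).
Context (V : finType) (U : V -> set (QpB K)) (base : V -> Qp K) (radius : V -> int).
Hypothesis family : disc_family U base radius.
Context (G : rel V) (G_sym : symmetric G) (G_refl : reflexive G) (alpha : R).
Local Notation q := (p%:R : R).
Local Notation C := R[i].
Local Notation T := (QpB K).
Local Notation Om := (OmegaV U).
Local Notation rad_at := (rad_at radius).
Local Notation XL := (level_cells p_prime mu_haar family).
Local Notation lcell := (lcell U base radius).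
Local Notation dcell := (dcell U base radius).
Local Notation dmu := (dmu mu U base radius).
Local Notation cm := (lcellm mu U base radius).
Local Notation cr := (@lcellr R p K V base radius _).
Local Notation wcell := (@wcell R p K V U base radius).
Local Notation wave := (@wave R p K mu V U base radius).
Implicit Types (i : wave_index U base radius) (x y : T).

(** D f x is the integral of (f x - f y) kap (dist x y) over the y in the sets
    adjacent to that of x. *)
Definition kap (r : R) : R := 2^-1 * dker alpha r * dker alpha r.

Lemma D_term n (F : levelI p V n -> C) (j : levelI p V n) :
  deltastep G alpha (dstep alpha (X := XL n) F) j =
  \sum_(l : levelI p V n | G j.1 l.1) (F j - F l) * ((kap (cr j l) * cm l)%:C)%C.
Proof.
apply: eq_bigr => l _; rewrite /dstep /kap -!mulrA; congr (_ * _).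
by rewrite -!rmorphM /= !mulrA.
Qed.

Lemma dist_far i x y y' : Om x -> ~ wcell i x -> wcell i y -> wcell i y' ->
  dist x y = dist x y'.
Proof.
move=> [w wx] nx [vy iy] [vy' iy']; rewrite /dist.
have [e|ne] := eqVneq w (wv i); last exact: (df_dist family ne wx wx vy vy').
subst w; have nd : ~ disc (centre base radius (wv i) (wa i)) (rad_at (wv i) (wn i)) x.
  by move=> h; apply: nx.
by rewrite pabs_sub (disc_far iy nd) pabs_sub [RHS]pabs_sub (disc_far iy' nd) pabs_sub.
Qed.

Definition under i (j : levelI p V (wn i).+1) : bool :=
  (j.1 == wv i) && (j.2 %% p ^ wn i == w0 i)%N.

Lemma under_sub i (j : levelI p V (wn i).+1) : under j -> lcell j `<=` wcell i.
Proof.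
case: j => v a /andP[/= /eqP -> /eqP e] x ax; rewrite (wcellE p_prime) -e -(dcell_mod p_prime).
have : dcell (wv i) (wn i).+1 a x by [].
exact: dcell_sub.
Qed.

Lemma under_meet i (j : levelI p V (wn i).+1) x : lcell j x -> wcell i x -> under j.
Proof.
case: j => v a xa; rewrite (wcellE p_prime) => -[vx ix].
have [/= vx' ax] := xa; have e := df_disjoint family vx' vx; subst v.
rewrite /under /= eqxx /=; apply/eqP.
have : dcell (wv i) (wn i) a x by apply: (dcell_sub p_prime (k := (wn i).+1)).
rewrite (dcell_mod p_prime) => -[_ ax'].
apply: (subcentre_uniq p_prime _ (w0_lt p_prime i) ax' ix).
by rewrite ltn_mod expn_gt0 prime_gt0.
Qed.

Lemma cell_empty_m n (j : levelI p V n) : cm j = 0 \/ exists x, lcell j x.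
Proof.
have [ex|nex] := pselect (exists x, lcell j x); first by right.
left; rewrite /lcellm (_ : lcell j = set0) ?measure0//.
by apply/seteqP; split=> // x jx; apply: nex; exists x.
Qed.

Lemma dist_near i (j l : levelI p V (wn i).+1) x y : under j -> under l -> j != l ->
  lcell j x -> lcell l y -> dist x y = q ^ rad_at (wv i) (wn i).
Proof.
move=> uj ul jl jx ly; have [vx ix] := under_sub uj jx; have [vy iy] := under_sub ul ly.
rewrite /dist; apply: (disc_shell p_prime); first exact: disc_trans (disc_sym ix) iy.
move=> xy; move/eqP: jl; apply; apply: (lcell_disj p_prime family (x := y)) => //.
have jv : j.1 = wv i by case/andP: uj => /eqP.
case: jx => _ jx; split; first by rewrite jv.
apply: disc_trans jx _; by move: xy; rewrite jv rad_atS.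
Qed.

Definition wc i : levelI p V (wn i).+1 := (wv i, Ordinal (wa_lt p_prime i)).

Lemma wc_under i : under (wc i).
Proof. by rewrite /under /= !eqxx. Qed.

(** Let A be the cell of the wavelet and x a point of A.  Different children of A
    are all at the same distance, so that kap is constant where the wavelet
    varies; as it has mean zero, A contributes kap times the measure of A.  The
    points outside of A contribute the integral of kap, the same for all x. *)
Definition wave_eigenvalue i : R :=
  kap (q ^ rad_at (wv i) (wn i)) * dmu (wv i) (wn i) (wa i) +
  \sum_(j : levelI p V (wn i).+1 | G (wv i) j.1 && ~~ under j) kap (cr (wc i) j) * cm j.

Lemma wc_meet i : lcell (wc i) (centre base radius (wv i) (wa i)).
Proof. exact: (valid_in p_prime (wn i).+1 (wv_valid i)). Qed.

Lemma far_cr i (j j' l : levelI p V (wn i).+1) : under j -> under j' -> ~~ under l ->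
  (exists x, lcell j x) -> (exists x, lcell j' x) -> (exists x, lcell l x) ->
  cr j l = cr j' l.
Proof.
move=> uj uj' ul [x jx] [x' jx'] [y ly].
have nl k : under k -> k != l by move=> uk; apply: contraNneq ul => <-.
rewrite -(lcell_dist p_prime family (nl _ uj) jx ly).
rewrite -(lcell_dist p_prime family (nl _ uj') jx' ly).
have sy (a b : T) : dist a b = dist b a by rewrite /dist pabs_sub.
rewrite sy [RHS]sy; apply: (@dist_far i).
- by exists l.1; case: ly.
- by move=> iy; move/negP: ul; apply; exact: under_meet ly iy.
- exact: under_sub uj _ jx.
- exact: under_sub uj' _ jx'.
Qed.

Lemma under_mass i : \sum_(j : levelI p V (wn i).+1 | under j) cm j = dmu (wv i) (wn i) (wa i).
Proof.
pose X := XL (wn i).+1.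
have s1 : isstep (X := X) (rind R (wcell i)) (fun j => (under j)%:R).
  move=> j x jx; case: (boolP (under j)) => uj; first by rewrite rindT//; exact: under_sub uj _ jx.
  by rewrite rindF// => ix; move/negP: uj; apply; exact: under_meet jx ix.
have mw : measurable (wcell i) by exact: (measurable_dcell p_prime family).
have := rind_inner mu (measurable_OmegaV X) mw mw.
rewrite (isstep_inner s1 s1) setIid setIidl; last exact: dcell_Om.
move=> h; apply: real_inj; apply: etrans _ h; rewrite rmorph_sum big_mkcond.
apply: eq_bigr => j _ /=; rewrite conjc_nat; case: ifP => _; first by rewrite !mul1r.
by rewrite !mul0r.
Qed.

(** At a point outside of A, the wavelet is integrated against a kernel that is
    constant on A, which gives 0. *)
Lemma wave_eigen i x : Om x ->
  delta_alpha mu U G alpha (d_alpha alpha (wave i)) x = ((wave_eigenvalue i)%:C)%C * wave i x.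
Proof.
move=> Ox; pose X := XL (wn i).+1.
have [F' F'w] := wave_level p_prime mu_haar family i.
pose F (j : levelI p V (wn i).+1) : C := if under j then F' j else 0.
have Fw : isstep (X := X) (wave i) F.
  move=> j y jy; rewrite /F; case: ifP => uj; first exact: F'w jy.
  rewrite (wave_supp p_prime mu_haar family)// => iy; move/negP: uj; apply.
  exact: under_meet jy iy.
have FU j : ~~ under j -> F j = 0 by rewrite /F => /negPf ->.
have z0 : ((0 : R)%:C)%C = 0 :> C by [].
have mean : \sum_(j | under j) F j * ((cm j)%:C)%C = 0.
  have one : isstep (X := X) (fun=> 1 : C) (fun=> 1) by [].
  have := wave_mean p_prime mu_haar family i; rewrite (isstep_inner one Fw) => h.
  apply: (can_inj (@conjcK R)); rewrite conjc0 conjc_sum -[RHS]h big_mkcond /=; apply: eq_bigr => j _; case: ifPn => uj.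
    by rewrite mul1r conjcM conjc_real.
  by rewrite FU// conjc0 mulr0 mul0r.
have [j0 jx] : exists j0 : levelI p V (wn i).+1, lcell j0 x.
  by have [v vx] := Ox; have [a ax] := lcell_exists p_prime family (wn i).+1 vx; exists (v, a).
rewrite (isstep_D (X := X) G alpha Fw jx) (Fw j0 x jx) D_term.
have [uj0|uj0] := boolP (under j0); last first.
  rewrite FU// mulr0 (bigID (@under i)) /= [X in _ + X]big1 ?addr0 => [|l /andP[_ ul]]; last first.
    by rewrite FU// subrr mul0r.
  have [Gj|nGj] := boolP (G j0.1 (wv i)); last first.
    rewrite big_pred0// => l; apply/negP => /andP[Gl /andP[/eqP lv _]].
    by move: nGj; rewrite -lv Gl.
  transitivity (- (((kap (cr (wc i) j0))%:C)%C * \sum_(l | under l) F l * ((cm l)%:C)%C)).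
    rewrite mulr_sumr -sumrN; apply: eq_big => [l|l /andP[_ ul]].
      have [ul|//] := boolP (under l); last by rewrite andbF.
      by have /andP[/eqP -> _] := ul; rewrite Gj.
    rewrite sub0r mulNr; congr (- _); have [m0|lx] := cell_empty_m l.
      by rewrite m0 mulr0 ?z0 ?mulr0.
    rewrite [RHS]mulrCA -rmorphM /= -(@far_cr i l (wc i) j0)//.
    - by rewrite [cr j0 l]lcellr_sym.
    - exact: wc_under.
    - by eexists; exact: wc_meet.
    - by exists x.
  by rewrite mean mulr0 oppr0.
rewrite (bigID (@under i)) /= /wave_eigenvalue rmorphD mulrDl /=; congr (_ + _).
  transitivity (\sum_(l | under l) ((kap (q ^ rad_at (wv i) (wn i)))%:C)%C *
      (F j0 * ((cm l)%:C)%C - F l * ((cm l)%:C)%C)).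
    apply: eq_big => [l|l /andP[_ ul]].
      have [ul|//] := boolP (under l); last by rewrite andbF.
      by have /andP[/eqP -> _] := ul; have /andP[/eqP -> _] := uj0; rewrite G_refl.
    rewrite -mulrBl mulrCA -rmorphM /=.
    have [->|ne] := eqVneq j0 l; first by rewrite subrr !mul0r.
    have [m0|[y ly]] := cell_empty_m l; first by rewrite m0 !mulr0 ?z0 ?mulr0.
    by rewrite -(lcell_dist p_prime family ne jx ly) (dist_near uj0 ul ne jx ly).
  rewrite -mulr_sumr sumrB mean subr0 -mulr_sumr.
  have -> : \sum_(l | @under i l) ((cm l)%:C)%C = ((dmu (wv i) (wn i) (wa i))%:C)%C :> C.
    by rewrite -(under_mass i); apply: esym; exact: (rmorph_sum (real_complex R)).
  by rewrite [F j0 * _]mulrC mulrA -(rmorphM (real_complex R)).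
rewrite rmorph_sum mulr_suml; apply: eq_big => [l|l /andP[_ ul]].
  by have /andP[/eqP -> _] := uj0.
rewrite (FU l ul) subr0 mulrC /=.
have [m0|lx] := cell_empty_m l; first by rewrite m0 !mulr0 z0 mul0r.
rewrite (@far_cr i j0 (wc i) l)//; first exact: wc_under.
  by exists x.
by eexists; exact: wc_meet.
Qed.

End WaveletEigen.

(** * The span of the wavelets *)
Section Span.
Context (R : realType) (T : Type) (Om : set T) (I : eqType) (b : I -> T -> R[i]).
Local Notation C := R[i].

Definition inspan (f : T -> C) := exists (J : seq I) (c : I -> C),
  forall x, Om x -> f x = \sum_(i <- J) c i * b i x.

Lemma span_eq f g : (forall x, Om x -> f x = g x) -> inspan f -> inspan g.
Proof. by move=> fg [J [c fE]]; exists J, c => x Ox; rewrite -fg// fE. Qed.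

Lemma span0 : inspan (fun=> 0).
Proof. by exists [::], (fun=> 0) => x _; rewrite big_nil. Qed.

Lemma span_basis i : inspan (b i).
Proof. by exists [:: i], (fun=> 1) => x _; rewrite big_seq1 mul1r. Qed.

Lemma span_scale a f : inspan f -> inspan (fun x => a * f x).
Proof.
move=> [J [c fE]]; exists J, (fun i => a * c i) => x Ox; rewrite fE// mulr_sumr.
by apply: eq_bigr => i _; rewrite mulrA.
Qed.

Lemma span_add f g : inspan f -> inspan g -> inspan (fun x => f x + g x).
Proof.
move=> [J [c fE]] [J' [c' gE]].
pose e (K : seq I) (d : I -> C) i := d i *+ count_mem i K.
exists (undup (J ++ J')), (fun i => e J c i + e J' c' i) => x Ox.
have ext (K : seq I) (d : I -> C) : {subset K <= J ++ J'} ->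
    \sum_(i <- K) d i * b i x = \sum_(i <- undup (J ++ J')) e K d i * b i x.
  move=> sub; rewrite (sum_undup K d (fun i => b i x)).
  rewrite [RHS](bigID (mem K)) /= [X in _ + X]big1 ?addr0; last first.
    by move=> i /count_memPn c0; rewrite /e c0 mulr0n mul0r.
  rewrite -[RHS]big_filter; apply: perm_big; apply: uniq_perm.
  - exact: undup_uniq.
  - by rewrite filter_uniq// undup_uniq.
  - move=> i; rewrite mem_filter !mem_undup.
    by case: (boolP (i \in K)) => // /sub.
rewrite fE// gE// (ext J c) => [|i iJ]; last by rewrite mem_cat iJ.
rewrite (ext J' c') => [|i iJ]; last by rewrite mem_cat iJ orbT.
by rewrite -big_split /=; apply: eq_bigr => i _; rewrite mulrDl.
Qed.

Lemma span_sum (A : Type) (r : seq A) (P : pred A) (F : A -> T -> C) :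
  (forall a, P a -> inspan (F a)) -> inspan (fun x => \sum_(a <- r | P a) F a x).
Proof.
move=> sF; elim: r => [|a r IH]; first by apply: span_eq span0 => x _; rewrite big_nil.
have [Pa|nPa] := boolP (P a).
  by apply: span_eq (span_add (sF a Pa) IH) => x _; rewrite big_cons Pa.
by apply: span_eq IH => x _; rewrite big_cons (negPf nPa).
Qed.

End Span.

Section WaveletSpan.
Context (R : realType) (p : nat) (p_prime : prime p) (K : padic_field R p).
Context (mu : {sigma_finite_measure set (QpB K) -> \bar R}) (mu_haar : is_haar mu).
Context (V : finType) (U : V -> set (QpB K)) (base : V -> Qp K) (radius : V -> int).
Hypothesis family : disc_family U base radius.
Local Notation q := (p%:R : R).
Local Notation C := R[i].
Local Notation T := (QpB K).
Local Notation Om := (OmegaV U).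
Local Notation rad_at := (rad_at radius).
Local Notation XL := (level_cells p_prime mu_haar family).
Local Notation lcell := (lcell U base radius).
Local Notation dcell := (dcell U base radius).
Local Notation dmu := (dmu mu U base radius).
Local Notation valid := (valid U base radius).
Local Notation wave := (@wave R p K mu V U base radius).
Context (I : eqType) (b : I -> T -> C).
Hypothesis span_block : forall v, inspan Om b (rind R (U v)).
Hypothesis span_wave : forall i, inspan Om b (wave i).

Definition children v n (a : nat) : pred 'I_(p ^ n.+1) :=
  fun c => (c %% p ^ n == a)%N && `[< valid v c >].

Arguments children : clear implicits.

Lemma children_cover v n a x : (a < p ^ n)%N ->
  rind R (dcell v n a) x = \sum_(c | children v n a c) rind R (dcell v n.+1 c) x.
Proof.
move=> an; have mod_eq (c : nat) : dcell v n c x -> dcell v n a x -> (c %% p ^ n)%N = a.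
  rewrite (dcell_mod p_prime _ _ _ v n c) => -[_ cx] [_ ax].
  by apply: (subcentre_uniq p_prime _ an cx ax); rewrite ltn_mod expn_gt0 prime_gt0.
have [ax|nax] := pselect (dcell v n a x); last first.
  rewrite rindF// big1// => c /andP[/eqP ca _]; rewrite rindF// => cx; apply: nax.
  rewrite -ca -(dcell_mod p_prime); exact: dcell_sub cx.
have [vx _] := ax; have [c cx] := lcell_exists p_prime family n.+1 vx.
have cv : valid v c := lcell_meet p_prime family cx.
have cc : children v n a c.
  apply/andP; split; last exact/asboolP.
  by apply/eqP/mod_eq => //; apply: (dcell_sub p_prime (k := n.+1)) => //; exact: cx.
rewrite rindT// (bigD1 c)//= rindT; last exact: cx.
rewrite big1 ?addr0// => c' /andP[_ ne]; rewrite rindF// => -[_ cx'].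
move/eqP: ne; apply; apply: val_inj.
by case: cx => _ cx; exact: (subcentre_uniq p_prime (ltn_ord c') (ltn_ord c) cx' cx).
Qed.

Lemma children_mass v n a : (a < p ^ n)%N ->
  dmu v n a = #|children v n a|%:R * q ^ rad_at v n.+1.
Proof.
move=> an; pose X := XL 0; have mOm := measurable_OmegaV X.
have Ofin := measure_Om_fin p_prime mu_haar family.
have md k c : measurable (dcell v k c) by exact: measurable_dcell.
have h k c : inner mu Om (rind R Om) (rind R (dcell v k c)) = ((dmu v k c)%:C)%C.
  have dO : dcell v k c `<=` Om by exact: dcell_Om.
  by rewrite (rind_inner mu mOm mOm (md k c)) (setIidr dO) (setIidl dO).
apply: real_inj; rewrite -h.
rewrite (@eq_inner _ _ _ _ _ _ _ (rind R Om) (fun x =>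
  \sum_(c | children v n a c) 1 * rind R (dcell v n.+1 c) x)) => [|//|x _]; last first.
  by rewrite children_cover//; apply: eq_bigr => c _; rewrite mul1r.
rewrite (inner_sumr mOm)//; last 2 first.
- by move=> c _; exact: rind_L2.
- exact: rind_L2.
rewrite (eq_bigr (fun=> ((q ^ rad_at v n.+1)%:C)%C)) => [|c /andP[_ /asboolP cv]].
  by rewrite sumr_const rmorphM rmorph_nat mulr_natl.
by rewrite h (dmuS p_prime mu_haar family)// (conjc_nat R 1) mul1r.
Qed.

Lemma wave_of v n (a c : nat) : (a < p ^ n)%N -> (c < p ^ n.+1)%N -> (c %% p ^ n)%N = a ->
  c != a -> valid v c -> exists i : wave_index U base radius,
  [/\ wv i = v, wa i = c, wn i = n & w0 i = a].
Proof.
move=> an cn ca cne cv; have pc : (p ^ n <= c)%N.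
  by rewrite leqNgt; apply/negP => h; move: cne; rewrite -ca modn_small// eqxx.
have c0 : (0 < c)%N by apply: leq_trans pc; rewrite expn_gt0 prime_gt0.
have cP : (0 < (v, c).2)%N && `[< valid (v, c).1 (v, c).2 >] by rewrite c0; apply/asboolP.
pose i : wave_index U base radius := exist _ (v, c) cP.
have nE : wn i = n.
  by apply: trunc_log_eq; [exact: prime_gt1|rewrite pc].
by exists i; split=> //; rewrite /w0 nE.
Qed.

(** The indicator of the distinguished child c0 is recovered from the wavelets
    and the indicator of the parent by summing over all children. *)
Lemma span_dcell v n a : (a < p ^ n)%N -> valid v a -> inspan Om b (rind R (dcell v n a)).
Proof.
elim: n a => [|n IH] a an va.
  apply: span_eq (span_block v) => x _; congr (_ x); congr (rind R _).
  move: an; rewrite expn0 ltnS leqn0 => /eqP ->.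
  rewrite /dcell setIidl// centre0 /rad_at subr0; exact: df_sub family v.
set a0 := (a %% p ^ n)%N.
have a0n : (a0 < p ^ n)%N by rewrite ltn_mod expn_gt0 prime_gt0.
have va0 : valid v a0 by exact: valid_mod.
have sA := IH a0 a0n va0.
pose m := q ^ rad_at v n.+1; pose M := dmu v n a0.
pose u := Num.sqrt (m / M); pose k := u / (1 - u).
have m0 : 0 < m by exact: pexp_gt0.
pose c0 := rind R (dcell v n.+1 a0); pose A := rind R (dcell v n a0).
pose N := #|children v n a0|.
have MN : M = N%:R * m by exact: children_mass.
have a0n1 : (a0 < p ^ n.+1)%N by apply: leq_trans a0n _; rewrite leq_exp2l// prime_gt1.
have ch0 : children v n a0 (Ordinal a0n1).
  by apply/andP; split; [rewrite /= modn_small|apply/asboolP].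
have N0 : (0 < N)%N by apply/card_gt0P; exists (Ordinal a0n1).
have child (c : nat) : (c < p ^ n.+1)%N -> (c %% p ^ n)%N = a0 -> c != a0 -> valid v c ->
    exists2 w, inspan Om b w & forall x, rind R (dcell v n.+1 c) x =
      w x - (k%:C)%C * c0 x + ((k * u)%:C)%C * A x.
  move=> cn ca cne cv; have [i [iv ia in_ i0]] := wave_of a0n cn ca cne cv.
  exists (fun x => ((Num.sqrt m)%:C)%C * wave i x); first exact: span_scale.
  move=> x; rewrite waveE// iv ia in_ i0 /house -/m -/M -/u -/k -/(c0 x) -/(A x).
  rewrite mulrA -realM mulfV ?gt_eqF ?sqrtr_gt0// (real_nat R 1) mul1r.
  by rewrite (realM k u); ring.
pose t := 1 - (N.-1)%:R * k.
(* if there are several children, u^2 = 1 / N and k = u / (1 - u) give t u = -1 *)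
have t0 : t != 0.
  have [N1|N1] := eqVneq N 1%N; first by rewrite /t N1 mul0r subr0 oner_eq0.
  have N2 : (1 < N)%N by rewrite ltn_neqAle eq_sym N1.
  have u2 : u ^+ 2 * N%:R = 1.
    have NR : (N%:R : R) != 0 by rewrite pnatr_eq0 -lt0n.
    have mM : m / M = (N%:R)^-1.
      by rewrite MN invfM mulrCA mulrV ?mulr1// unitfE gt_eqF.
    by rewrite /u mM sqr_sqrtr ?invr_ge0// mulVf.
  have u0 : 0 < u by rewrite sqrtr_gt0 divr_gt0// MN mulr_gt0// ltr0n.
  have u1 : 1 - u != 0.
    rewrite subr_eq0; apply/eqP => u1; move: u2; rewrite -u1 expr1n mul1r => /eqP.
    by rewrite pnatr_eq1 (negPf N1).
  have tE : t * u = -1.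
    have NE : (N.-1)%:R = N%:R - 1 :> R by rewrite -{2}(prednK N0) -natr1 addrK.
    apply: (mulfI (x := u * (1 - u))); first by rewrite mulf_neq0// gt_eqF.
    rewrite /t /k NE.
    have -> : u * (1 - u) * ((1 - (N%:R - 1) * (u / (1 - u))) * u) =
      u ^+ 2 * (1 - u) - u * (u ^+ 2 * N%:R - u ^+ 2) by field.
    by rewrite u2; ring.
  by apply/eqP => t0; move: tE; rewrite t0 mul0r => /eqP; rewrite eq_sym oppr_eq0 oner_eq0.
have sc0 : inspan Om b c0.
  have /choice[w wP] : forall c : 'I_(p ^ n.+1), exists w, c != Ordinal a0n1 -> children v n a0 c ->
      inspan Om b w /\ forall x, rind R (dcell v n.+1 c) x =
      w x - (k%:C)%C * c0 x + ((k * u)%:C)%C * A x.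
    move=> c; have [cc|ncc] := boolP ((c != Ordinal a0n1) && children v n a0 c); last first.
      by exists (fun=> 0) => h1 h2; rewrite h1 h2 in ncc.
    have /andP[cne /andP[/eqP ca /asboolP cv]] := cc.
    by have [w sw wE] := child c (ltn_ord c) ca cne cv; exists w.
  have key x : A x = ((t%:C)%C) * c0 x + (((N.-1)%:R * (k * u))%:C)%C * A x +
      \sum_(c | children v n a0 c && (c != Ordinal a0n1)) w c x.
    rewrite {1}/A children_cover// (bigD1 (Ordinal a0n1))//=.
    rewrite (eq_bigr (fun c => w c x + (- (k%:C)%C * c0 x + ((k * u)%:C)%C * A x))); last first.
      by move=> c /andP[cc cne]; rewrite (wP c cne cc).2; ring.
    rewrite big_split /= sumr_const.
    have -> : #|[pred c | children v n a0 c & c != Ordinal a0n1]| = N.-1.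
      have := cardD1 (Ordinal a0n1) (children v n a0).
      rewrite -[_ \in _]/(children v n a0 (Ordinal a0n1)) ch0 add1n -/N => ->.
      by apply: eq_card => c; rewrite !inE andbC.
    rewrite -mulr_natl /t realB (real_nat R 1) (realM _ (k * u)) (realM k u) (realM (N.-1)%:R k) !real_nat.
    by rewrite -/c0; ring.
  have tc : ((t%:C)%C) != 0 :> C by apply: contra t0 => /eqP/real_inj ->.
  apply: (@span_eq _ _ _ _ _ (fun x => ((t%:C)%C)^-1 * (A x +
      (- (((N.-1)%:R * (k * u))%:C)%C * A x +
      - 1 * \sum_(c | children v n a0 c && (c != Ordinal a0n1)) w c x)))).
    by move=> x _; apply: (mulfI tc); rewrite [LHS]mulrA mulfV// mul1r {1}key; ring.
  apply: span_scale; apply: span_add => //; apply: span_add; first exact: span_scale.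
  apply: span_scale; apply: span_sum => c /andP[cc cne]; exact: (wP c cne cc).1.
have [aa|aa] := eqVneq a a0; first by rewrite aa.
have [w sw wE] := child a an erefl aa va.
apply: (@span_eq _ _ _ _ _ (fun x => w x + (- (k%:C)%C * c0 x + ((k * u)%:C)%C * A x))).
  by move=> x _; rewrite wE; ring.
by apply: span_add => //; apply: span_add; exact: span_scale.
Qed.

Lemma level_span n (f : T -> C) : level XL n f -> inspan Om b f.
Proof.
move=> [F fF].
apply: (@span_eq _ _ _ _ _ (fun x => \sum_(c : levelI p V n) F c * rind R (lcell c) x)).
  move=> x; rewrite (OmegaV_cells (XL n)) => -[c _ cx]; rewrite (fF c x cx).
  rewrite (bigD1 c)//= rindT// mulr1 big1 ?addr0// => c' ne; rewrite rindF ?mulr0// => cx'.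
  by move/eqP: ne; apply; exact: (lcell_disj p_prime family cx' cx).
apply: span_sum => -[v a] _; apply: span_scale.
have [va|nva] := pselect (valid v a); first exact: (@span_dcell v n a).
case: n a nva {F fF} => [|n] a nva.
  case: nva; have -> : (a : nat) = 0%N by case: a => a /=; rewrite expn0 ltnS leqn0 => /eqP.
  exact: valid0.
apply: span_eq (span0 _ _) => x _; rewrite rindF// => cx; apply: nva.
exact: (lcell_meet p_prime family cx).
Qed.

End WaveletSpan.

(** * Lower bounds for the wavelet eigenvalues *)
Section WaveletBounds.
Context (R : realType) (p : nat) (p_prime : prime p) (K : padic_field R p).
Context (mu : {sigma_finite_measure set (QpB K) -> \bar R}) (mu_haar : is_haar mu).
Context (V : finType) (U : V -> set (QpB K)) (base : V -> Qp K) (radius : V -> int).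
Hypothesis family : disc_family U base radius.
Context (G : rel V) (G_refl : reflexive G) (alpha : R) (alpha_gt0 : 0 < alpha).
Local Notation q := (p%:R : R).
Local Notation T := (QpB K).
Local Notation Om := (OmegaV U).
Local Notation rad_at := (rad_at radius).
Local Notation XL := (level_cells p_prime mu_haar family).
Local Notation lcell := (lcell U base radius).
Local Notation dcell := (dcell U base radius).
Local Notation dmu := (dmu mu U base radius).
Local Notation cm := (lcellm mu U base radius).
Local Notation cr := (@lcellr R p K V base radius _).
Local Notation wcell := (@wcell R p K V U base radius).
Local Notation kap := (kap alpha).
Local Notation lam := (wave_eigenvalue p_prime mu G alpha).
Local Notation wc := (wc p_prime).
Implicit Types (i : wave_index U base radius) (x y : T).

Lemma kap_gt0 r : 0 < r -> 0 < kap r.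
Proof. by move=> r0; rewrite /kap !mulr_gt0 ?invr_gt0 ?powR_gt0. Qed.

Lemma kap_anti r s : 0 < r -> r <= s -> kap s <= kap r.
Proof.
move=> r0 rs; have s0 := lt_le_trans r0 rs.
have h : dker alpha s <= dker alpha r.
  rewrite /dker !powRN lef_pV2 ?posrE ?powR_gt0//.
  by apply: ge0_ler_powR; rewrite ?nnegrE// ltW.
have d0 : 0 <= dker alpha s by rewrite powR_ge0.
by rewrite /kap -!mulrA ler_wpM2l ?invr_ge0// ler_pM.
Qed.

Lemma cm_ge0 n (j : levelI p V n) : 0 <= cm j.
Proof. by rewrite fine_ge0. Qed.

Lemma cells_mass n (P : pred (levelI p V n)) (S : set T) : measurable S -> S `<=` Om ->
  (forall j x, lcell j x -> S x <-> P j) -> \sum_(j | P j) cm j = fine (mu S).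
Proof.
move=> mS SO SP; pose X := XL n.
have s1 : isstep (X := X) (rind R S) (fun j => (P j)%:R).
  move=> j x jx; case: (boolP (P j)) => Pj; first by rewrite rindT//; apply/(SP j x jx).
  by rewrite rindF// => /(SP j x jx) Pj'; rewrite Pj' in Pj.
have := rind_inner mu (measurable_OmegaV X) mS mS.
rewrite (isstep_inner s1 s1) setIid (setIidl SO).
move=> h; apply: real_inj; apply: etrans _ h; rewrite real_sum big_mkcond.
apply: eq_bigr => j _ /=; rewrite conjc_nat; case: ifP => _; first by rewrite !mul1r.
by rewrite !mul0r.
Qed.

Lemma cr_bounds i (j : levelI p V (wn i).+1) : j.1 = wv i -> ~~ under j -> (exists x, lcell j x) ->
  0 < cr (wc i) j <= q ^ radius (wv i).
Proof.
move=> jv uj [y jy]; have wx := wc_meet p_prime i.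
have ne : wc i != j by apply: contraNneq uj => <-; exact: wc_under.
rewrite -(lcell_dist p_prime family ne wx jy) /dist; apply/andP; split.
  rewrite pabs_gt0 subr_eq0; apply/eqP => e; move/eqP: ne; apply.
  by apply: (lcell_disj p_prime family wx); rewrite e.
case: wx jy => wx _ [jy _]; rewrite jv in jy.
exact: (disc_trans (disc_sym (df_sub family jy)) (df_sub family wx)).
Qed.

Definition inside i k (j : levelI p V (wn i).+1) : bool :=
  (j.1 == wv i) && (j.2 %% p ^ k == wa i %% p ^ k)%N.

Lemma insideP i k (j : levelI p V (wn i).+1) x : (k <= (wn i).+1)%N -> lcell j x ->
  dcell (wv i) k (wa i) x <-> inside k j.
Proof.
case: j => v a kn jx; have [/= vx _] := jx; split.
  move=> -[vx' ix]; have e := df_disjoint family vx vx'; subst v.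
  rewrite /inside /= eqxx /=; apply/eqP.
  have ax : dcell (wv i) k a x by apply: (dcell_sub p_prime kn).
  have {}ix : dcell (wv i) k (wa i) x by split.
  move: ix ax; rewrite (dcell_mod p_prime _ _ _ _ k (wa i)) (dcell_mod p_prime _ _ _ _ k a).
  move=> [_ ix'] [_ ax'].
  by apply: (subcentre_uniq p_prime _ _ ax' ix'); rewrite ltn_mod expn_gt0 prime_gt0.
move=> /andP[/= /eqP e /eqP ae]; subst v; rewrite (dcell_mod p_prime) -ae -(dcell_mod p_prime).
exact: (dcell_sub p_prime kn).
Qed.

Lemma inside_mass i k : (k <= (wn i).+1)%N ->
  \sum_(j | @inside i k j) cm j = dmu (wv i) k (wa i).
Proof.
move=> kn; apply: (@cells_mass _ _ (dcell (wv i) k (wa i))).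
- exact: measurable_dcell.
- exact: dcell_Om.
- by move=> j x jx; exact: (@insideP i k j x kn jx).
Qed.

Lemma vertex_mass i : \sum_(j : levelI p V (wn i).+1 | j.1 == wv i) cm j = Um mu U (wv i).
Proof.
apply: (@cells_mass _ _ (U (wv i))); first exact: (measurable_U p_prime family).
  by move=> x vx; exists (wv i).
move=> j x [jx _]; split=> [vx|/eqP <-//].
by apply/eqP; exact: (df_disjoint family (jx : U j.1 x) vx).
Qed.

Lemma outside_le i (F : levelI p V (wn i).+1 -> R) :
  (forall j, j.1 = wv i -> ~~ under j -> (exists x, lcell j x) -> F j <= kap (cr (wc i) j)) ->
  \sum_(j : levelI p V (wn i).+1 | (j.1 == wv i) && ~~ under j) F j * cm j <=
  \sum_(j : levelI p V (wn i).+1 | G (wv i) j.1 && ~~ under j) kap (cr (wc i) j) * cm j.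
Proof.
move=> HF; rewrite [leRHS](bigID (fun j : levelI p V (wn i).+1 => j.1 == wv i)) /=.
apply: le_trans (_ : _ <= \sum_(j : levelI p V (wn i).+1 | (j.1 == wv i) && ~~ under j)
   kap (cr (wc i) j) * cm j) _.
  apply: ler_sum => j /andP[/eqP jv uj]; have [m0|ex] := cell_empty_m mu U base radius j.
    by rewrite m0 !mulr0.
  by rewrite ler_wpM2r ?cm_ge0// HF.
have -> : \sum_(j : levelI p V (wn i).+1 | (j.1 == wv i) && ~~ under j) kap (cr (wc i) j) * cm j =
    \sum_(j : levelI p V (wn i).+1 | G (wv i) j.1 && ~~ under j && (j.1 == wv i))
      kap (cr (wc i) j) * cm j.
  apply: eq_bigl => j; case: eqP => [->|]; rewrite ?andbF ?G_refl//=.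
  by rewrite andbT.
rewrite lerDl sumr_ge0// => j _; rewrite mulr_ge0 ?cm_ge0// /kap.
by rewrite !mulr_ge0 ?invr_ge0 ?powR_ge0.
Qed.

(** On U v the kernel is at least its value at the diameter of U v; this bounds
    both parts of the eigenvalue. *)
Lemma wave_gap i : kap (q ^ radius (wv i)) * Um mu U (wv i) <= lam i.
Proof.
rewrite -vertex_mass (bigID (@under _ _ _ _ _ _ _ i)) /= mulrDr lerD//.
  rewrite -(under_mass p_prime mu_haar family i).
  have le1 : kap (q ^ radius (wv i)) <= kap (q ^ rad_at (wv i) (wn i)).
    apply: kap_anti; first exact: pexp_gt0.
    by rewrite pexp_le// -[X in _ <= X]subr0; exact: (rad_at_le radius (wv i) (leq0n (wn i))).
  rewrite (eq_bigl (@under _ _ _ _ _ _ _ i)) => [|j].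
    by rewrite ler_wpM2r// sumr_ge0// => j _; exact: cm_ge0.
  by rewrite /under; case: eqP => //= _; rewrite andbT.
rewrite mulr_sumr; apply: outside_le => j jv uj ex; have /andP[c0 cq] := cr_bounds jv uj ex.
exact: kap_anti.
Qed.

(** The shell of the points at distance p^r from the wavelet has measure
    p^r - p^(r-1), so all shells have the same integral of 1 / dist. *)
Lemma shell_sum i k : (k < wn i)%N -> (0 < k)%N ->
  \sum_(j | @inside i k j && ~~ inside k.+1 j) (cr (wc i) j)^-1 * cm j = 1 - q^-1.
Proof.
move=> kn k0; have kn1 : (k <= (wn i).+1)%N by apply: ltnW; apply: ltnW.
have kn2 : (k.+1 <= (wn i).+1)%N by apply: ltnW.
have wx := wc_meet p_prime i.
have sub j : @inside i k.+1 j -> inside k j.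
  move=> /andP[jv /eqP e]; rewrite /inside jv /=.
  have pk : (p ^ k %| p ^ k.+1)%N by rewrite dvdn_exp2l.
  by rewrite -(modn_dvdm _ pk) e modn_dvdm.
transitivity ((q ^ rad_at (wv i) k)^-1 * \sum_(j | @inside i k j && ~~ inside k.+1 j) cm j).
  rewrite mulr_sumr; apply: eq_bigr => j /andP[ik nik].
  have [m0|[y jy]] := cell_empty_m mu U base radius j; first by rewrite m0 !mulr0.
  have ne : wc i != j by apply: contraNneq nik => <-; rewrite /inside /= !eqxx.
  rewrite -(lcell_dist p_prime family ne wx jy); congr (_^-1 * _).
  have [vy ky] := (insideP kn1 jy).2 ik.
  rewrite /dist; apply: (disc_shell p_prime); first exact: ky.
  by rewrite -rad_atS => h; move/negP: nik; apply; apply/(insideP kn2 jy); split.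
have := inside_mass kn1; rewrite (bigID (@inside i k.+1)) /=.
rewrite (eq_bigl (@inside i k.+1)) => [|j]; last first.
  by have [/sub ->//|] := boolP (inside k.+1 j); rewrite andbF.
have wva := wv_valid i.
rewrite (inside_mass kn2); case: k k0 kn {kn1 kn2 sub} => // k _ kn.
rewrite !(dmuS p_prime mu_haar family)// => h.
have -> : \sum_(j | @inside i k.+1 j && ~~ inside k.+2 j) cm j =
    q ^ rad_at (wv i) k.+1 - q ^ rad_at (wv i) k.+2 by rewrite -h [RHS]addrC addKr.
rewrite (rad_atS radius (wv i) k.+1) pexpD// -[X in X - _]mulr1 -mulrBr mulKf//; last first.
  by rewrite gt_eqF// pexp_gt0.
Qed.

Lemma log_sum i k : (0 < k <= wn i)%N ->
  (k.-1)%:R * (1 - q^-1) <=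
  \sum_(j : levelI p V (wn i).+1 | (j.1 == wv i) && ~~ inside k j) (cr (wc i) j)^-1 * cm j.
Proof.
have ge0 (P : pred (levelI p V (wn i).+1)) : 0 <= \sum_(j | P j) (cr (wc i) j)^-1 * cm j.
  apply: sumr_ge0 => j _; rewrite mulr_ge0 ?cm_ge0// invr_ge0 /lcellr.
  by case: ifP => _; exact: pabs_ge0.
elim: k => [//|[|k] IH] kn; first by rewrite mul0r.
have kn' : (0 < k.+1 <= wn i)%N by move: kn => /= /ltnW.
rewrite (bigID (@inside i k.+1)) /= addrC.
have -> : (k.+1)%:R * (1 - q^-1) = (k.+1.-1)%:R * (1 - q^-1) + (1 - q^-1) :> R.
  by rewrite -natr1 mulrDl mul1r.
have [k1 k1n] := andP kn'.
apply: lerD.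
  apply: le_trans (IH kn') _.
  rewrite le_eqVlt; apply/orP; left; apply/eqP; apply: eq_bigl => j.
  have [ik2|nik2] := boolP (inside k.+2 j); rewrite /= ?andbT ?andbF//.
  have -> : inside k.+1 j.
    move: ik2 => /andP[jv /eqP e]; rewrite /inside jv /=.
    have pk : (p ^ k.+1 %| p ^ k.+2)%N by rewrite dvdn_exp2l.
    by rewrite -(modn_dvdm _ pk) e modn_dvdm.
  by rewrite andbF.
have k2n : (k.+1 < wn i)%N by case/andP: kn.
rewrite -(@shell_sum i k.+1 k2n)//.
rewrite le_eqVlt; apply/orP; left; apply/eqP; apply: eq_bigl => j.
by rewrite /inside; case: eqP => //= _; rewrite andbC.
Qed.

Lemma kap_inv v (r : R) : 2^-1 <= alpha -> 0 < r <= q ^ radius v ->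
  (2^-1 * (q ^ radius v) `^ (1 - 2 * alpha)) * r^-1 <= kap r.
Proof.
move=> a2 /andP[r0 rq]; rewrite /kap /dker -!mulrA ler_wpM2l ?invr_ge0//.
rewrite -powRD; last by apply/implyP => _; rewrite gt_eqF.
have -> : - alpha - alpha = (1 - 2 * alpha) - 1 by ring.
rewrite [leRHS]powRD; last by apply/implyP => _; rewrite gt_eqF.
have -> : r `^ (-1) = r^-1 by rewrite powRN powRr1// ltW.
apply: ler_wpM2r; first by rewrite invr_ge0 ltW.
have -> : 1 - 2 * alpha = - (2 * alpha - 1) by ring.
rewrite !powRN lef_pV2 ?posrE ?powR_gt0 ?pexp_gt0//.
apply: ge0_ler_powR; rewrite ?nnegrE//.
- by rewrite subr_ge0 mulrC -ler_pdivrMr// div1r.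
- exact: ltW.
- by rewrite ltW// pexp_gt0.
Qed.

(** For alpha >= 1/2 the kernel dominates a multiple of 1 / dist on U v, and the
    n-th generation wavelet is surrounded by n - 1 shells within U v. *)
Lemma wave_growth i : 2^-1 <= alpha ->
  (2^-1 * (q ^ radius (wv i)) `^ (1 - 2 * alpha)) * ((wn i)%:R - 1) * (1 - q^-1) <= lam i.
Proof.
move=> a2; set c := 2^-1 * _.
have c0 : 0 <= c by rewrite mulr_ge0 ?invr_ge0 ?powR_ge0.
have q1 : 0 <= 1 - q^-1 by rewrite subr_ge0 invf_le1 ?p_gt0// ltW// p_gt1.
have l0 : 0 <= kap (q ^ rad_at (wv i) (wn i)) * dmu (wv i) (wn i) (wa i).
  by apply: mulr_ge0; [rewrite ltW// kap_gt0 ?pexp_gt0|exact: fine_ge0].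
have [n0|n0] := posnP (wn i).
  apply: (@le_trans _ _ 0).
    by rewrite n0 sub0r mulrN1 mulNr oppr_le0 mulr_ge0.
  apply: le_trans (wave_gap i); apply: mulr_ge0; first by rewrite ltW// kap_gt0 ?pexp_gt0.
  by rewrite ltW// (Um_gt0 p_prime mu_haar family).
apply: (@le_trans _ _ (c * \sum_(j : levelI p V (wn i).+1 | (j.1 == wv i) && ~~ inside (wn i) j)
    (cr (wc i) j)^-1 * cm j)).
  rewrite -mulrA ler_wpM2l//; apply: le_trans (log_sum (k := wn i) _); last by rewrite n0 /=.
  by rewrite -{1}(prednK n0) -natr1 addrK.
apply: (@le_trans _ _ (\sum_(j : levelI p V (wn i).+1 | G (wv i) j.1 && ~~ under j)
    kap (cr (wc i) j) * cm j)); last by rewrite lerDr.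
rewrite mulr_sumr (eq_bigr (fun j => (c * (cr (wc i) j)^-1) * cm j)) => [|j _]; last by rewrite mulrA.
by apply: outside_le => j jv uj ex; apply: kap_inv a2 (cr_bounds jv uj ex).
Qed.

End WaveletBounds.

(** * Heat traces at large times *)
Section HeatLimits.
Context (R : realType).

Lemma pos_lower_bound (V : finType) (F : V -> R) : (forall v, 0 < F v) ->
  exists2 c : R, 0 < c & forall v, c <= F v.
Proof.
move=> F0; exists (1 + \sum_v (F v)^-1)^-1.
  by rewrite invr_gt0 ltr_pwDl// sumr_ge0// => v _; rewrite invr_ge0 ltW.
move=> v; rewrite -[leRHS]invrK lef_pV2 ?posrE ?invr_gt0//; last first.
  by rewrite ltr_pwDl// sumr_ge0// => w _; rewrite invr_ge0 ltW.
rewrite (bigD1 v)//= addrCA lerDl addr_ge0// sumr_ge0// => w _.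
by rewrite invr_ge0 ltW.
Qed.

Lemma expR_decay (c a : R) : 0 < c -> (fun t : R => expR (- (c * t)) * a) @ +oo --> (0 : R).
Proof.
move=> c0; rewrite -[X in _ --> X](mul0r a); apply: cvgMr_tmp.
have h : (fun t : R => c * t) @ +oo --> +oo.
  exact/gt0_cvgMry.
exact: (cvg_comp _ _ h (@cvgr_expR R)).
Qed.

Lemma ler_sum_sub (I : eqType) (s s' : seq I) (F : I -> R) : uniq s -> uniq s' ->
  {subset s <= s'} -> (forall x, 0 <= F x) -> \sum_(x <- s) F x <= \sum_(x <- s') F x.
Proof.
move=> us us' ss F0; have h : perm_eq s [seq x <- s' | x \in s].
  by apply: uniq_perm; rewrite ?filter_uniq// => x; rewrite mem_filter /=; case: (boolP (x \in s)) => //= /ss ->.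
by rewrite (perm_big _ h) big_filter [leRHS](bigID (mem s)) /= lerDl sumr_ge0.
Qed.

(** A uniform spectral gap turns finiteness at one time into exponential decay:
    expR (- lam t) <= expR (- c (t - t0)) expR (- lam t0). *)
Lemma heat_sum_decay (I : choiceType) (lam : I -> R) (c t0 : R) :
  0 < c -> (forall i, c <= lam i) ->
  (\esum_(i in [set: I]) (expR (- (lam i * t0)))%:E < +oo)%E ->
  (fun t : R => \esum_(i in [set: I]) (expR (- (lam i * t)))%:E)%E @ +oo --> 0%E.
Proof.
move=> c0 gap fin0.
have e0 t i : (0 <= (expR (- (lam i * t)))%:E)%E by rewrite lee_fin expR_ge0.
set S := (\esum_(i in _) _)%E in fin0.
have S0 : (0 <= S)%E by apply: esum_ge0.
have SE : S = (fine S)%:E by rewrite fineK// ge0_fin_numE.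
apply: (@squeeze_cvge _ _ _ _ (fun=> 0%E) _
  (fun t => (expR (- (c * t)) * (expR (c * t0) * fine S))%:E)).
- near=> t; apply/andP; split; first exact: esum_ge0.
  have tt : t0 <= t by near: t; apply: nbhs_pinfty_ge; rewrite num_real.
  rewrite mulrA EFinM -SE -esumZ ?mulr_ge0 ?expR_ge0//; apply: le_esum => i _.
  rewrite -EFinM lee_fin -!expRD ler_expR.
  rewrite -subr_ge0 (_ : _ - _ = (lam i - c) * (t - t0)); last by ring.
  by rewrite mulr_ge0 ?subr_ge0.
- exact: cvg_cst.
- apply: cvg_EFin; last exact: expR_decay.
  by near=> t.
Unshelve. all: by end_near. Qed.

Lemma heat_sum_finite (I : finType) (l : I -> R) : (forall i, 0 <= l i) ->
  (fun t : R => \sum_i expR (- (l i * t))) @ +oo --> (#|[pred i | l i == 0]|%:R : R).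
Proof.
move=> l0; rewrite -sum1_card natr_sum big_mkcond /=; apply: cvg_big => [|i _]; first exact: (@add_continuous R).
rewrite inE; have [->|ne] := eqVneq (l i) 0.
  under eq_fun do rewrite mul0r oppr0 expR0.
  exact: cvg_cst.
have lp : 0 < l i by rewrite lt_neqAle eq_sym ne l0.
by have := expR_decay 1 lp; under eq_fun do rewrite mulr1.
Qed.

End HeatLimits.

Section WaveHeat.
Context (R : realType) (p : nat) (p_prime : prime p) (K : padic_field R p).
Context (mu : {sigma_finite_measure set (QpB K) -> \bar R}) (mu_haar : is_haar mu).
Context (V : finType) (U : V -> set (QpB K)) (base : V -> Qp K) (radius : V -> int).
Hypothesis family : disc_family U base radius.
Context (G : rel V) (G_refl : reflexive G) (alpha : R) (alpha_gt0 : 0 < alpha).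
Local Notation q := (p%:R : R).
Local Notation lam := (wave_eigenvalue p_prime mu G alpha).
Implicit Types (i : wave_index U base radius).

Lemma wave_uniform_gap : exists2 c : R, 0 < c & forall i, c <= lam i.
Proof.
have [v|c c0 cF] := @pos_lower_bound R V (fun v => kap alpha (q ^ radius v) * Um mu U v).
  by rewrite mulr_gt0// ?(Um_gt0 p_prime mu_haar family)// kap_gt0// pexp_gt0.
exists c => // i; apply: le_trans (cF (wv i)) _; exact: wave_gap.
Qed.

(** The right-hand side telescopes 1 / a^2 <= 2 (1 / a - 1 / (a + 1)). *)
Lemma sum_inv_sq (A : nat) : \sum_(0 <= a < A) ((a.+1)%:R ^+ 2)^-1 <= 2 - 2 * (A.+1)%:R^-1 :> R.
Proof.
elim: A => [|A IH]; first by rewrite big_nil invr1 mulr1 subrr.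
rewrite big_nat_recr//=; apply: le_trans (lerD IH (lexx _)) _.
rewrite -(natr1 A.+1); set x : R := A.+1%:R; have x1 : 1 <= x by rewrite ler1n.
have x0 : 0 < x by lra.
rewrite -subr_ge0 (_ : _ - _ = (x - 1) / (x ^+ 2 * (x + 1))); last by field; lra.
by rewrite divr_ge0 ?subr_ge0// mulr_ge0 ?exprn_ge0 ?addr_ge0 ?ltW.
Qed.

(** The eigenvalues grow at least like the depth of the wavelet, that is like
    the logarithm of its index a; at large times the terms of the trace are
    thus dominated by those of the series of 1 / a^2. *)
Lemma wave_heat_finite : 2^-1 <= alpha ->
  exists2 t : R, 0 < t &
    (\esum_(i in [set: wave_index U base radius]) (expR (- (lam i * t)))%:E < +oo)%E.
Proof.
move=> a2.
have [v|c c0 cF] := @pos_lower_bound R V (fun v => (2^-1 * (q ^ radius v) `^ (1 - 2 * alpha)) * (1 - q^-1)).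
  rewrite !mulr_gt0 ?invr_gt0 ?powR_gt0 ?pexp_gt0//.
  by rewrite subr_gt0 invf_lt1 ?p_gt0 ?p_gt1.
have lnq : 0 < ln q by rewrite ln_gt0// p_gt1.
(* with this t, exp (- c (n - 1) t) is p^4 / (p^(n+1))^2 *)
pose t := 2 * ln q / c; have t0 : 0 < t by rewrite divr_gt0// mulr_gt0.
exists t => //.
have bound i : expR (- (lam i * t)) <= q ^+ 4 * ((wa i)%:R ^+ 2)^-1.
  have a0 : (0 < wa i)%N by have /andP[] := valP i.
  have ap : (wa i)%:R <= q ^+ (wn i).+1 by rewrite -natrX ler_nat ltnW// wa_lt.
  apply: (@le_trans _ _ (q ^+ 4 * ((q ^+ (wn i).+1) ^+ 2)^-1)); last first.
    rewrite ler_wpM2l ?exprn_ge0// lef_pV2 ?posrE ?exprn_gt0 ?ltr0n// ?prime_gt0//.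
    by rewrite lerXn2r ?nnegrE ?exprn_ge0.
  have -> : q ^+ 4 * ((q ^+ (wn i).+1) ^+ 2)^-1 = expR (- (2 * ln q * ((wn i)%:R - 1))).
    rewrite (_ : - _ = ln q * 4%:R - ln q * ((wn i).+1 * 2)%:R); last first.
      by rewrite natrM -natr1; ring.
    by rewrite expRD expRN !expRM_natr lnK ?posrE ?p_gt0// exprM.
  rewrite ler_expR lerN2 (_ : 2 * ln q * _ = c * ((wn i)%:R - 1) * t); last first.
    by rewrite /t; field; rewrite gt_eqF.
  rewrite ler_wpM2r ?(ltW t0)//.
  have [n0|n0] := posnP (wn i).
    rewrite n0 sub0r mulrN1; apply: (@le_trans _ _ 0); first by rewrite oppr_le0 ltW.
    have [c' c'0 c'l] := wave_uniform_gap; apply: le_trans (c'l i); exact: ltW.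
  apply: le_trans (wave_growth p_prime mu_haar family G_refl alpha_gt0 i a2).
  rewrite -[leRHS]mulrA [_ * (1 - q^-1)]mulrC mulrA ler_wpM2r ?cF//.
  by rewrite subr_ge0 ler1n.
apply: (@le_lt_trans _ _ (\sum_(v : V) (q ^+ 4 * 2))%:E); last exact: ltry.
apply: esum_le_seq => J uJ; rewrite sumEFin lee_fin.
apply: le_trans (ler_sum _ (fun i _ => bound i)) _.
pose F (x : V * nat) : R := q ^+ 4 * ((x.2)%:R ^+ 2)^-1.
pose A := (\max_(i <- J) wa i)%N.
rewrite -(big_map val xpredT F); apply: (@le_trans _ _ (\sum_(x <- [seq (v, a.+1) | v <- enum V, a <- iota 0 A]) F x)).
  apply: ler_sum_sub.
  - by rewrite map_inj_uniq//; exact: val_inj.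
  - by rewrite allpairs_uniq ?enum_uniq ?iota_uniq// => -[v a] [w b] _ _ [-> ->].
  - move=> _ /mapP[i iJ ->]; have a0 : (0 < wa i)%N by have /andP[] := valP i.
    apply/allpairsP; exists (wv i, (wa i).-1); rewrite mem_enum mem_iota /= add0n prednK//.
    by split=> //; [exact: leq_bigmax_seq|exact: surjective_pairing].
  - by move=> x; rewrite mulr_ge0 ?exprn_ge0// invr_ge0 exprn_ge0.
rewrite (big_allpairs_dep (h := fun v a => (v, a.+1))) big_enum /=; apply: ler_sum => v _.
rewrite /F /= -mulr_sumr ler_wpM2l ?exprn_ge0//.
apply: (@le_trans _ _ (2 - 2 * (A.+1)%:R^-1)).
  by rewrite -[A in iota 0 A]subn0; exact: sum_inv_sq.
by rewrite lerBlDr lerDl mulr_ge0 ?invr_ge0.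
Qed.

End WaveHeat.

(** * The operators on block functions *)
Section Blocks.
Context (R : realType) (p : nat) (p_prime : prime p) (K : padic_field R p).
Context (mu : {sigma_finite_measure set (QpB K) -> \bar R}) (mu_haar : is_haar mu).
Context (V : finType) (U : V -> set (QpB K)) (base : V -> Qp K) (radius : V -> int).
Hypothesis family : disc_family U base radius.
Context (E : rel V) (E_sym : symmetric E) (alpha : R).
Context (m : nat) (src tgt : 'I_m -> V) (ori : orientation E src tgt).
Local Notation C := R[i].
Local Notation T := (QpB K).
Local Notation G := (add_loops E).
Local Notation Om := (OmegaV U).
Local Notation OmE := (OmegaE U G).
Local Notation d_alpha := (@d_alpha R p K alpha).
Local Notation delta_alpha := (delta_alpha mu U G alpha).
Local Notation mu2 := (mu2 mu).
Local Notation X0 := (block_cells p_prime mu_haar family).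
Local Notation um := (Um mu U).

Let um_gt0 v : 0 < um v := Um_gt0 p_prime mu_haar family v.

Lemma G_sym : symmetric G.
Proof. by move=> v w; rewrite /add_loops eq_sym E_sym. Qed.

Definition vmass v : R := Num.sqrt (um v).
Definition edge_dist j : R := pabs (base (src j) - base (tgt j)).
Definition edge_weight j : R := dker alpha (edge_dist j) / Num.sqrt 2.
Definition edge_norm j : R := (Num.sqrt 2 * vmass (src j) * vmass (tgt j))^-1.
Definition diff_mx := incidence_mx src tgt vmass edge_weight.

Lemma vmass_gt0 v : 0 < vmass v. Proof. by rewrite sqrtr_gt0. Qed.
Lemma vmass_sq v : vmass v * vmass v = um v. Proof. by rewrite -expr2 sqr_sqrtr// ltW. Qed.
Lemma vmassC_neq0 v : ((vmass v)%:C)%C != 0 :> C.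
Proof. by apply/eqP => /real_inj w0; have := vmass_gt0 v; rewrite w0 ltxx. Qed.

(** vertex_fun u has the coordinates u in the orthonormal basis of the functions
    1_(U v) / vmass v, and edge_fun c the coordinates c in that of the
    antisymmetrized indicators of U (src j) x U (tgt j). *)
Definition vertex_coef (u : 'rV[C]_#|V|) v : C := u 0 (enum_rank v) * (((vmass v)^-1)%:C)%C.
Definition vertex_fun (u : 'rV[C]_#|V|) : T -> C := fun x =>
  \sum_v vertex_coef u v * rind R (U v) x.

Definition edge_coef (c : 'rV[C]_m) v w : C := \sum_j c 0 j *
  (((edge_norm j)%:C)%C * (((v == src j) && (w == tgt j))%:R - ((v == tgt j) && (w == src j))%:R)).
Definition edge_fun (c : 'rV[C]_m) : T * T -> C := fun z =>
  \sum_v \sum_w edge_coef c v w * (rind R (U v) z.1 * rind R (U w) z.2).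

Lemma rind_U v w x : U v x -> rind R (U w) x = (w == v)%:R.
Proof.
move=> vx; case: eqP => [->|ne]; first by rewrite rindT.
by rewrite rindF// => wx; apply: ne; exact: (df_disjoint family wx vx).
Qed.

Lemma vertex_funE u v x : U v x -> vertex_fun u x = vertex_coef u v.
Proof.
move=> vx; rewrite /vertex_fun (bigD1 v)//= big1 ?addr0 => [|w /negPf wv].
  by rewrite (rind_U v vx) eqxx mulr1.
by rewrite (rind_U w vx) wv mulr0.
Qed.

Lemma edge_funE c v w x y : U v x -> U w y -> edge_fun c (x, y) = edge_coef c v w.
Proof.
move=> vx wy; rewrite /edge_fun (bigD1 v)//= [X in _ + X]big1 ?addr0 => [|v' /negPf ne]; last first.
  by rewrite big1// => w' _; rewrite (rind_U v' vx) ne mul0r mulr0.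
rewrite (bigD1 w)//= [X in _ + X]big1 ?addr0 => [|w' /negPf ne]; last first.
  by rewrite (rind_U w' wy) ne !mulr0.
by rewrite (rind_U v vx) (rind_U w wy) !eqxx !mulr1.
Qed.

Lemma vertex_fun_step u : isstep (X := X0) (vertex_fun u) (vertex_coef u).
Proof. by move=> v x vx; exact: vertex_funE. Qed.

Lemma edge_fun_step c : isstep2 (X := X0) G (edge_fun c) (edge_coef c).
Proof. by move=> v w x y _ vx wy; exact: edge_funE. Qed.

Lemma vertex_fun_L2 u : L2 mu Om (vertex_fun u).
Proof. exact: isstep_L2 (vertex_fun_step u). Qed.
Lemma edge_fun_L2 c : L2 mu2 OmE (edge_fun c).
Proof. exact: isstep2_L2 (edge_fun_step c). Qed.

Lemma vertex_fun_inner u u' :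
  inner mu Om (vertex_fun u) (vertex_fun u') = \sum_i u 0 i * conjc (u' 0 i).
Proof.
rewrite (isstep_inner (vertex_fun_step u) (vertex_fun_step u')).
rewrite [RHS](reindex enum_rank) /=; last exact/onW_bij/enum_rank_bij.
apply: eq_bigr => v _; rewrite /vertex_coef /= conjcM conjc_real.
set a := u _ _; set b := conjc _.
transitivity (a * b * (((vmass v)^-1 * (vmass v)^-1 * um v)%:C)%C).
  by rewrite -(vmass_sq v) !realM; ring.
rewrite -(vmass_sq v) (_ : (vmass v)^-1 * _ * _ = 1 :> R); first by rewrite (real_nat R 1) mulr1.
by field; rewrite gt_eqF// vmass_gt0.
Qed.

Lemma edge_coef_anti c v w : edge_coef c v w = - edge_coef c w v.
Proof.
rewrite /edge_coef -sumrN; apply: eq_bigr => j _; rewrite -!mulrN opprB.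
by rewrite [(w == src j) && _]andbC [(w == tgt j) && _]andbC.
Qed.

Lemma edge_coef_diag c v : edge_coef c v v = 0.
Proof.
rewrite /edge_coef big1// => j _.
by rewrite [(v == tgt j) && _]andbC subrr !mulr0.
Qed.

Lemma edge_coef_edge c j : edge_coef c (src j) (tgt j) = c 0 j * ((edge_norm j)%:C)%C.
Proof.
rewrite /edge_coef (bigD1 j)//= big1 ?addr0 => [|i ij].
  by rewrite !eqxx /= (negPf (src_neq_tgt ori j)) subr0 mulr1.
have -> : (src j == src i) && (tgt j == tgt i) = false.
  by apply/negP => /andP[/eqP a /eqP b]; case/eqP: ij; exact: (orient_inj ori).
have -> : (src j == tgt i) && (tgt j == src i) = false.
  by apply/negP => /andP[/eqP a /eqP b]; exact: (orient_simple ori a b).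
by rewrite subrr !mulr0.
Qed.

Lemma G_edge j : G (src j) (tgt j).
Proof. by apply/orP; right; apply/(orient_edge ori); exists j; left. Qed.

Lemma edge_fun_inner c c' :
  inner mu2 OmE (edge_fun c) (edge_fun c') = \sum_j c 0 j * conjc (c' 0 j).
Proof.
rewrite (isstep2_inner (edge_fun_step c) (edge_fun_step c')) /=.
have pick (X : V -> V -> C) a b : G a b ->
    \sum_v \sum_(w | G v w) ((v == a) && (w == b))%:R * X v w = X a b.
  move=> Gab; rewrite (bigD1 a)//= [X in _ + X]big1 ?addr0 => [|v /negPf va]; last first.
    by rewrite big1// => w _; rewrite va mul0r.
  rewrite (bigD1 b)//= [X in _ + X]big1 ?addr0 => [|w /andP[_ /negPf wb]]; last first.
    by rewrite wb andbF mul0r.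
  by rewrite !eqxx mul1r.
pose X v w := conjc (edge_coef c' v w) * ((um v * um w)%:C)%C.
transitivity (\sum_j c 0 j * ((edge_norm j)%:C)%C * (X (src j) (tgt j) - X (tgt j) (src j))).
  transitivity (\sum_j \sum_v \sum_(w | G v w) c 0 j * ((edge_norm j)%:C)%C *
      (((v == src j) && (w == tgt j))%:R * X v w - ((v == tgt j) && (w == src j))%:R * X v w)).
    rewrite exchange_big; apply: eq_bigr => v _; rewrite exchange_big; apply: eq_bigr => w _.
    rewrite /edge_coef !mulr_suml; apply: eq_bigr => j _; rewrite /X; ring.
  apply: eq_bigr => j _.
  rewrite -(pick X _ _ (G_edge j)) -(pick X (tgt j) (src j)); last by rewrite G_sym G_edge.
  rewrite -sumrB mulr_sumr; apply: eq_bigr => v _.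
  by rewrite -sumrB mulr_sumr.
apply: eq_bigr => j _; rewrite /X [edge_coef c' (tgt j) _]edge_coef_anti edge_coef_edge.
rewrite conjcN conjcM conjc_real [um (tgt j) * _]mulrC; set a := c 0 j; set b := conjc _.
transitivity (a * b * ((2 * edge_norm j * edge_norm j * (um (src j) * um (tgt j)))%:C)%C).
  by apply: complex_eq; rewrite !partE /=; ring.
rewrite (_ : 2 * _ * _ * _ = 1 :> R); first by rewrite (real_nat R 1) mulr1.
rewrite /edge_norm -!vmass_sq.
set r := Num.sqrt 2; have r0 : 0 < r by rewrite sqrtr_gt0.
have <- : r * r = 2 by rewrite -expr2 sqr_sqrtr.
by field; rewrite !gt_eqF ?vmass_gt0.
Qed.

(** In the orthonormal bases of the normalized indicators of the sets U v and of
    the antisymmetrized indicators of the blocks, d is the incidence matrix. *)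
Lemma d_vertex_fun u z : OmE z -> d_alpha (vertex_fun u) z = edge_fun (u *m diff_mx) z.
Proof.
case: z => x y [v [w [Gvw /= vx wy]]].
rewrite (@isstep2_d _ _ _ _ _ _ G alpha X0 _ _ (vertex_fun_step u) v w x y Gvw vx wy).
rewrite (edge_funE _ vx wy).
have key j : dstep (X := X0) alpha (vertex_coef u) (src j) (tgt j) =
    edge_coef (u *m diff_mx) (src j) (tgt j).
  rewrite edge_coef_edge mxE (reindex enum_rank) /=; last exact/onW_bij/enum_rank_bij.
  rewrite (eq_bigr (fun v => u 0 (enum_rank v) *
    ((incidence src tgt vmass edge_weight v j)%:C)%C)) => [|v' _]; last by rewrite mxE enum_rankK.
  rewrite (sum_incidence ori) /dstep /vertex_coef /edge_weight /edge_norm /=.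
  rewrite -/(edge_dist j); set k := dker _ _; set a := u _ _; set b := u _ _.
  have s0 := vmass_gt0 (src j); have t0 := vmass_gt0 (tgt j).
  set r := Num.sqrt 2; have q0 : 0 < r by rewrite sqrtr_gt0.
  have q2 : r * r = 2 by rewrite -expr2 sqr_sqrtr.
  have e1 : (vmass (src j))^-1 * (2^-1 * k) =
      k / r * vmass (tgt j) * (r * vmass (src j) * vmass (tgt j))^-1.
    by rewrite -q2; field; rewrite !gt_eqF.
  have e2 : (vmass (tgt j))^-1 * (2^-1 * k) =
      k / r * vmass (src j) * (r * vmass (src j) * vmass (tgt j))^-1.
    by rewrite -q2; field; rewrite !gt_eqF.
  rewrite mulrBl -![_ * (_%:C)%C * (_%:C)%C]mulrA -!realM e1 e2 !realM; ring.
have [e|ne] := eqVneq v w; first by rewrite e edge_coef_diag dstep_diag.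
have /orP[/eqP//|] := Gvw; first by move=> e; rewrite e eqxx in ne.
move=> /(orient_edge ori)[j [] [<- <-]]; first exact: key.
by rewrite dstep_anti key -edge_coef_anti.
Qed.

Lemma diff_mx_real i j : conjc (diff_mx i j) = diff_mx i j.
Proof. by rewrite mxE conjc_real. Qed.

(** The matrix of delta is found by adjunction. *)
Lemma delta_edge_fun c x : Om x -> delta_alpha (edge_fun c) x = vertex_fun (c *m diff_mx^T) x.
Proof.
move=> [v vx]; pose F := deltastep (X := X0) G alpha (edge_coef c).
have dF : isstep (X := X0) (delta_alpha (edge_fun c)) F.
  exact: (isstep_delta alpha (edge_fun_step c) (edge_coef_diag c)).
rewrite (dF v x vx) (vertex_funE _ vx).
have := step_adjoint G_sym alpha (vertex_fun_step (delta_mx 0 (enum_rank v)))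
  (edge_fun_step c) (edge_coef_diag c) (fun i j _ => edge_coef_anti c i j).
rewrite (eq_inner mu2 (d_vertex_fun (delta_mx 0 (enum_rank v))) (fun z _ => erefl (edge_fun c z))).
rewrite edge_fun_inner (isstep_inner (vertex_fun_step _) dF).
rewrite [RHS](bigD1 v)//= [X in _ + X]big1 ?addr0 => [|w /negPf wv]; last first.
  rewrite /vertex_coef mxE /= (inj_eq enum_rank_inj) wv !mul0r; by [].
rewrite /vertex_coef [(c *m diff_mx^T) _ _]mxE [delta_mx _ _ _ _]mxE !eqxx mul1r -(vmass_sq v).
rewrite (_ : ((_ * _)%:C)%C = ((vmass v)%:C)%C * ((vmass v)%:C)%C); last exact: realM.
move=> h; have v0 := vmassC_neq0 v.
have {h} : conjc (F v) * ((vmass v)%:C)%C = \sum_j (diff_mx (enum_rank v) j) * conjc (c 0 j).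
  rewrite -rowE in h; transitivity (\sum_j row (enum_rank v) diff_mx 0 j * conjc (c 0 j)).
    rewrite h.
    have -> : (((vmass v)^-1)%:C)%C = ((vmass v)%:C)%C^-1 :> C by exact: fmorphV.
    by field.
  by apply: eq_bigr => j _; rewrite mxE.
move=> /(congr1 conjc); rewrite conjcM conjcK conjc_real conjc_sum => h.
have -> : (((vmass v)^-1)%:C)%C = ((vmass v)%:C)%C^-1 :> C by exact: fmorphV.
apply: (mulIf v0); rewrite h divfK//; apply: eq_bigr => j _.
by rewrite conjcM conjcK diff_mx_real mulrC [diff_mx^T _ _]mxE.
Qed.

Lemma G_OmV x y : OmE (x, y) -> Om x /\ Om y.
Proof. by move=> [v [w [_ vx wy]]]; split; [exists v|exists w]. Qed.

Lemma d_alpha_congr f f' z : (forall x, Om x -> f x = f' x) -> OmE z ->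
  d_alpha f z = d_alpha f' z.
Proof. by case: z => x y ff' /G_OmV[Ox Oy]; rewrite !d_alphaE !ff'. Qed.

Lemma delta_alpha_congr h h' x : (forall z, OmE z -> h z = h' z) ->
  delta_alpha h x = delta_alpha h' x.
Proof.
move=> hh'; rewrite /Defs.delta_alpha /cintegral; congr Complex;
  by apply: eq_Rintegral => y /set_mem[_ xy]; rewrite hh'.
Qed.

Lemma delta_d_vertex_fun u x : Om x ->
  delta_alpha (d_alpha (vertex_fun u)) x = vertex_fun (u *m (diff_mx *m diff_mx^T)) x.
Proof.
move=> Ox; rewrite mulmxA -delta_edge_fun//.
by apply: delta_alpha_congr => z; exact: d_vertex_fun.
Qed.

Lemma d_delta_edge_fun c z : OmE z ->
  d_alpha (delta_alpha (edge_fun c)) z = edge_fun (c *m (diff_mx^T *m diff_mx)) z.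
Proof.
move=> Oz; rewrite mulmxA -d_vertex_fun//.
by apply: d_alpha_congr => // x; exact: delta_edge_fun.
Qed.

Lemma vertex_fun_lin (I : finType) (a : I -> C) (u : I -> 'rV[C]_#|V|) x :
  vertex_fun (\sum_i a i *: u i) x = \sum_i a i * vertex_fun (u i) x.
Proof.
rewrite /vertex_fun [RHS](eq_bigr (fun i => \sum_v a i * (vertex_coef (u i) v * rind R (U v) x))).
  rewrite exchange_big; apply: eq_bigr => v _; rewrite /vertex_coef summxE !mulr_suml.
  by apply: eq_bigr => i _; rewrite mxE !mulrA.
by move=> i _; rewrite mulr_sumr.
Qed.

Lemma edge_fun_lin (I : finType) (a : I -> C) (c : I -> 'rV[C]_m) z :
  edge_fun (\sum_i a i *: c i) z = \sum_i a i * edge_fun (c i) z.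
Proof.
have coef v w : edge_coef (\sum_i a i *: c i) v w = \sum_i a i * edge_coef (c i) v w.
  rewrite [RHS](eq_bigr (fun i => \sum_j a i * (c i 0 j * (((edge_norm j)%:C)%C *
    (((v == src j) && (w == tgt j))%:R - ((v == tgt j) && (w == src j))%:R))))) => [|i _].
    rewrite exchange_big; apply: eq_bigr => j _; rewrite summxE mulr_suml.
    by apply: eq_bigr => i _; rewrite mxE !mulrA.
  by rewrite mulr_sumr.
rewrite /edge_fun [RHS](eq_bigr (fun i => \sum_v \sum_w
  a i * (edge_coef (c i) v w * (rind R (U v) z.1 * rind R (U w) z.2)))) => [|i _].
  rewrite [RHS]exchange_big; apply: eq_bigr => v _; rewrite [RHS]exchange_big; apply: eq_bigr => w _.
  transitivity (\sum_i a i * (edge_coef (c i) v w * (rind R (U v) z.1 * rind R (U w) z.2))); last by [].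
  by rewrite coef mulr_suml; apply: eq_bigr => i _; rewrite [RHS]mulrA.
by rewrite mulr_sumr; apply: eq_bigr => v _; rewrite mulr_sumr.
Qed.

Lemma vertex_fun_scale a u x : vertex_fun (a *: u) x = a * vertex_fun u x.
Proof. by have := @vertex_fun_lin 'I_1 (fun=> a) (fun=> u) x; rewrite !big_ord1. Qed.

Lemma edge_fun_scale a c z : edge_fun (a *: c) z = a * edge_fun c z.
Proof. by have := @edge_fun_lin 'I_1 (fun=> a) (fun=> c) z; rewrite !big_ord1. Qed.

Lemma L2rho_edge_fun c : L2rho mu U G (edge_fun c).
Proof.
split; last by move=> v w Gvw; exists (edge_coef c v w) => x y vx wy; exact: edge_funE.
split; first exact: edge_fun_L2.
move=> x y [v [w [_ /= vx wy]]].
by rewrite (edge_funE c vx wy) (edge_funE c wy vx) edge_coef_anti.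
Qed.

(** A block-constant antisymmetric function vanishes on the blocks U v x U v that
    come from the loops. *)
Lemma edge_fun_surj h : L2rho mu U G h -> exists c, forall z, OmE z -> h z = edge_fun c z.
Proof.
move=> [[_ ha] hc]; have b v := df_base family v.
pose c : 'rV[C]_m := \row_j (h (base (src j), base (tgt j)) / ((edge_norm j)%:C)%C).
exists c => -[x y] [v [w [Gvw /= vx wy]]]; rewrite (edge_funE c vx wy).
have hb v' w' x' y' : G v' w' -> U v' x' -> U w' y' -> h (x', y') = h (base v', base w').
  by move=> /hc[k kE] vx' wy'; rewrite !kE.
rewrite (hb v w)//; have anti v' w' : G v' w' -> h (base v', base w') = - h (base w', base v').
  by move=> Gvw'; apply: ha; exists v', w'.
have key j : h (base (src j), base (tgt j)) = edge_coef c (src j) (tgt j).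
  rewrite edge_coef_edge mxE divfK//; apply/eqP => /real_inj/eqP; apply/negP.
  by rewrite invr_neq0// !mulf_neq0// gt_eqF ?vmass_gt0// sqrtr_gt0.
have [e|ne] := eqVneq v w.
  subst w; rewrite edge_coef_diag; have := anti v v Gvw; set k := h _ => /eqP.
  by rewrite -addr_eq0 -mulr2n mulrn_eq0 => /eqP.
have /orP[/eqP e|] := Gvw; first by rewrite e eqxx in ne.
move=> /(orient_edge ori)[j [] [e1 e2]]; first by rewrite -e1 -e2.
by rewrite anti// edge_coef_anti -e1 -e2 key.
Qed.

End Blocks.

(** * The spectrum on edge functions *)
Section UnitaryRows.
Context (R : realType).
Local Notation C := R[i].
Local Open Scope sesquilinear_scope.

Lemma unitary_rows n (P : 'M[C]_n) i k : P *m P ^t* = 1%:M ->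
  \sum_j row i P 0 j * conjc (row k P 0 j) = (i == k)%:R.
Proof.
move=> /matrixP/(_ i k); rewrite !mxE => <-; apply: eq_bigr => j _.
by rewrite !mxE.
Qed.

Lemma unitary_expand n (P : 'M[C]_n) (u : 'rV[C]_n) : P ^t* *m P = 1%:M ->
  u = \sum_k (\sum_j u 0 j * conjc (row k P 0 j)) *: row k P.
Proof.
move=> PP; rewrite -{1}[u]mulmx1 -PP mulmxA mulmx_sum_row; apply: eq_bigr => k _.
congr (_ *: _); rewrite mxE; apply: eq_bigr => j _.
by rewrite !mxE.
Qed.

Lemma mul_adj_vec n (u w : 'rV[C]_n) : (u *m w ^t*) 0 0 = \sum_j u 0 j * conjc (w 0 j).
Proof. by rewrite mxE; apply: eq_bigr => j _; rewrite !mxE. Qed.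

End UnitaryRows.

Section FiniteSpectrum.
Context (R : realType) (p : nat) (p_prime : prime p) (K : padic_field R p).
Context (mu : {sigma_finite_measure set (QpB K) -> \bar R}) (mu_haar : is_haar mu).
Context (V : finType) (U : V -> set (QpB K)) (base : V -> Qp K) (radius : V -> int).
Hypothesis family : disc_family U base radius.
Context (E : rel V) (E_sym : symmetric E) (alpha : R).
Context (m : nat) (src tgt : 'I_m -> V) (ori : orientation E src tgt).
Hypothesis connected : forall v w, connect E v w.
Hypothesis V_gt0 : (0 < #|V|)%N.
Local Open Scope sesquilinear_scope.
Local Notation C := R[i].
Local Notation T := (QpB K).
Local Notation G := (add_loops E).
Local Notation Om := (OmegaV U).
Local Notation OmE := (OmegaE U G).
Local Notation d_alpha := (@d_alpha R p K alpha).
Local Notation delta_alpha := (delta_alpha mu U G alpha).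
Local Notation mu2 := (mu2 mu).
Local Notation X0 := (block_cells p_prime mu_haar family).
Local Notation vf := (vertex_fun mu U).
Local Notation ef := (edge_fun mu U src tgt).
Local Notation M := (diff_mx mu U base alpha src tgt).

Let mOm : measurable Om := measurable_OmegaV X0.
Let mOE : measurable OmE := measurable_OmegaE G X0.
Let ef_inner := edge_fun_inner p_prime mu_haar family E_sym ori.
Let vf_inner := vertex_fun_inner p_prime mu_haar family.
Let ef_L2 := edge_fun_L2 p_prime mu_haar family E src tgt.
Let vf_L2 := vertex_fun_L2 p_prime mu_haar family.
Let delta_ef := delta_edge_fun p_prime mu_haar family E_sym alpha ori.
Let d_delta_ef := d_delta_edge_fun p_prime mu_haar family E_sym alpha ori.

Lemma diff_mx_adj : M ^t* = M^T.
Proof. by apply/matrixP => i j; rewrite !mxE; exact: conjc_real. Qed.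

Lemma diff_mxT_adj : M^T ^t* = M.
Proof. by apply/matrixP => i j; rewrite !mxE; exact: conjc_real. Qed.

Lemma rank_diff_mx : (\rank M).+1 = #|V|.
Proof.
apply: (rank_incidence_mx ori connected) => //.
  exact: (vmass_gt0 p_prime mu_haar family).
move=> j; rewrite mulf_neq0 ?invr_neq0 ?gt_eqF ?sqrtr_gt0// powR_gt0//.
rewrite pabs_gt0 subr_eq0; apply/eqP => e; move/eqP: (src_neq_tgt ori j); apply.
by apply: (df_disjoint family (df_base family _)); rewrite e; exact: df_base family _.
Qed.

Lemma vertex_spectral : exists (P : 'M[C]_#|V|) (l : 'I_#|V| -> R),
  [/\ P *m P ^t* = 1%:M, P ^t* *m P = 1%:M, forall k, 0 <= l k,
      forall k, row k P *m (M *m M^T) = ((l k)%:C)%C *: row k P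
    & #|[pred k | l k == 0]| = 1%N].
Proof.
have [P [l [P1 P2 l0 Pl card]]] := gram_spectral M; exists P, l; split=> // [k|].
  by apply/rowP => j; rewrite -row_mul mxE -diff_mx_adj Pl !mxE.
by rewrite card; have := rank_diff_mx; lia.
Qed.

Lemma edge_spectral : exists (P : 'M[C]_m) (l : 'I_m -> R),
  [/\ P *m P ^t* = 1%:M, P ^t* *m P = 1%:M, forall k, 0 <= l k,
      forall k, row k P *m (M^T *m M) = ((l k)%:C)%C *: row k P
    & #|[pred k | l k == 0]| = (m.+1 - #|V|)%N].
Proof.
have [P [l [P1 P2 l0 Pl card]]] := gram_spectral M^T; exists P, l; split=> // [k|].
  by apply/rowP => j; rewrite -row_mul mxE -{2}diff_mxT_adj Pl !mxE.
by rewrite card mxrank_tr; have := rank_diff_mx; lia.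
Qed.

(** On block functions the operator is the Hermitian matrix M^T M. *)
Lemma Delta_rho_sym h k h' k' : L2 mu2 OmE k -> L2 mu2 OmE k' ->
  Delta_rho mu U G alpha h k -> Delta_rho mu U G alpha h' k' ->
  inner mu2 OmE k h' = inner mu2 OmE h k'.
Proof.
have red h1 k1 : L2 mu2 OmE k1 -> Delta_rho mu U G alpha h1 k1 -> exists c,
    (forall z, OmE z -> h1 z = ef c z) /\
    forall g, L2 mu2 OmE g -> inner mu2 OmE k1 g = inner mu2 OmE (ef (c *m (M^T *m M))) g.
  move=> Lk [/(edge_fun_surj p_prime mu_haar family ori)[c hc] kd]; exists c; split=> // g Lg.
  apply: inner_ae => //; apply: filterS kd => z kz Oz; rewrite (kz Oz) -d_delta_ef//.
  by apply: d_alpha_congr Oz => x _; exact: delta_alpha_congr.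
move=> Lk Lk' D1 D2; have [c [hc kc]] := red _ _ Lk D1; have [c' [hc' kc']] := red _ _ Lk' D2.
have Lh : L2 mu2 OmE h by case: D1 => -[[]].
have Lh' : L2 mu2 OmE h' by case: D2 => -[[]].
rewrite (innerC mOE Lk' Lh) kc// kc'// -(innerC mOE _ Lh)//.
rewrite (eq_inner mu2 (fun z _ => erefl) hc') (eq_inner mu2 hc (fun z _ => erefl)) !ef_inner.
rewrite -!mul_adj_vec !trmx_mul !map_mxM.
by rewrite -!mulmxA -[map_mx _ M^T]/(M^t*) -[map_mx _ M^T^T]/(M^T ^t*) diff_mx_adj diff_mxT_adj.
Qed.

Section EdgeBasis.
Context (P : 'M[C]_m) (l : 'I_m -> R).
Hypothesis PPt : P *m P ^t* = 1%:M.
Hypothesis PtP : P ^t* *m P = 1%:M.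
Hypothesis Pl : forall k, row k P *m (M^T *m M) = ((l k)%:C)%C *: row k P.

Definition edge_basis k := ef (row k P).

Lemma edge_basis_orthonormal i k :
  inner mu2 OmE (edge_basis i) (edge_basis k) = (i == k)%:R.
Proof. by rewrite ef_inner unitary_rows. Qed.

Lemma edge_basis_expand c z :
  ef c z = \sum_k inner mu2 OmE (ef c) (edge_basis k) * edge_basis k z.
Proof.
rewrite {1}(unitary_expand c PtP) edge_fun_lin; apply: eq_bigr => k _.
by rewrite ef_inner.
Qed.

Lemma edge_eigenbasis :
  orthonormal_eigenbasis mu2 OmE (L2rho mu U G) (Delta_rho mu U G alpha) edge_basis l.
Proof.
split.
- by move=> k; exact: (L2rho_edge_fun p_prime mu_haar family).
- exact: edge_basis_orthonormal.
- move=> h e /(edge_fun_surj p_prime mu_haar family ori)[c hc] e0.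
  exists (index_enum 'I_m), (fun k => inner mu2 OmE (ef c) (edge_basis k)).
  rewrite (@eq_sqnorm _ _ _ _ _ _ (fun=> 0)).
    by rewrite sqnormE integral0_eq ?lte_fin// => z _; rewrite sqmod0.
  by move=> z Oz; rewrite hc// edge_basis_expand subrr.
- move=> k; split; first exact: (L2rho_edge_fun p_prime mu_haar family).
  apply: eq_ae => z Oz; rewrite d_delta_ef// Pl.
  by rewrite edge_fun_scale.
Qed.

Lemma delta_edge_basis0 k : l k = 0 -> row k P *m M^T = 0.
Proof.
move=> lk; apply: mul_adj_eq0; rewrite trmx_mul map_mxM.
rewrite -[map_mx _ M^T^T]/(M^T ^t*) diff_mxT_adj mulmxA -(mulmxA (row k P)).
by rewrite Pl lk (_ : (0%:C)%C = 0)// scale0r mul0mx.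
Qed.

Lemma vertex_fun_ae0 u : ae_on mu Om (vf u) (fun=> 0) -> u = 0.
Proof.
move=> u0; apply: mul_adj_eq0; apply/matrixP => i j; rewrite !ord1 mul_adj_vec -vf_inner.
by rewrite (inner_ae mOm (vf_L2 u) (L2_0 mu Om) (vf_L2 u) u0) inner0l// mxE.
Qed.

(** The kernel of delta on the block functions is spanned by the eigenvectors
    of eigenvalue 0, because |delta h|^2 = <d delta h, h>. *)
Lemma ker_delta_rho_dim :
  has_dim mu2 OmE (ker_delta_rho mu U G alpha) #|[pred k | l k == 0]|.
Proof.
pose A := [pred k | l k == 0].
apply: (has_dim_orthonormal mOE (e := fun i : 'I_#|A| => edge_basis (enum_val i))).
- by move=> h [[[]]].
- move=> i; split; first exact: (L2rho_edge_fun p_prime mu_haar family).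
  apply: eq_ae => x Ox; rewrite delta_ef//.
  have /eqP li := enum_valP i; rewrite (delta_edge_basis0 li).
  by case: Ox => v vx; rewrite (vertex_funE mu family _ vx) /vertex_coef mxE mul0r.
- by move=> i j; rewrite edge_basis_orthonormal (inj_eq enum_val_inj).
move=> h [/(edge_fun_surj p_prime mu_haar family ori)[c hc] dh].
have c0 : c *m M^T = 0.
  apply: vertex_fun_ae0; apply: filterS dh => x dhx Ox; rewrite -(delta_ef c Ox) -(dhx Ox).
  by apply: delta_alpha_congr => z Oz; rewrite hc.
have orth k : l k != 0 -> inner mu2 OmE (ef c) (edge_basis k) = 0.
  move=> lk; have lkc : ((l k)%:C)%C != 0 :> C by apply: contra lk => /eqP/real_inj ->.
  apply: (mulfI lkc); rewrite mulr0 ef_inner -mul_adj_vec.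
  transitivity ((c *m (row k P *m (M^T *m M)) ^t*) 0 0).
    rewrite Pl linearZ /= map_mxZ -scalemxAr [RHS]mxE; congr (_ * _).
    exact: esym (conjc_real _).
  rewrite !trmx_mul !map_mxM -[map_mx _ M^T]/(M^t*) diff_mx_adj.
  by rewrite !mulmxA c0 !mul0mx mxE.
apply: eq_ae => z Oz; rewrite hc// edge_basis_expand (bigID A) /= [X in _ + X]big1 ?addr0; last first.
  by move=> k lk; rewrite orth// mul0r.
rewrite [LHS](big_enum_val (A := A)).
by apply: eq_bigr => k _; rewrite (eq_inner mu2 hc (fun z _ => erefl)).
Qed.

End EdgeBasis.

End FiniteSpectrum.

(** * The spectrum on vertex functions *)
Section VertexSpectrum.
Context (R : realType) (p : nat) (p_prime : prime p) (K : padic_field R p).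
Context (mu : {sigma_finite_measure set (QpB K) -> \bar R}) (mu_haar : is_haar mu).
Context (V : finType) (U : V -> set (QpB K)) (base : V -> Qp K) (radius : V -> int).
Hypothesis family : disc_family U base radius.
Context (E : rel V) (E_sym : symmetric E) (alpha : R).
Context (m : nat) (src tgt : 'I_m -> V) (ori : orientation E src tgt).
Local Open Scope sesquilinear_scope.
Local Notation C := R[i].
Local Notation T := (QpB K).
Local Notation G := (add_loops E).
Local Notation Om := (OmegaV U).
Local Notation OmE := (OmegaE U G).
Local Notation d_alpha := (@d_alpha R p K alpha).
Local Notation delta_alpha := (delta_alpha mu U G alpha).
Local Notation mu2 := (mu2 mu).
Local Notation XL := (level_cells p_prime mu_haar family).
Local Notation vf := (vertex_fun mu U).
Local Notation M := (diff_mx mu U base alpha src tgt).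
Local Notation wave := (@wave R p K mu V U base radius).
Local Notation lam := (wave_eigenvalue p_prime mu G alpha).
Local Notation waves := (wave_index U base radius).

Let mOm : measurable Om := measurable_OmegaV (XL 0).
Let Ofin := measure_Om_fin p_prime mu_haar family.
Let G_sym' : symmetric G := G_sym E_sym.
Let vf_inner := vertex_fun_inner p_prime mu_haar family.
Let vf_L2 := vertex_fun_L2 p_prime mu_haar family.
Let lcL := loc_const_level p_prime mu_haar family.

Lemma G_refl : reflexive G.
Proof. by move=> v; rewrite /add_loops eqxx. Qed.

Lemma loc_const_D f g : loc_const U f -> loc_const U g -> loc_const U (fun x => f x + g x).
Proof.
move=> lf lg x Ox; have [k fk] := lf x Ox; have [l gl] := lg x Ox.
exists (Num.min k l) => y Oy xy; rewrite fk ?gl// (le_trans xy)// pexp_le// ge_min lexx//.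
by rewrite orbT.
Qed.

Lemma loc_const_Z c f : loc_const U f -> loc_const U (fun x => c * f x).
Proof. by move=> lf x Ox; have [k fk] := lf x Ox; exists k => y Oy xy; rewrite fk. Qed.

Lemma loc_const_disc x k : loc_const U (rind R (disc x k : set T)).
Proof.
move=> y Oy; exists k => z Oz yz.
have yz' : disc y k z by rewrite /disc /= pabs_sub.
have [xy|nxy] := pselect (disc x k y).
  by rewrite !rindT//; exact: disc_trans yz'.
by rewrite !rindF// => xz; apply: nxy; exact: disc_trans (disc_sym yz').
Qed.

(** The empty set is added to have a generator stable under intersections. *)
Lemma discs_generate : @measurable _ T = <<s [set A | is_disc A \/ A = set0] >>.
Proof.
apply/seteqP; split.
  by apply: sub_sigma_algebra2 => A; left.
apply: smallest_sub; first exact: smallest_sigma_algebra.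
move=> A [dA|->]; first exact: sub_sigma_algebra.
exact: (@measurable0 _ T).
Qed.

Lemma discs_setI : setI_closed ([set A | is_disc A \/ A = set0] : set (set T)).
Proof.
move=> A B [[x [k ->]]|->] [[y [l ->]]|->]; rewrite ?set0I ?setI0; try by right.
have [[z [xz yz]]|e] := pselect ((disc x k `&` disc y l) !=set0); last first.
  by right; apply/seteqP; split=> // z xyz; apply: e; exists z.
left; have [kl|lk] := leP k l.
  by rewrite setIidl; [exists x, k|exact: disc_nested kl xz yz].
by rewrite setIidr; [exists y, l|exact: disc_nested (ltW lk) yz xz].
Qed.

Lemma loc_const_dense f : L2 mu Om f -> forall e : R, 0 < e ->
  exists2 g, loc_const U g & (sqnorm mu Om (fun x => f x - g x)%R < e%:E)%E.
Proof.
apply: (L2_dense mOm Ofin _ _ _ discs_generate discs_setI).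
- by move=> g; exact: (lc_L2 lcL).
- exact: loc_const_D.
- exact: loc_const_Z.
- move=> A [[x [k ->]]|->]; first exact: loc_const_disc.
  by move=> x Ox; exists 0 => y _ _; rewrite !indicE !in_set0.
- by move=> x Ox; exists 0.
Qed.

Lemma vertex_fun_level u n : level XL n (vf u).
Proof.
apply: levelP => -[v a] x y [/= vx _] [/= vy _].
by rewrite (vertex_funE mu family u vx) (vertex_funE mu family u vy).
Qed.

Lemma vertex_fun_lc u : loc_const U (vf u).
Proof. exact: level_loc_const (vertex_fun_level u 0). Qed.

Lemma wave_lc i : loc_const U (wave i).
Proof. exact: level_loc_const (wave_level p_prime mu_haar family i). Qed.

Section VertexBasis.
Context (P : 'M[C]_#|V|) (l : 'I_#|V| -> R).
Hypothesis PPt : P *m P ^t* = 1%:M.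
Hypothesis PtP : P ^t* *m P = 1%:M.
Hypothesis Pl : forall k, row k P *m (M *m M^T) = ((l k)%:C)%C *: row k P.

Definition full_basis (i : 'I_#|V| + waves) : T -> C :=
  match i with inl k => vf (row k P) | inr w => wave w end.
Definition full_eigenvalue (i : 'I_#|V| + waves) : R :=
  match i with inl k => l k | inr w => lam w end.

Lemma full_basis_lc i : loc_const U (full_basis i).
Proof. by case: i => [k|w]; [exact: vertex_fun_lc|exact: wave_lc]. Qed.

Lemma full_basis_L2 i : L2 mu Om (full_basis i).
Proof. exact: (lc_L2 lcL (full_basis_lc i)). Qed.

Lemma full_basis_orthonormal i j :
  inner mu Om (full_basis i) (full_basis j) = (i == j)%:R.
Proof.
have orth k w : inner mu Om (vf (row k P)) (wave w) = 0.
  exact: level_wave_orth (vertex_fun_level _ 0) (leq0n _).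
case: i j => [k|w] [k'|w'] /=; rewrite ?orth//.
- by rewrite vf_inner unitary_rows.
- transitivity (conjc (inner mu Om (vf (row k' P)) (wave w))); last by rewrite orth conjc0.
  exact: (innerC mOm (vf_L2 _) (full_basis_L2 (inr w))).
- exact: (wave_orthonormal p_prime mu_haar family).
Qed.

Lemma full_basis_D i x : Om x ->
  delta_alpha (d_alpha (full_basis i)) x = ((full_eigenvalue i)%:C)%C * full_basis i x.
Proof.
case: i => [k|w] Ox /=; last exact: (wave_eigen p_prime mu_haar family G_refl).
by rewrite (delta_d_vertex_fun p_prime mu_haar family E_sym alpha ori)// Pl vertex_fun_scale.
Qed.

Lemma loc_const_span f : loc_const U f -> inspan Om full_basis f.
Proof.
move=> /lcL[n /(_ n (leqnn n))]; apply: level_span => [v|w]; last exact: (span_basis _ _ (inr w)).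
pose u : 'rV[C]_#|V| := ((vmass mu U v)%:C)%C *: delta_mx 0 (enum_rank v).
apply: (@span_eq _ _ _ _ _ (vf u)).
  move=> x [w wx]; rewrite (vertex_funE mu family u wx) (rind_U family v wx).
  rewrite /vertex_coef !mxE eqxx /= (inj_eq enum_rank_inj) eq_sym.
  case: eqP => [->|_]; last by rewrite mulr0 mul0r.
  by rewrite mulr1 -realM mulfV ?(real_nat R 1)// gt_eqF// (vmass_gt0 p_prime mu_haar family).
rewrite (unitary_expand u PtP).
apply: (@span_eq _ _ _ _ _ (fun x => \sum_k (\sum_j u 0 j * conjc (row k P 0 j)) * vf (row k P) x)).
  by move=> x _; rewrite -vertex_fun_lin.
apply: span_sum => k _; apply: span_scale; exact: (span_basis _ _ (inl k)).
Qed.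

Lemma full_basis_dense f : L2 mu Om f -> forall e : R, 0 < e ->
  exists (J : seq ('I_#|V| + waves)) (c : 'I_#|V| + waves -> C),
    (sqnorm mu Om (fun x => f x - \sum_(i <- J) c i * full_basis i x)%R < e%:E)%E.
Proof.
move=> Lf e e0; have [g lg fg] := loc_const_dense Lf e0.
have [J [c gE]] := loc_const_span lg; exists J, c.
by rewrite (@eq_sqnorm _ _ _ _ _ _ (fun x => f x - g x)) => // x Ox; rewrite gE.
Qed.

Lemma full_eigenbasis :
  orthonormal_eigenbasis mu Om (L2 mu Om) (D_closed mu U G alpha) full_basis full_eigenvalue.
Proof.
split.
- exact: full_basis_L2.
- exact: full_basis_orthonormal.
- by move=> f e Lf e0; exact: full_basis_dense.
- move=> i; apply: (D_closed_lc lcL); first exact: full_basis_lc.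
  by move=> x Ox; exact: full_basis_D.
Qed.

Lemma d_vertex_basis0 k z : l k = 0 -> OmE z -> d_alpha (vf (row k P)) z = 0.
Proof.
move=> lk Oz; rewrite (d_vertex_fun p_prime mu_haar family alpha ori)//.
have -> : row k P *m M = 0.
  apply: mul_adj_eq0; rewrite trmx_mul map_mxM -[map_mx _ M^T]/(M^t*) diff_mx_adj.
  by rewrite mulmxA -(mulmxA (row k P)) Pl lk (_ : (0%:C)%C = 0)// scale0r mul0mx.
by rewrite -(scale0r (0 : 'rV_m)) edge_fun_scale mul0r.
Qed.

(** Elements of the kernel are orthogonal to the eigenfunctions of nonzero
    eigenvalue, hence by completeness combinations of the remaining ones. *)
Lemma ker_d_dim : (forall w : waves, lam w != 0) ->
  has_dim mu Om (ker_d mu U G alpha) #|[pred k | l k == 0]|.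
Proof.
move=> lam0; pose A := [pred k | l k == 0].
apply: (has_dim_orthonormal mOm (e := fun i : 'I_#|A| => full_basis (inl (enum_val i)))).
- by move=> f [].
- move=> i; have /eqP li := enum_valP i; split.
  + exact: full_basis_L2.
  + exact: (L2_0 mu2 OmE).
  + exists (fun=> full_basis (inl (enum_val i))); split=> [_||].
    * exact: full_basis_lc.
    * exact: const_cvg.
    * by apply: const_cvg => z; exact: d_vertex_basis0.
- move=> i j; rewrite full_basis_orthonormal.
  by rewrite -[inl _ == inl _]/(enum_val i == enum_val j) (inj_eq enum_val_inj).
move=> f kf; have Lf : L2 mu Om f by case: kf.
have orth i : full_eigenvalue i != 0 -> inner mu Om f (full_basis i) = 0.
  move=> li; apply: (ker_d_orthogonal G_sym' lcL kf (full_basis_lc i) _ (full_basis_D i)).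
  by apply: contra li => /eqP/real_inj ->.
pose s x := \sum_(i < #|A|) inner mu Om f (full_basis (inl (enum_val i))) *
  full_basis (inl (enum_val i)) x.
have Ls : L2 mu Om s by apply: L2_sum => // i _; apply: L2Z => //; exact: full_basis_L2.
have Lr : L2 mu Om (fun x => f x - s x) by exact: L2B.
apply/(sqnrm0_ae mOm Lf Ls).
have := parseval mOm full_basis_L2 full_basis_orthonormal Lr (full_basis_dense Lr).
rewrite esum1 => [[]//|j _]; congr (_%:E).
rewrite innerBl//; last exact: full_basis_L2.
rewrite (inner_suml mOm)//; last 2 first.
- by move=> i _; exact: full_basis_L2.
- exact: full_basis_L2.
under eq_bigr do rewrite full_basis_orthonormal.
have [lj|lj] := eqVneq (full_eigenvalue j) 0; last first.
  rewrite orth// big1 ?subrr ?sqmod0// => i _; case: eqP => [e|_]; last by rewrite mulr0.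
  by have /eqP li := enum_valP i; move: lj; rewrite -e /= li eqxx.
case: j lj => [k|w] /= lj; last by move: (lam0 w); rewrite lj eqxx.
have kA : k \in A by apply/eqP.
rewrite (bigD1 (enum_rank_in kA k))//= enum_rankK_in// eqxx mulr1.
rewrite big1 ?addr0 ?subrr ?sqmod0// => i ne; case: eqP => [[e]|_]; last by rewrite mulr0.
by move/eqP: ne; case; apply: enum_val_inj; rewrite enum_rankK_in.
Qed.

End VertexBasis.
End VertexSpectrum.

(** * The index *)
Theorem corollary5p1 (R : realType) (p : nat) (p_prime : prime p)
  (K : padic_field R p)
  (mu : {sigma_finite_measure set (QpB K) -> \bar R}) (mu_haar : is_haar mu)
  (g : nat) (g_gt0 : (0 < g)%N)
  (Gam : set 'M[Qp K]_2) (Gam_schottky : schottky_group Gam)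
  (gam : 'I_g -> 'M[Qp K]_2) (D : holes K g)
  (D_good : good_fundamental_domain D Gam gam)
  (s : hole g -> Qp K)
  (s_hole : forall h, h != outer D -> open_hole D h (Some (s h)))
  (V : finType) (B : V -> set (Qp K)) (B_inj : injective B)
  (B_vertices : range B = [set A | TF_vertex D s A])
  (U_neq0 : forall v, holed_disc D B v !=set0)
  (E_simple : simple_attachment D)
  (E_connected : forall v w, connect (reduction_graph D B) v w)
  (alpha : R) (alpha_gt0 : 0 < alpha) :
  let E := reduction_graph D B in
  let G := add_loops E in
  let U : V -> set (QpB K) := holed_disc D B in
  exists (ind : int) (trD trDelta : R -> \bar R),
    [/\ is_index mu U G alpha ind,
        is_heat_trace_D mu U G alpha trD,
        is_heat_trace_Delta mu U G alpha trDelta,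
        (* for alpha < 1/2 the trace of the heat kernel of D^alpha is +oo at
           every t *)
        (2^-1 <= alpha \/ exists2 t : R, 0 < t & (trD t < +oo)%E) ->
          (fun t : R => trD t - trDelta t)%E @ +oo --> (ind%:~R : R)%:E
      & ind = 1 - g%:Z /\ 1 - g%:Z = euler_char E].
Proof.
move=> E G U.
have disj := gfd_disjoint D_good.
have E_sym : symmetric E := reduction_graph_sym D B.
have V_gt0 := card_V_gt0 p_prime disj s_hole B_vertices.
have [m [src [tgt [ori mE]]]] :=
  orientation_exists p_prime g_gt0 disj s_hole B_inj B_vertices U_neq0 E_simple.
pose bs := base U_neq0; pose rd := radius B_vertices U_neq0.
have family : disc_family U bs rd.
  split.
  - exact: base_U.
  - by move=> v x vx; have := U_sub vx; rewrite (B_disc B_vertices U_neq0).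
  - by move=> v x; exact: (U_subdisc p_prime disj s_hole).
  - by move=> v w x; exact: (U_disjoint p_prime B_inj B_vertices U_neq0).
  - by move=> v w x y x' y'; exact: (U_dist p_prime disj s_hole B_inj B_vertices U_neq0).
have [P [l [P1 P2 l0 Pl lz]]] :=
  vertex_spectral p_prime mu_haar family alpha ori E_connected V_gt0.
have [P' [l' [P1' P2' l0' Pl' lz']]] :=
  edge_spectral p_prime mu_haar family alpha ori E_connected V_gt0.
have gE : (m.+1 - #|V| = g)%N by rewrite mE addKn.
pose lam := wave_eigenvalue p_prime mu G alpha (U := U) (base := bs) (radius := rd).
have [c0 c0_gt0 gap] := wave_uniform_gap p_prime mu_haar family (G_refl E) alpha_gt0.
have lam0 i : lam i != 0 by rewrite gt_eqF// (lt_le_trans c0_gt0)// gap.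
have basisD := full_eigenbasis p_prime mu_haar family E_sym ori P1 P2 Pl.
have basisE := edge_eigenbasis p_prime mu_haar family E_sym ori P1' P2' Pl'.
pose X := level_cells p_prime mu_haar family.
have mOm : measurable (OmegaV U) := measurable_OmegaV (X 0%N).
have mOE : measurable (OmegaE U G) := measurable_OmegaE G (X 0%N).
have trD := heat_traceP mOm (fun f Lf => Lf) (fun f k f' k' _ _ _ _ Dk Dk' =>
  D_closed_sym (G_sym E_sym) (loc_const_level p_prime mu_haar family) Dk Dk') basisD.
have trE := heat_traceP mOE (fun f (Lf : L2rho mu U G f) => Lf.1.1) (fun f k f' k' _ _ Lk Lk' Dk Dk' =>
  Delta_rho_sym p_prime mu_haar family E_sym ori Lk Lk' Dk Dk') basisE.
exists (1 - g%:Z); eexists; eexists; split; [|exact: trD|exact: trE| |split=> //]; last first.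
- by rewrite (euler_char_orientation ori); lia.
- pose W (t : R) := (\esum_(i in [set: wave_index U bs rd]) (expR (- (lam i * t)))%:E)%E.
  have pos (I : Type) (a : I -> R) t i : (0 <= (expR (- (a i * t)))%:E)%E.
    by rewrite lee_fin expR_ge0.
  have trE_split (t : R) : (\esum_(i in [set: 'I_#|V| + wave_index U bs rd])
      (expR (- (full_eigenvalue p_prime mu E alpha l i * t)))%:E =
      (\sum_k expR (- (l k * t)))%:E + W t)%E.
    by rewrite esum_sumType// esum_finType// sumEFin.
  move=> fin; have [t0 Wt0] : exists t0, (W t0 < +oo)%E.
    case: fin => [a2|[t t_gt0]].
      by have [t0 _ h] := wave_heat_finite p_prime mu_haar family (G_refl E) alpha_gt0 a2; exists t0.
    rewrite trE_split => h; exists t; apply: le_lt_trans h; rewrite leeDr// lee_fin.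
    by rewrite sumr_ge0// => k _; exact: expR_ge0.
  have cW := heat_sum_decay c0_gt0 gap Wt0.
  have cl := heat_sum_finite l0; have cl' := heat_sum_finite l0'.
  rewrite lz in cl; rewrite lz' gE in cl'.
  have -> : (fun t : R => (\esum_(i in [set: 'I_#|V| + wave_index U bs rd])
      (expR (- (full_eigenvalue p_prime mu E alpha l i * t)))%:E -
      \esum_(k in [set: 'I_m]) (expR (- (l' k * t)))%:E)%E) =
    (fun t => ((\sum_k expR (- (l k * t)) - \sum_k expR (- (l' k * t)))%:E + W t)%E).
    apply/funext => t; rewrite trE_split esum_finType// sumEFin EFinB.
    by rewrite addeAC.
  have -> : ((1 - g%:Z)%:~R : R)%:E = ((1 - g%:R)%:E + 0)%E :> \bar R.
    by rewrite adde0 rmorphB.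
  apply: cvgeD => //; apply: cvg_EFin; first by near=> t.
  exact: cvgB cl cl'.
exists 1%N, g; split=> //.
- by have := ker_d_dim mu_haar family E_sym ori P1 P2 Pl lam0; rewrite lz.
- by have := ker_delta_rho_dim p_prime mu_haar family E_sym ori P1' P2' Pl'; rewrite lz' gE.
Unshelve. all: by end_near. Qed.
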